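(* Let $E,E_0,E_1$ be r.i. spaces, $b\in SV(0,1)$, $1<p_0<p_1<\infty$ and $\alpha,\beta<1$, with $(1+u)^{\beta-1}\in E_1$. Put $$\rho(u)=u^{\frac1{p_0}-\frac1{p_1}}\frac{\ell^{\alpha-1}(u)\,\varphi_{E_0}(\ell(u))}{\|\ell^{\beta-1}(t)\|_{\widetilde E_1(0,u)}},\qquad u\in(0,1).$$ (a) If $0<\theta<1$, then $\big(B_{p_0,\alpha,E_0},A_{p_1,\beta,E_1}\big)_{\theta,b,E}=L_{p,B_\theta,E}$, where $\frac1p=\frac{1-\theta}{p_0}+\frac{\theta}{p_1}$ and $B_\theta(u)=\big(\ell^{\alpha-1}(u)\varphi_{E_0}(\ell(u))\big)^{1-\theta}\|\ell^{\beta-1}(t)\|^{\theta}_{\widetilde E_1(0,u)}\,b(\rho(u))$, $u\in(0,1)$. (b) If $\theta=0$, then $$\big(B_{p_0,\alpha,E_0},A_{p_1,\beta,E_1}\big)_{0,b,E}=L^{\mathcal L}_{p_0,B_0,E,\ell^{\alpha-1}(u),L_\infty}\cap L^{\mathcal L,\mathcal L}_{p_0,\,b\circ\rho,\,E,\,1,\,E_0,\,\ell^{\alpha-1}(u),\,L_\infty},$$ where $B_0(u)=\varphi_{E_0}(\ell(u))\,b(\rho(u))$, $u\in(0,1)$. (c) If $\theta=1$ and $\|b\|_{\widetilde E(0,1)}<\infty$, then $$\big(B_{p_0,\alpha,E_0},A_{p_1,\beta,E_1}\big)_{1,b,E}=L^{\mathcal R}_{p_1,B_1,E,1,L_1}\cap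 L^{\mathcal R,\mathcal R}_{p_1,\,b\circ\rho,\,E,\,\ell^{\beta-1}(u),\,E_1,\,1,\,L_1},$$ where $B_1(u)=\|\ell^{\beta-1}(t)\|_{\widetilde E_1(0,u)}\,b(\rho(u))$, $u\in(0,1)$.
   Context: Notation. $\ell(t)=1+|\log t|$, $\ell^\sigma(t)=(\ell(t))^\sigma$. An r.i. space $E$ is a rearrangement invariant Banach function space on $(0,\infty)$ with the Fatou property; $\varphi_E(s)=\|\chi_{(0,s)}\|_E$, $s>0$, is its fundamental function; $\widetilde E$ is the corresponding space for the measure $dt/t$, with $\|g\|_{\widetilde E}=\|g^\star\|_E$ ($g^\star$ the non-increasing rearrangement with respect to $dt/t$); for an interval $I$, $\|g\|_{\widetilde E(I)}=\|g\chi_I\|_{\widetilde E}$. A positive finite measurable $b$ on $(0,1)$ is in $SV(0,1)$ if for all $\varepsilon>0$, $t^\varepsilon b(t)$ is equivalent to a non-decreasing function and $t^{-\varepsilon}b(t)$ to a non-increasing one on $(0,1)$. In $b(\rho(u))$, $b$ is understood as extended to $[1,\infty)$ by $b(s)=1$ for $s\ge1$ (the choice of slowly varying extension is immaterial up to equivalence of norms). Interpolation spaces: for (quasi-)Banach spaces with $Y_1\hookrightarrow Y_0$, $(Y_0,Y_1)_{\theta,b,E}$ is the set of $f\in Y_0$ with $\|t^{-\theta}b(t)K(t,f;Y_0,Y_1)\|_{\widetilde E(0,1)}<\infty$, $0\le\theta\le1$, where $K$ is Peetre's $K$-functional. Function spaces: functions are measurable on $(0,1)$ with Lebesgue measure;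 $f^*$ is the non-increasing rearrangement and $f^{**}(t)=\frac1t\int_0^tf^*(s)\,ds$. Each space is the set of measurable $f$ with finite indicated norm (innermost norm in $s$, next in $t$, outermost in $u$), $1<p<\infty$: - $L_{p,b,E}$: $\|t^{1/p}b(t)f^*(t)\|_{\widetilde E(0,1)}$; - $L^{\mathcal R}_{p,b,E,a,F}$: $\big\|b(t)\|s^{1/p}a(s)f^*(s)\|_{\widetilde F(t,1)}\big\|_{\widetilde E(0,1)}$; - $L^{\mathcal L}_{p,b,E,a,F}$: $\big\|b(t)\|s^{1/p}a(s)f^*(s)\|_{\widetilde F(0,t)}\big\|_{\widetilde E(0,1)}$; - $L^{\mathcal R,\mathcal R}_{p,c,E,b,F,a,G}$: $\Big\|c(u)\big\|b(t)\|s^{1/p}a(s)f^*(s)\|_{\widetilde G(t,1)}\big\|_{\widetilde F(u,1)}\Big\|_{\widetilde E(0,1)}$; - $L^{\mathcal L,\mathcal L}_{p,c,E,b,F,a,G}$: $\Big\|c(u)\big\|b(t)\|s^{1/p}a(s)f^*(s)\|_{\widetilde G(0,t)}\big\|_{\widetilde F(0,u)}\Big\|_{\widetilde E(0,1)}$; - $A_{p,\alpha,E}$ ($\alpha<1$, $(1+u)^{\alpha-1}\in E$, i.e. $\|\ell^{\alpha-1}\|_{\widetilde E(0,1)}<\infty$): $\Big\|\ell^{\alpha-1}(t)\int_t^1s^{1/p}f^{**}(s)\,\frac{ds}s\Big\|_{\widetilde E(0,1)}$; - $B_{p,\alpha,E}$ ($\alpha<1$): $\Big\|\sup_{0<s<t}s^{1/p}\ell^{\alpha-1}(s)f^{**}(s)\Big\|_{\widetilde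 E(0,1)}$. Equality of spaces means equality as sets with equivalent norms. *)

(* Defs.v *)
From HB Require Import structures.
From mathcomp Require Import all_boot all_order all_algebra.
From mathcomp Require Import all_classical all_reals all_analysis.
From mathcomp Require Import measurable_realfun.

Set Implicit Arguments.
Unset Strict Implicit.
Unset Printing Implicit Defensive.

Import Order.TTheory GRing.Theory Num.Theory.
Import numFieldNormedType.Exports.

Local Open Scope classical_set_scope.
Local Open Scope ring_scope.

(* A norm on functions on (0, oo) is represented by a functional on
   R -> \bar R; only its values on functions that are nonnegative and
   measurable on (0, oo) are meaningful. *)
Definition nonneg_measurable (R : realType) : set (R -> \bar R) :=
  [set f : R -> \bar R | measurable_fun (`]0, +oo[ : set R) f /\
           forall x, 0 < x -> (0 <= f x)%E].

Definition equimeasurable (R : realType) (f g : R -> \bar R) : Prop :=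
  forall y : R, 0 <= y ->
    lebesgue_measure ((`]0, +oo[ : set R) `&` [set x | (y%:E < f x)%E]) =
    lebesgue_measure ((`]0, +oo[ : set R) `&` [set x | (y%:E < g x)%E]).

(* The axioms of Bennett and Sharpley for a rearrangement invariant Banach
   function norm over ((0, oo), dx); completeness of the space of functions
   of finite norm is a consequence of ri_fatou. *)
Record ri_space (R : realType) := RISpace {
  ri_norm :> (R -> \bar R) -> \bar R ;
  ri_ge0 : forall f, nonneg_measurable f -> (0 <= ri_norm f)%E ;
  ri_eq0 : forall f, nonneg_measurable f ->
    (ri_norm f = 0%E <->
     {ae lebesgue_measure, forall x : R, 0 < x -> f x = 0%E}) ;
  ri_homo : forall (a : R) f, 0 <= a -> nonneg_measurable f ->
    ri_norm (fun x => a%:E * f x)%E = (a%:E * ri_norm f)%E ;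
  ri_triangle : forall f g, nonneg_measurable f -> nonneg_measurable g ->
    (ri_norm (fun x => f x + g x) <= ri_norm f + ri_norm g)%E ;
  ri_le : forall f g, nonneg_measurable f -> nonneg_measurable g ->
    {ae lebesgue_measure, forall x : R, 0 < x -> (f x <= g x)%E} ->
    (ri_norm f <= ri_norm g)%E ;
  ri_fatou : forall (f_ : nat -> R -> \bar R) f,
    (forall n, nonneg_measurable (f_ n)) -> nonneg_measurable f ->
    {ae lebesgue_measure, forall x : R, 0 < x ->
      nondecreasing_seq (f_ ^~ x) /\ f_ ^~ x @ \oo --> f x} ->
    (fun n => ri_norm (f_ n)) @ \oo --> ri_norm f ;
  ri_indic : forall A : set R, measurable A -> A `<=` `]0, +oo[ ->
    (lebesgue_measure A < +oo)%E ->
    (ri_norm (fun x => (\1_A x)%:E) < +oo)%E ;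
  ri_integral : forall A : set R, measurable A -> A `<=` `]0, +oo[ ->
    (lebesgue_measure A < +oo)%E ->
    exists2 C : R, 0 < C & forall f, nonneg_measurable f ->
      (\int[lebesgue_measure]_(x in A) f x <= C%:E * ri_norm f)%E ;
  ri_rearrangement : forall f g, nonneg_measurable f -> nonneg_measurable g ->
    equimeasurable f g -> ri_norm f = ri_norm g }.

(* The norms of L_1 and L_oo over (0, oo), for q = 1 and q = +oo. *)
Definition Lq (R : realType) (q : \bar R) (f : R -> \bar R) : \bar R :=
  'N[lebesgue_measure]_q [f \_ (`]0, +oo[ : set R)].

Section Definitions.
Variable R : realType.
Implicit Types (E F G : (R -> \bar R) -> \bar R) (a b c : R -> R).
Implicit Types (p q t u : R) (f : R -> R) (I : set R).

Definition fundamental E (s : R) : \bar R :=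
  E (fun x => (\1_(`]0, s[ : set R) x)%:E).

(* Non-increasing rearrangement with respect to the set function m. *)
Definition rearrangement (m : set R -> \bar R) (g : R -> \bar R) (x : R)
    : \bar R :=
  ereal_inf [set y%:E | y in
    [set y : R | 0 <= y /\ (m [set t | (y%:E < `|g t|)%E] <= x%:E)%E]].

(* The measure dt/t on (0, oo). *)
Definition log_measure (A : set R) : \bar R :=
  (\int[lebesgue_measure]_(t in A `&` `]0%R, +oo[) (t^-1)%:E)%E.

(* Outside I, g \_ I is 0. *)
Definition tilde E I (g : R -> \bar R) : \bar R :=
  E (rearrangement log_measure (g \_ I)).

Definition ell t : R := 1 + `|ln t|.

Definition equivalent_on01 (g h : R -> R) : Prop :=
  exists c C : R, [/\ 0 < c, 0 < C &
    forall t, 0 < t < 1 -> c * h t <= g t <= C * h t].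

Definition slowly_varying b : Prop :=
  [/\ measurable_fun (`]0, 1[ : set R) b,
      forall t, 0 < t < 1 -> 0 < b t &
      forall eps : R, 0 < eps ->
        (exists2 h : R -> R,
           {in (`]0, 1[ : interval R) &, {homo h : s t / s <= t}} &
           equivalent_on01 (fun t => t `^ eps * b t) h) /\
        (exists2 h : R -> R,
           {in (`]0, 1[ : interval R) &, {homo h : s t /~ s <= t}} &
           equivalent_on01 (fun t => t `^ (- eps) * b t) h)].

(* The slowly varying extension of b from (0, 1) to (0, oo). *)
Definition extend1 b (s : R) : R := if s < 1 then b s else 1.

(* Functions on (0, 1) are represented by real functions on R, of which only
   the values on (0, 1) matter. Measurable means Borel measurable, which loses
   no class of Lebesgue measurable functions modulo a.e. equality. *)
Definition fstar f : R -> \bar R :=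
  rearrangement (fun A => lebesgue_measure (A `&` (`]0, 1[ : set R)))
    (EFin \o f).

Definition fstar2 f t : \bar R :=
  ((t^-1)%:E * \int[lebesgue_measure]_(s in `]0%R, t[) fstar f s)%E.

Record fspace := FSpace {
  carrier : set (R -> R) ;
  fnorm : (R -> R) -> \bar R }.

Definition finite_norm_space (N : (R -> R) -> \bar R) : fspace :=
  FSpace [set f : R -> R |
    measurable_fun (`]0, 1[ : set R) f /\ (N f < +oo)%E] N.

Definition fspaceI (X Y : fspace) : fspace :=
  FSpace (carrier X `&` carrier Y)
         (fun f => maxe (fnorm X f) (fnorm Y f)).

Definition same_space (X Y : fspace) : Prop :=
  carrier X = carrier Y /\
  exists2 C : R, 0 < C & forall f, carrier X f ->
    (fnorm X f <= C%:E * fnorm Y f)%E /\ (fnorm Y f <= C%:E * fnorm X f)%E.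

Definition Kfunctional (Y0 Y1 : fspace) t f : \bar R :=
  ereal_inf [set z | exists f0 f1 : R -> R,
    [/\ carrier Y0 f0, carrier Y1 f1,
        {ae lebesgue_measure, forall s : R, 0 < s < 1 -> f s = f0 s + f1 s} &
        z = (fnorm Y0 f0 + t%:E * fnorm Y1 f1)%E]].

Definition interp_norm (Y0 Y1 : fspace) (theta : R) b E f : \bar R :=
  tilde E `]0%R, 1%R[
    (fun t => (t `^ (- theta) * b t)%:E * Kfunctional Y0 Y1 t f)%E.

Definition interp (Y0 Y1 : fspace) (theta : R) b E : fspace :=
  FSpace [set f : R -> R |
    carrier Y0 f /\ (interp_norm Y0 Y1 theta b E f < +oo)%E]
         (interp_norm Y0 Y1 theta b E).

Definition weighted p a f (s : R) : \bar R :=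
  ((s `^ p^-1 * a s)%:E * fstar f s)%E.

Definition Lsp p b E : fspace := finite_norm_space (fun f =>
  tilde E `]0%R, 1%R[ (weighted p b f)).

Definition LR p b E a F : fspace := finite_norm_space (fun f =>
  tilde E `]0%R, 1%R[ (fun t =>
    (b t)%:E * tilde F `]t, 1%R[ (weighted p a f))%E).

Definition LL p b E a F : fspace := finite_norm_space (fun f =>
  tilde E `]0%R, 1%R[ (fun t =>
    (b t)%:E * tilde F `]0%R, t[ (weighted p a f))%E).

Definition LRR p c E b F a G : fspace := finite_norm_space (fun f =>
  tilde E `]0%R, 1%R[ (fun u =>
    (c u)%:E * tilde F `]u, 1%R[ (fun t =>
      (b t)%:E * tilde G `]t, 1%R[ (weighted p a f)))%E).

Definition LLL p c E b F a G : fspace := finite_norm_space (fun f =>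
  tilde E `]0%R, 1%R[ (fun u =>
    (c u)%:E * tilde F `]0%R, u[ (fun t =>
      (b t)%:E * tilde G `]0%R, t[ (weighted p a f)))%E).

Definition Asp p (alpha : R) E : fspace := finite_norm_space (fun f =>
  tilde E `]0%R, 1%R[ (fun t =>
    (ell t `^ (alpha - 1))%:E *
    \int[lebesgue_measure]_(s in `]t, 1%R[)
      ((s `^ p^-1)%:E * fstar2 f s * (s^-1)%:E))%E).

Definition Bsp p (alpha : R) E : fspace := finite_norm_space (fun f =>
  tilde E `]0%R, 1%R[ (fun t =>
    ereal_sup [set ((s `^ p^-1 * ell s `^ (alpha - 1))%:E * fstar2 f s)%E
              | s in `]0%R, t[])).

(* The two building blocks of rho, B_theta, B_0 and B_1; they are finite for
   0 < u < 1, whence fine, as soon as E is an r.i. space and, for tail_norm,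
   (1 + u)^(beta - 1) belongs to E. *)
Definition fundamental_ell E u : R := fine (fundamental E (ell u)).

Definition tail_norm (beta : R) E u : R :=
  fine (tilde E `]0%R, u[ (fun t => (ell t `^ (beta - 1))%:E)).

Definition rho (p0 p1 alpha beta : R) (E0 E1 : (R -> \bar R) -> \bar R) u : R :=
  u `^ (p0^-1 - p1^-1) *
  (ell u `^ (alpha - 1) * fundamental_ell E0 u / tail_norm beta E1 u).

End Definitions.

(* Main.v *)
(* Cut (0, 1] into the blocks (e^-(n+1), e^-n], which have measure 1 for dt/t.
   The norm of E~ of a function that varies slowly from block to block is
   equivalent to the norm of E applied to the step function of its values at
   e^-n. With a_n = f^*(e^-(n+1)), S_n = sup_(k >= n) s_k a_k and
   T_n = sum_(k <= n) om_k a_k, where s_n = e^(-n/p0) l^(alpha-1)(e^-n) and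
   om_n = e^(-n/p1), Hardy's inequality removes the averages f^** and turns the
   norms of B and A into |S|_E0 and |d T|_E1 with d_n = l^(beta-1)(e^-n).

   The K-functional at rho_n = rho(e^-n) is equivalent to P0_n + rho_n P1_n, with
   P0_n = |S restricted to k >= n|_E0 + phi_n S_n and
   P1_n = tau_n T_n + |d T restricted to k <= n|_E1, where
   phi_n = phi_E0(l(e^-n)) and tau_n is the E1 norm of l^(beta-1) on (0, e^-n):
   truncate f at height a_n for the upper bound; for the lower bound use
   a_n <= a0_(n+1) + a1_(n+1) for f = f0 + f1. The definition of rho says that
   rho_n tau_n om_n = phi_n s_n.

   As rho_n decays geometrically up to constants, the interpolation norm is
   equivalent to its samples at t = rho_n, that is to the norm in E of
   w_n (P0_n + rho_n P1_n) with w_n = rho_n^-theta b(rho_n). Slow variation of b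
   makes w_n grow geometrically if theta > 0 and w_n rho_n decay geometrically if
   theta < 1. In the first case a discrete Hardy inequality bounds the P0 part by
   the norm of w_n phi_n s_n a_n, in the second case it does so for the P1 part;
   for theta = 0 and theta = 1 the other part remains. *)
Require Import Defs.
From HB Require Import structures.
From mathcomp Require Import all_boot all_order all_algebra.
From mathcomp Require Import zify ring lra.
From mathcomp Require Import all_classical all_reals all_analysis.
From mathcomp Require Import measurable_realfun ess_sup_inf.

Set Implicit Arguments.
Unset Strict Implicit.
Unset Printing Implicit Defensive.

Import Order.TTheory GRing.Theory Num.Theory.
Import numFieldNormedType.Exports.

Local Open Scope classical_set_scope.
Local Open Scope ring_scope.

(** * Logarithmic blocks *)

(** Every rearrangement is non-increasing, hence measurable, and [log_measure] and integrals of
    nonnegative functions are monotone on arbitrary sets and functions. So [tilde] norms can be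
    compared block by block, also for functions such as a K-functional. Upper bounds compare on the
    same block. Lower bounds lose a few blocks, since f^* dominates a_n only on later blocks; this
    is harmless, because all blocks have the same mass and a shift preserves the distribution
    function.

    Norms take values in [0, +oo], and equivalences are proved for all measurable f, infinite norms
    included. Equality of sets follows from them once a finite interpolation norm is known to force
    a finite B norm.

    The fundamental function and the inverse of the tail norm grow only polynomially in n, and the
    positive exponent 1/p0 - 1/p1 beats this growth; that is why rho_n decays geometrically.

    For an arbitrary r.i. space E the discrete Hardy inequalities rest on two facts: shifts are
    contractions of the sequence norm, and the Fatou property extends the triangle inequality to
    series. Geometric weights then sum to a constant. *)

Lemma le_nonneg_integral d (T : measurableType d) (R : realType)
    (mu : {measure set T -> \bar R}) (D : set T) (f g : T -> \bar R) :
  (forall x, D x -> 0 <= f x <= g x)%E ->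
  (\int[mu]_(x in D) f x <= \int[mu]_(x in D) g x)%E.
Proof.
move=> fg; rewrite !ge0_integralE; last 2 first.
- by move=> x /fg/andP[f0]; exact: le_trans.
- by move=> x /fg/andP[].
apply: ereal_sup_le => _ [h hf <-]; exists h => // x.
apply: le_trans (hf x) _; rewrite /patch; case: ifPn => //.
by rewrite inE => /fg/andP[].
Qed.

Lemma le_integral_subset d (T : measurableType d) (R : realType)
    (mu : {measure set T -> \bar R}) (A B : set T) (f : T -> \bar R) :
  A `<=` B -> (forall x, B x -> 0 <= f x)%E ->
  (\int[mu]_(x in A) f x <= \int[mu]_(x in B) f x)%E.
Proof.
move=> AB f0; rewrite integral_mkcond [leRHS]integral_mkcond.
apply: le_nonneg_integral => x _; rewrite /patch.
case: ifPn => [|_].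
  by rewrite inE => Ax; rewrite (mem_set (AB _ Ax)) f0 ?lexx//; exact: AB.
by case: ifPn => [|_]; [rewrite inE => /f0 ->; rewrite lexx|rewrite lexx].
Qed.

Section Blocks.
Variable R : realType.
Notation mu := (@lebesgue_measure R).
Implicit Types (a : nat -> \bar R) (t x y : R) (n m : nat).

Definition idx t : nat := Num.truncn (- ln t).

Definition block n : set R := `](expR (- n.+1%:R)), (expR (- n%:R))].

(** Lebesgue counterpart of [block]: a step function on the blocks under dt/t has the same
    distribution as the step function with these values on unit intervals under dx. *)
Definition ublock n : set R := `[n%:R, n.+1%:R[.

Lemma blockE n t : block n t <-> 0 < t <= 1 /\ idx t = n.
Proof.
rewrite /block /= in_itv /=; split.
  move=> /andP[t1 t2]; have t0 : 0 < t by exact: lt_trans t1; exact: expR_gt0.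
  split; first by rewrite t0 (le_trans t2)// -expR0 ler_expR oppr_le0.
  apply: truncn_def; rewrite lerNr ltrNl.
  by rewrite -[leLHS]lnK// ler_expR in t2; rewrite -[ltRHS]lnK// ltr_expR in t1;
    rewrite t1 t2.
move=> [/andP[t0 t1] <-].
have l0 : 0 <= - ln t by rewrite oppr_ge0 ln_le0.
have /andP[h1 h2] := truncn_itv l0.
by rewrite -[X in _ < X]lnK// -[X in X <= _]lnK// ltr_expR ler_expR ltrNl lerNr h1 h2.
Qed.

Lemma idx_block t : 0 < t <= 1 -> block (idx t) t.
Proof. by move=> t01; apply/blockE. Qed.

Lemma ublockE n x : ublock n x <-> 0 <= x /\ Num.truncn x = n.
Proof.
rewrite /ublock /= in_itv /=; split.
  by move=> /andP[nx xn]; split; [exact: le_trans nx|apply: truncn_def; rewrite nx].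
by move=> [x0 <-]; exact: truncn_itv.
Qed.

Lemma trivIset_block : trivIset setT block.
Proof.
apply/trivIsetP => i j _ _ ij; rewrite -subset0 => t [/blockE[_ hi] /blockE[_ hj]].
by rewrite -hi -hj eqxx in ij.
Qed.

Lemma trivIset_ublock : trivIset setT ublock.
Proof.
apply/trivIsetP => i j _ _ ij; rewrite -subset0 => t [/ublockE[_ hi] /ublockE[_ hj]].
by rewrite -hi -hj eqxx in ij.
Qed.

Lemma measurable_block n : measurable (block n).
Proof. exact: measurable_itv. Qed.

Lemma measurable_ublock n : measurable (ublock n).
Proof. exact: measurable_itv. Qed.

Lemma bigcup_block : \bigcup_n block n = `]0, 1]%classic.
Proof.
apply/seteqP; split=> t.
  by move=> [n _ /blockE[t01 _]]; rewrite /= in_itv.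
by rewrite /= in_itv/= => t01; exists (idx t) => //; exact: idx_block.
Qed.

Lemma lebesgue_block n : mu (block n) = (expR (- n%:R) - expR (- n.+1%:R))%:E.
Proof.
rewrite lebesgue_measure_itv/= lte_fin ltr_expR ltrN2 ltr_nat ltnSn.
by rewrite EFinB.
Qed.

Lemma lebesgue_ublock n : mu (ublock n) = 1%E.
Proof.
rewrite lebesgue_measure_itv/= lte_fin ltr_nat ltnSn -EFinB.
by rewrite -natrB// subSnn.
Qed.

Lemma measurable_fun_inv : measurable_fun (`]0, +oo[ : set R) (fun t : R => t^-1).
Proof.
apply: open_continuous_measurable_fun; first exact: interval_open.
move=> x; rewrite inE/= in_itv/= andbT => x0.
by apply: inv_continuous; rewrite gt_eqF.
Qed.

Lemma inv_integral_block n : (\int[mu]_(t in block n) (t^-1)%:E = 1)%E.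
Proof.
have e0 k : 0 < expR (- k%:R) :> R := expR_gt0 _.
have lt : expR (- n.+1%:R) < expR (- n%:R) :> R by rewrite ltr_expR ltrN2 ltr_nat.
have pos x : x \in `[expR (- n.+1%:R : R), expR (- n%:R)] -> 0 < x.
  by rewrite in_itv/= => /andP[+ _]; exact: lt_le_trans.
have cinv x : 0 < x -> {for x, continuous (fun t : R => t^-1)}.
  by move=> x0; apply: inv_continuous; rewrite gt_eqF.
have minv : measurable_fun (block n) (fun t : R => (t^-1)%:E).
  apply/measurable_EFinP; apply: (measurable_funS (measurable_itv _) _ measurable_fun_inv).
  by move=> x /blockE[/andP[x0 _] _]; rewrite /= in_itv/= x0.
(* The closed block stays away from 0, so the fundamental theorem of calculus applies there with
   antiderivative [ln]. *)
rewrite integral_itv_obnd_cbnd// (@continuous_FTC2 _ _ (@ln R))//.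
- by rewrite !expRK -EFinB -natr1 opprK addrA addNr add0r.
- apply: continuous_in_subspaceT => x; rewrite inE => /pos x0; exact: cinv.
- split.
  + move=> x xi; have x0 : 0 < x by apply: pos; exact: subset_itv_oo_cc.
    by apply: ex_derive; exact: is_derive1_ln.
  + by apply: cvg_at_right_filter; apply: continuous_ln.
  + by apply: cvg_at_left_filter; apply: continuous_ln.
- move=> x xi; have x0 : 0 < x by apply: pos; exact: subset_itv_oo_cc.
  by rewrite derive1E; have := is_derive1_ln x0; case.
Qed.

(* Each block has measure 1 for dt/t, so this is the distribution function of
   a \o idx on (0, 1]. *)
Definition dist_seq a y : \bar R := (\sum_(n <oo | (y%:E < a n)) 1)%E.

Lemma le_log_measure (A B : set R) : A `<=` B -> (log_measure A <= log_measure B)%E.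
Proof.
move=> AB; apply: le_integral_subset; first exact: setSI.
by move=> t [_]; rewrite /= in_itv/= andbT => t0; rewrite lee_fin invr_ge0 ltW.
Qed.

(** The blocks are disjoint of mass 1, so the measure merely counts them. The offset [m] lets lower
    bounds push every block further towards 0 at no cost. *)
Lemma log_measure_blocks (P : pred nat) m :
  (log_measure (\bigcup_(n in [set n | P n]) block (n + m)) = \sum_(n <oo | P n) 1)%E.
Proof.
rewrite /log_measure setIidl; last first.
  move=> t [n _ /blockE[/andP[t0 _] _]].
  by rewrite /= in_itv/= t0.
rewrite bigcup_mkcond ge0_integral_bigcup/=.
- rewrite [RHS]eseries_mkcond; apply: eq_eseriesr => n _.
  rewrite mem_setE/= -[n \in _]/(P n); case: ifPn => Pn.
    by rewrite inv_integral_block.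
  by rewrite integral_set0.
- by move=> n; case: ifPn => _; [exact: measurable_block|exact: measurable0].
- apply/measurable_EFinP; apply: (measurable_funS (measurable_itv _) _ measurable_fun_inv).
  move=> t [n _]; case: ifPn => // _ /blockE[/andP[t0 _] _].
  by rewrite /= in_itv/= t0.
- move=> t [n _]; case: ifPn => // _ /blockE[/andP[t0 _] _].
  by rewrite lee_fin invr_ge0 ltW.
- apply/trivIsetP => i j _ _ ij; rewrite -subset0 => t [].
  case: ifPn => // _ /blockE[_ hi]; case: ifPn => // _ /blockE[_ hj].
  by move: ij; rewrite -(eqn_add2r m) -hi -hj eqxx.
Qed.

Lemma lebesgue_ublocks (P : pred nat) :
  (mu (\bigcup_(n in [set n | P n]) ublock n) = \sum_(n <oo | P n) 1)%E.
Proof.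
rewrite measure_bigcup; last 2 first.
- by move=> n _; exact: measurable_ublock.
- by apply: sub_trivIset trivIset_ublock.
rewrite eseries_mkcond [RHS]eseries_mkcond; apply: eq_eseriesr => n _.
by rewrite mem_setE/= -[n \in _]/(P n); case: ifPn => // Pn; rewrite lebesgue_ublock.
Qed.

End Blocks.

(** * Sequence norms *)

Section Sequences.
Variable R : realType.
Notation mu := (@lebesgue_measure R).
Implicit Types (a c X : nat -> \bar R) (F : (R -> \bar R) -> \bar R) (t x y : R).
Implicit Types (g f : R -> \bar R) (I : set R) (n m : nat).

(** Common ground of the r.i. norms and of [Lq 1%E] and [Lq +oo%E], which are not packaged as
    [ri_space]. *)
Definition monotone_functional F := forall f g, nonneg_measurable f ->
  nonneg_measurable g -> (forall x, 0 < x -> (f x <= g x)%E) -> (F f <= F g)%E.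

(** Closing the interval at 1 makes the blocks tile it exactly; the point 1 is null for dt/t. *)
Definition nseq F a : \bar R := tilde F `]0, 1] (a \o idx (R:=R)).

Lemma antitone_nonneg_measurable f : (forall x y, x <= y -> (f y <= f x)%E) ->
  (forall x, 0 < x -> (0 <= f x)%E) -> nonneg_measurable f.
Proof.
move=> fa f0; split => //; move=> mD.
apply: (measurability _ (ErealGenOInfty.measurableE R)) => //= _ [_ [x ->] <-].
apply: measurableI => //; apply: is_interval_measurable => s t /=.
rewrite !in_itv/= !andbT => fs ft u /andP[su ut].
rewrite in_itv/= andbT; exact: lt_le_trans ft (fa _ _ ut).
Qed.

Lemma rearrangement_antitone (m : set R -> \bar R) g x y : x <= y ->
  (rearrangement m g y <= rearrangement m g x)%E.
Proof.
move=> xy; apply: ereal_inf_le_tmp => _ [z [z0 mz] <-]; exists z => //; split => //.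
by apply: le_trans mz _; rewrite lee_fin.
Qed.

Lemma rearrangement_ge0 (m : set R -> \bar R) g x : (0 <= rearrangement m g x)%E.
Proof. by apply: le_ereal_inf_tmp => _ [z [z0 mz] <-]; rewrite lee_fin. Qed.

(** Superlevel sets of a non-increasing function are intervals, so measurability is automatic
    whatever [m] and [g] are. *)
Lemma rearrangement_nonneg_measurable (m : set R -> \bar R) g :
  nonneg_measurable (rearrangement m g).
Proof.
apply: antitone_nonneg_measurable; first exact: rearrangement_antitone.
by move=> *; exact: rearrangement_ge0.
Qed.
Hint Resolve rearrangement_nonneg_measurable : core.

Lemma rearrangement_le_dist (m m' : set R -> \bar R) g f x :
  (forall y, 0 <= y -> (m [set t | (y%:E < `|g t|)%E] <= m' [set t | (y%:E < `|f t|)%E])%E) ->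
  (rearrangement m g x <= rearrangement m' f x)%E.
Proof.
move=> h; apply: ereal_inf_le_tmp => _ [z [z0 mz] <-]; exists z => //; split => //.
exact: le_trans (h _ z0) mz.
Qed.

(** Only distribution functions are compared, so mass may be moved from one block to another; shifts
    and injective relabellings of indices rely on this. *)
Lemma le_dist_tilde F I J g f : monotone_functional F ->
  (forall y, 0 <= y -> (log_measure [set t | (y%:E < `|(g \_ I) t|)%E] <=
     log_measure [set t | (y%:E < `|(f \_ J) t|)%E])%E) ->
  (tilde F I g <= tilde F J f)%E.
Proof. by move=> mF h; apply: mF => // x _; exact: rearrangement_le_dist. Qed.

Lemma dist_seq_antitone a x y : x <= y -> (dist_seq a y <= dist_seq a x)%E.
Proof.
move=> xy; apply: subset_lee_nneseries => // n.
by apply: le_lt_trans; rewrite lee_fin.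
Qed.

Lemma dist_seq_ge0 a y : (0 <= dist_seq a y)%E.
Proof. exact: nneseries_ge0. Qed.

Lemma log_measure_dist_seq a y : (forall n, 0 <= a n)%E -> 0 <= y ->
  log_measure [set t | (y%:E < `|((a \o idx (R:=R)) \_ `]0%R, 1%R]) t|)%E] = dist_seq a y.
Proof.
move=> a0 y0; rewrite /dist_seq -(log_measure_blocks R _ 0); congr log_measure.
apply/seteqP; split=> t.
  rewrite /= /patch; case: ifPn => [|_]; last by rewrite -/(0%E : \bar R) abse0 lte_fin ltNge y0.
  rewrite inE/= in_itv/= => t01; rewrite gee0_abs// => h; exists (idx t) => //.
  by rewrite addn0; exact: idx_block.
move=> [n /= yn]; rewrite addn0 => /blockE[t01 tn].
by rewrite patchE mem_set/= ?in_itv//= tn gee0_abs.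
Qed.

(** Right continuity of the distribution function: some partial sum already exceeds [x], and its
    finitely many entries above [y] stay above a slightly larger level [y']. *)
Lemma dist_seq_rc a y x : (x%:E < dist_seq a y)%E ->
  exists2 y', y < y' & (x%:E < dist_seq a y')%E.
Proof.
rewrite {1}/dist_seq eseries_mkcond => h.
have cv : cvgn (fun n => \sum_(0 <= i < n) (if (y%:E < a i)%E then 1 else 0)%E : \bar R).
  by apply: is_cvg_nneseries => n _ _; case: ifP.
have [N hN] : exists N, (x%:E < \sum_(0 <= i < N) (if (y%:E < a i)%E then 1 else 0)%E)%E.
  apply: contrapT => /forallNP hn; move: h; rewrite ltNge => /negP; apply.
  by apply: lime_le => //; apply: nearW => n; rewrite leNgt; apply/negP/hn.
have [y' yy' hy'] : exists2 y', y < y' & forall n, (n < N)%N -> (y%:E < a n)%E -> (y'%:E < a n)%E.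
  elim: N {hN} => [|N [y1 yy1 h1]]; first by exists (y + 1) => //; rewrite ltrDl.
  have [yN|] := boolP (y%:E < a N)%E; last first.
    move=> yN; exists y1 => // n; rewrite ltnS leq_eqVlt => /orP[/eqP ->|/h1//].
    by rewrite (negbTE yN).
  have [y2 yy2 h2] : exists2 y2, y < y2 & (y2%:E < a N)%E.
    case: (a N) yN => [r||//]; last by exists (y + 1); rewrite ?ltrDl// ltry.
    by rewrite lte_fin => yr; exists ((y + r) / 2); rewrite ?midf_lt// lte_fin midf_lt.
  exists (Num.min y1 y2) => [|n]; first by rewrite lt_min yy1.
  rewrite ltnS leq_eqVlt => /orP[/eqP -> _|nN /(h1 _ nN)].
    by apply: le_lt_trans h2; rewrite lee_fin ge_min lexx orbT.
  by apply: le_lt_trans; rewrite lee_fin ge_min lexx.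
exists y' => //; apply: lt_le_trans hN _.
rewrite /dist_seq [leRHS]eseries_mkcond.
apply: le_trans (nneseries_lim_ge N _); last by move=> *; case: ifP.
rewrite !big_nat; apply: lee_sum => n nN; case: ifP => h1; last by case: ifP.
by rewrite (hy' _ nN h1).
Qed.

(** The rearrangement is the generalized inverse of the distribution function. One direction is the
    definition as an infimum; the other needs a level strictly above [y], supplied by
    [dist_seq_rc]. *)
Lemma lt_rearrangement_seq a x y : (forall n, 0 <= a n)%E -> 0 <= y ->
  (y%:E < rearrangement (@log_measure R) ((a \o idx (R:=R)) \_ `]0%R, 1%R]) x)%E =
  (x%:E < dist_seq a y)%E.
Proof.
move=> a0 y0; apply/idP/idP; apply: contraTT; rewrite -!leNgt => h.
  by apply: ereal_inf_lbound; exists y => //; split => //; rewrite log_measure_dist_seq.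
rewrite leNgt; apply/negP => /dist_seq_rc[y' yy' hy'].
have : (y'%:E <= y%:E)%E; last by rewrite leNgt lte_fin yy'.
apply: le_trans h; apply: le_ereal_inf_tmp => _ [z [z0 +] <-].
rewrite log_measure_dist_seq// lee_fin => hz; rewrite leNgt; apply/negP => zy.
by move: (lt_le_trans hy' (dist_seq_antitone a (ltW zy))); rewrite ltNge hz.
Qed.

Lemma lebesgue_dist_rearrangement_seq a y : (forall n, 0 <= a n)%E -> 0 <= y ->
  mu (`]0, +oo[%classic `&`
    [set x | (y%:E < rearrangement (@log_measure R) ((a \o idx (R:=R)) \_ `]0%R, 1%R]) x)%E])
  = dist_seq a y.
Proof.
move=> a0 y0; set S := (X in _ `&` X).
have -> : S = [set x : R | (x%:E < dist_seq a y)%E].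
  by apply/funext => x; rewrite /S /mkset lt_rearrangement_seq.
case: (dist_seq a y) (dist_seq_ge0 a y) => [d d0||//].
  rewrite (_ : _ `&` _ = `]0, d[%classic).
    rewrite lebesgue_measure_itv/= lte_fin oppr0 adde0.
    move: d0; rewrite lee_fin le_eqVlt => /orP[/eqP <-|->]; last by [].
    by rewrite ltxx.
  apply/seteqP; split=> z /=; rewrite !in_itv/= lte_fin andbT.
    by move=> [-> ->].
  by move=> /andP[].
move=> _; rewrite (_ : _ `&` _ = `]0, +oo[%classic); first by rewrite lebesgue_measure_itv/= ltry.
by apply/seteqP; split=> z /= => [[]//|z0]; split=> //; exact: ltry.
Qed.

Lemma measurable_truncn_comp a :
  measurable_fun (`]0, +oo[ : set R) (a \o Num.truncn (R:=R)).
Proof.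
have mU : measurable_fun (\bigcup_n @ublock R n) (a \o Num.truncn (R:=R)).
  apply/measurable_fun_bigcup => n; first exact: measurable_ublock.
  apply: (@eq_measurable_fun _ _ _ _ _ (fun=> a n)); last exact: measurable_cst.
  by move=> x; rewrite inE => /ublockE[_ /= ->].
apply: measurable_funS mU.
  by apply: bigcup_measurable => n _; exact: measurable_ublock.
move=> x; rewrite /= in_itv/= andbT => x0; exists (Num.truncn x) => //.
by apply/ublockE; split => //; exact: ltW.
Qed.

Lemma lebesgue_dist_truncn a y : (forall n, 0 <= a n)%E ->
  mu (`]0, +oo[%classic `&` [set x | (y%:E < (a \o Num.truncn (R:=R)) x)%E]) = dist_seq a y.
Proof.
move=> a0; rewrite /dist_seq -lebesgue_ublocks.
set A := _ `&` _; set B := \bigcup_(_ in _) _.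
have mA : measurable A.
  by apply: emeasurable_fun_o_infty => //; exact: measurable_truncn_comp.
have mB : measurable B by apply: bigcup_measurable => n _; exact: measurable_ublock.
have AB : A `<=` B.
  move=> x [/=]; rewrite in_itv/= andbT => x0 h; exists (Num.truncn x) => //.
  by apply/ublockE; split => //; exact: ltW.
(* [ublock 0] contains the point 0, which []0, +oo[] omits; it is a null set. *)
have BA : B `<=` A `|` [set 0].
  move=> x [n /= yn /ublockE[x0 xn]].
  have [<-|xn0] := eqVneq 0 x; [by right|left; split; rewrite /= ?xn//].
  by rewrite in_itv/= andbT lt_neqAle xn0.
apply/eqP; rewrite eq_le; apply/andP; split; first by apply: le_measure; rewrite ?inE.
apply: (@le_trans _ _ (mu (A `|` [set 0]))).
  by apply: le_measure; rewrite ?inE//; exact: measurableU.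
have := measureU2 mu mA (measurable_set1 0).
by rewrite [X in (_ + X)%E](lebesgue_measure_set1 0) adde0.
Qed.

(** Both sides have the distribution function [dist_seq a]. On the right [a] enters linearly, so
    homogeneity, the triangle inequality and the Fatou property of E pass to [nseq E]; the
    rearrangement on the left hides them. *)
Lemma nseq_truncn (E : ri_space R) a : (forall n, 0 <= a n)%E ->
  nseq E a = E (a \o Num.truncn (R:=R)).
Proof.
move=> a0; apply: ri_rearrangement => //.
  by split; [exact: measurable_truncn_comp|move=> x _; exact: a0].
move=> y y0; rewrite lebesgue_dist_truncn//.
exact: lebesgue_dist_rearrangement_seq.
Qed.

Lemma ri_monotone (E : ri_space R) : monotone_functional E.
Proof. by move=> f g hf hg fg; apply: ri_le => //; apply: nearW => x; exact: fg. Qed.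

End Sequences.
#[global] Hint Resolve rearrangement_nonneg_measurable : core.

Section SequenceNorm.
Variable R : realType.
Notation mu := (@lebesgue_measure R).
Implicit Types (a c X : nat -> \bar R) (F : (R -> \bar R) -> \bar R) (t x y : R).
Implicit Types (g f : R -> \bar R) (I : set R) (n m : nat) (E : ri_space R).

Lemma tilde_le F I g X : monotone_functional F -> (forall n, 0 <= X n)%E ->
  (forall t, I t -> 0 < t <= 1 /\ (`|g t| <= X (idx t))%E) ->
  (tilde F I g <= nseq F X)%E.
Proof.
move=> mF X0 h; apply: le_dist_tilde => // y y0; apply: le_log_measure => t /=.
rewrite /patch; case: ifPn => [|_].
  rewrite inE => /h[t01 gX] yg.
  by rewrite mem_set/= ?in_itv//= gee0_abs//; exact: lt_le_trans gX.
by rewrite -/(0%E : \bar R) abse0 lte_fin ltNge y0.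
Qed.

(* The shift by m.+1 blocks leaves room to compare g with a neighbouring
   value of a monotone sequence. *)
Lemma tilde_ge F I g X m : monotone_functional F -> (forall n, 0 <= X n)%E ->
  (forall n t, (0 < X n)%E -> @block R (n + m.+1) t ->
    I t /\ (X n <= `|g t|)%E) ->
  (nseq F X <= tilde F I g)%E.
Proof.
move=> mF X0 h; apply: le_dist_tilde => // y y0.
rewrite log_measure_dist_seq// /dist_seq -(log_measure_blocks R _ m.+1).
apply: le_log_measure => t [n /= yX /h[|It gX]].
  by apply: le_lt_trans yX; rewrite lee_fin.
by rewrite patchE mem_set//; exact: lt_le_trans gX.
Qed.

Lemma nseq_le F a c : monotone_functional F -> (forall n, 0 <= a n)%E ->
  (forall n, a n <= c n)%E -> (nseq F a <= nseq F c)%E.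
Proof.
move=> mF a0 ac; apply: tilde_le => //.
  by move=> n; exact: le_trans (ac n).
by move=> t; rewrite /= in_itv/= => t01; split => //; rewrite gee0_abs//; exact: ac.
Qed.

Lemma truncn_nonneg_measurable a : (forall n, 0 <= a n)%E ->
  nonneg_measurable (a \o Num.truncn (R:=R)).
Proof. by move=> a0; split; [exact: measurable_truncn_comp|move=> x _; exact: a0]. Qed.
Hint Resolve truncn_nonneg_measurable : core.

Lemma tilde_ge0 E I g : (0 <= tilde E I g)%E.
Proof. exact: ri_ge0. Qed.

Lemma nseq_ge0 E a : (0 <= nseq E a)%E.
Proof. exact: tilde_ge0. Qed.

Lemma nseqZ E r a : 0 <= r -> (forall n, 0 <= a n)%E ->
  (nseq E (fun n => r%:E * a n) = r%:E * nseq E a)%E.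
Proof.
move=> r0 a0; rewrite !nseq_truncn//; first by rewrite -ri_homo//; exact: truncn_nonneg_measurable.
by move=> n; exact: mule_ge0.
Qed.

Lemma nseqD E a c : (forall n, 0 <= a n)%E -> (forall n, 0 <= c n)%E ->
  (nseq E (fun n => a n + c n) <= nseq E a + nseq E c)%E.
Proof.
move=> a0 c0; rewrite !nseq_truncn//; last by move=> n; exact: adde_ge0.
by apply: ri_triangle; exact: truncn_nonneg_measurable.
Qed.

Lemma nseq0 E : nseq E (fun=> 0%E) = 0%E.
Proof.
transitivity (nseq E (fun n : nat => 0%:E * (fun=> 0%E) n)%E).
  by congr (nseq E _); apply/funext => n; rewrite mule0.
by rewrite nseqZ// mul0e.
Qed.

Lemma nseq_sum E (I : Type) (s : seq I) (a : I -> nat -> \bar R) :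
  (forall i n, 0 <= a i n)%E ->
  (nseq E (fun n => \sum_(i <- s) a i n) <= \sum_(i <- s) nseq E (a i))%E.
Proof.
move=> a0; elim: s => [|i s IH].
  by rewrite big_nil; under [X in nseq _ X]eq_fun do rewrite big_nil; rewrite nseq0.
rewrite big_cons; under [X in nseq _ X]eq_fun do rewrite big_cons.
apply: le_trans (nseqD _ _ _) _ => //; first by move=> n; apply: sume_ge0.
by rewrite leeD2l.
Qed.

(** The triangle inequality survives infinite sums by the Fatou property, applied to the increasing
    partial sums. *)
Lemma nseq_series E (a : nat -> nat -> \bar R) : (forall i n, 0 <= a i n)%E ->
  (nseq E (fun n => \sum_(i <oo) a i n) <= \sum_(i <oo) nseq E (a i))%E.
Proof.
move=> a0; pose s m n := (\sum_(0 <= i < m) a i n)%E.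
have s0 m n : (0 <= s m n)%E by apply: sume_ge0.
have S0 n : (0 <= \sum_(i <oo) a i n)%E by apply: nneseries_ge0.
have cv : (fun m => nseq E (s m)) @ \oo --> nseq E (fun n => \sum_(i <oo) a i n)%E.
  under eq_fun do rewrite nseq_truncn//; rewrite nseq_truncn//.
  apply: (@ri_fatou _ E (fun m => s m \o Num.truncn (R:=R))).
  - by move=> m; exact: truncn_nonneg_measurable.
  - exact: truncn_nonneg_measurable.
  apply: nearW => x _; split.
    apply/nondecreasing_seqP => m; rewrite /s /= big_nat_recr//=.
    by rewrite leeDl.
  by apply: is_cvg_nneseries => i _ _.
rewrite -(cvg_lim _ cv)//; apply: lee_lim.
- by apply/cvg_ex; eexists; exact: cv.
- by apply: is_cvg_nneseries => i _ _; exact: nseq_ge0.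
- by apply: nearW => m; exact: nseq_sum.
Qed.

(** At each level [tau] embeds the indices where [a] exceeds it into those where [c] does, so the
    distribution functions are ordered. *)
Lemma nseq_inj E a c (tau : nat -> nat) : (forall n, 0 <= a n)%E ->
  (forall n, 0 <= c n)%E ->
  (forall n, (0 < a n)%E -> (a n <= c (tau n))%E) ->
  (forall n m, (0 < a n)%E -> (0 < a m)%E -> tau n = tau m -> n = m) ->
  (nseq E a <= nseq E c)%E.
Proof.
move=> a0 c0 ac inj; apply: le_dist_tilde; first exact: ri_monotone.
move=> y y0; rewrite !log_measure_dist_seq// /dist_seq !nneseries_esum//.
rewrite -(esum_image [set x | (y%:E < a x)%E] tau (fun=> 1%E)).
  rewrite [leLHS]esum_mkcond [leRHS]esum_mkcond; apply: le_esum => k _.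
  case: ifPn => [|_]; last by case: ifPn.
  rewrite inE => -[n /= yan <-]; rewrite ifT// inE/=.
  by apply: (lt_le_trans yan (ac _ _)); apply: le_lt_trans yan; rewrite lee_fin.
move=> n m; rewrite !inE/= => yan yam; apply: inj.
  by apply: le_lt_trans yan; rewrite lee_fin.
by apply: le_lt_trans yam; rewrite lee_fin.
Qed.

(** Indices with equal image differ by at most [M], so [tau] is injective on each residue class
    modulo [M.+1]; adding the classes costs the factor [M.+1]. *)
Lemma nseq_quasi E a c (tau : nat -> nat) M : (forall n, 0 <= a n)%E ->
  (forall n, 0 <= c n)%E ->
  (forall n, a n <= c (tau n))%E ->
  (forall n m, (n <= m)%N -> tau n = tau m -> (m - n <= M)%N) ->
  (nseq E a <= M.+1%:R%:E * nseq E c)%E.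
Proof.
move=> a0 c0 ac fib.
pose d (r : 'I_M.+1) n := if (n %% M.+1)%N == r then a n else 0%E.
have d0 r n : (0 <= d r n)%E by rewrite /d; case: ifP.
apply: (@le_trans _ _ (nseq E (fun n => \sum_(r <- enum 'I_M.+1) d r n)%E)).
  apply: nseq_le => //; first exact: ri_monotone.
  move=> n; rewrite big_enum/= (bigD1 (Ordinal (ltn_pmod n (ltn0Sn M))))//=.
  by rewrite {1}/d eqxx leeDl// sume_ge0.
apply: le_trans (nseq_sum E _ _) _ => //.
apply: (@le_trans _ _ (\sum_(r <- enum 'I_M.+1) nseq E c)%E).
  apply: lee_sum => r _; apply: (@nseq_inj _ _ _ tau) => //.
    by move=> n; rewrite /d; case: ifP => // _ _; exact: ac.
  move=> n m; rewrite /d; case: eqP => [nr _|_]; last by rewrite ltxx.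
  case: eqP => [mr _|_]; last by rewrite ltxx.
  have key i j : (i <= j)%N -> (i = j %[mod M.+1])%N -> tau i = tau j -> i = j.
    move=> ij emod /(fib _ _ ij) hM.
    have : (M.+1 %| j - i)%N by rewrite -eqn_mod_dvd//; apply/eqP.
    move=> /dvdn_leq; case: (posnP (j - i)) => [/eqP|j0 /(_ isT)]; last by rewrite ltnNge hM.
    by rewrite subn_eq0 => ji _; apply/eqP; rewrite eqn_leq ij.
  move=> e; case/orP: (leq_total n m) => nm; first by apply: key; rewrite ?nr ?mr.
  by apply/esym/key; rewrite ?nr ?mr.
rewrite big_enum/= sumr_const card_ord.
by rewrite mule_natl.
Qed.

Lemma nseq_shift E a k : (forall n, 0 <= a n)%E ->
  (nseq E (fun n => a (n + k)%N) <= nseq E a)%E.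
Proof.
move=> a0; apply: (@nseq_inj _ _ _ (addn^~ k)) => //.
by move=> n m _ _ /eqP; rewrite eqn_add2r => /eqP.
Qed.

Lemma nseq_unshift E a k : (forall n, 0 <= a n)%E ->
  (nseq E (fun n => if (k <= n)%N then a (n - k)%N else 0%E) <= nseq E a)%E.
Proof.
move=> a0; apply: (@nseq_inj _ _ _ (subn^~ k)) => //.
- by move=> n; case: ifP.
- by move=> n; case: ifP => //; rewrite ltxx.
move=> n m; case: ifP => [kn _|]; last by rewrite ltxx.
by case: ifP => [km _|]; [lia|rewrite ltxx].
Qed.

Lemma geometric_series_le (r : R) : 0 <= r < 1 ->
  (\sum_(k <oo) (r ^+ k)%:E <= ((1 - r)^-1)%:E)%E.
Proof.
move=> /andP[r0 r1]; apply: lime_le.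
  by apply: is_cvg_nneseries => n _ _; rewrite lee_fin exprn_ge0.
apply: nearW => n; rewrite sumEFin lee_fin -[leRHS]mul1r ler_pdivlMr ?subr_gt0//.
rewrite big_mkord mulrC -[_ - r]opprB mulNr -subrX1 opprB.
by rewrite gerBl exprn_ge0.
Qed.

Lemma nseq_geometric E (r : R) (A : nat -> nat -> \bar R) N : 0 <= r < 1 ->
  (forall k n, 0 <= A k n)%E -> (forall k, nseq E (A k) <= N)%E ->
  (nseq E (fun n => \sum_(k <oo) (r ^+ k)%:E * A k n) <= ((1 - r)^-1)%:E * N)%E.
Proof.
move=> r01 A0 AN; have r0 : 0 <= r by case/andP: r01.
have rk k : 0 <= r ^+ k by exact: exprn_ge0.
have rk' k : (0 <= (r ^+ k)%:E)%E by rewrite lee_fin.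
apply: le_trans (nseq_series _ _) _; first by move=> i n; rewrite mule_ge0.
have N0 : (0 <= N)%E by exact: le_trans (nseq_ge0 _ _) (AN 0%N).
apply: (@le_trans _ _ (\sum_(k <oo) (r ^+ k)%:E * N)%E).
  apply: lee_nneseries => [k _ _|k _]; first exact: nseq_ge0.
  by rewrite nseqZ// lee_wpmul2l.
(* The scaling rule for series covers real N only. For [N = +oo] the term k = 0, with coefficient 1,
   makes both sides infinite. *)
have -> : (\sum_(k <oo) (r ^+ k)%:E * N = (\sum_(k <oo) (r ^+ k)%:E) * N)%E.
  case: N N0 {AN} => [N N0||//].
    under eq_eseriesr do rewrite muleC.
    by rewrite nneseriesZl// muleC.
  move=> _; rewrite [RHS]muleC gt0_mulye//; last first.
    rewrite (nneseries_recl (P:=predT))//=.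
    by rewrite expr0 (lt_le_trans (@lte01 R))// leeDl// nneseries_ge0.
  by apply: (@nneseries_pinfty _ _ _ 0%N) => //; rewrite ?expr0 ?mul1e// => k _; rewrite mule_ge0 ?leey.
by rewrite lee_wpmul2r// geometric_series_le.
Qed.

Lemma nseq_geometric_left E (r : R) a : 0 <= r < 1 -> (forall n, 0 <= a n)%E ->
  (nseq E (fun n => \sum_(k <oo) (r ^+ k)%:E * a (n + k)%N)
   <= ((1 - r)^-1)%:E * nseq E a)%E.
Proof. by move=> r01 a0; apply: nseq_geometric => // k; exact: nseq_shift. Qed.

Lemma nseq_geometric_right E (r : R) a : 0 <= r < 1 -> (forall n, 0 <= a n)%E ->
  (nseq E (fun n => \sum_(j < n.+1) (r ^+ (n - j))%:E * a j)
   <= ((1 - r)^-1)%:E * nseq E a)%E.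
Proof.
move=> r01 a0; have r0 : 0 <= r by case/andP: r01.
pose A k n := if (k <= n)%N then a (n - k)%N else 0%E.
have A0 k n : (0 <= A k n)%E by rewrite /A; case: ifP.
apply: le_trans (nseq_geometric (A := A) r01 A0 _); last first.
  by move=> k; exact: nseq_unshift.
apply: nseq_le; first exact: ri_monotone.
  by move=> n; apply: sume_ge0 => i _; rewrite mule_ge0 ?lee_fin ?exprn_ge0.
move=> n; apply: le_trans (nneseries_lim_ge n.+1 _); last first.
  by move=> k _ _; rewrite mule_ge0 ?lee_fin ?exprn_ge0.
rewrite big_mkord (reindex_inj rev_ord_inj)/=; apply: lee_sum => -[i /= ni] _.
by rewrite subSS subKn// /A -ltnS ni.
Qed.

End SequenceNorm.
#[global] Hint Resolve truncn_nonneg_measurable : core.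

(** * Sequence norms for L_1 and L_oo *)

Section LebesgueFunctionals.
Variable R : realType.
Notation mu := (@lebesgue_measure R).
Implicit Types (X : nat -> \bar R) (f g : R -> \bar R).

Lemma lebesgue_setT_gt0 : (0 < mu [set: R])%E.
Proof.
have h : (mu `]0%R, 1%R[%classic <= mu setT)%E by apply: le_measure; rewrite ?inE.
by apply: lt_le_trans h; rewrite lebesgue_measure_itv/= lte_fin ltr01 oppr0 adde0 lte_fin.
Qed.

Lemma Lq_ooE f : Lq +oo%E f = ess_sup mu (fun x : R => `|(f \_ `]0%R, +oo[) x|%E).
Proof. by rewrite /Lq unlock/= lebesgue_setT_gt0. Qed.

Lemma Lq_1E f : Lq 1%E f = (\int[mu]_x `|(f \_ `]0%R, +oo[) x|)%E.
Proof. by rewrite /Lq Lnorm1. Qed.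

Lemma le_abse_restrict f g : nonneg_measurable f -> nonneg_measurable g ->
  (forall x, 0 < x -> (f x <= g x)%E) -> forall x,
  (`|(f \_ `]0%R, +oo[) x| <= `|(g \_ `]0%R, +oo[) x|)%E.
Proof.
move=> [_ f0] [_ g0] fg x; rewrite /patch; case: ifPn => //.
rewrite inE/= in_itv/= andbT => x0; rewrite !gee0_abs//; [exact: fg|exact: g0|exact: f0].
Qed.

Lemma Lq_oo_monotone : monotone_functional (@Lq R +oo%E).
Proof.
move=> f g hf hg fg; rewrite !Lq_ooE; apply: le_ess_sup.
by apply: nearW; exact: le_abse_restrict.
Qed.

Lemma Lq_1_monotone : monotone_functional (@Lq R 1%E).
Proof.
move=> f g hf hg fg; rewrite !Lq_1E; apply: le_nonneg_integral => x _.
by rewrite abse_ge0/=; exact: le_abse_restrict.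
Qed.

Lemma nseq_Lq_oo_le X M : (forall n, 0 <= X n <= M)%E -> (nseq (Lq +oo%E) X <= M)%E.
Proof.
move=> XM; have X0 n : (0 <= X n)%E by case/andP: (XM n).
have XM' n : (X n <= M)%E by case/andP: (XM n).
have M0 : (0 <= M)%E by exact: le_trans (XM' 0%N).
rewrite /nseq /tilde Lq_ooE; apply/ess_supP/nearW => x.
rewrite /= patchE; case: ifPn => [|_]; last by rewrite abse0.
rewrite inE/= in_itv/= andbT => x0; rewrite gee0_abs ?rearrangement_ge0//.
case: M {XM} M0 XM' => [M|_ _|//]; rewrite ?leey// lee_fin => M0 XM.
rewrite leNgt lt_rearrangement_seq// -leNgt /dist_seq eseries0 ?lee_fin ?ltW// => n _.
by rewrite ltNge XM.
Qed.

(** If [X n] exceeded the essential supremum, so would the rearrangement on all of (0, 1), because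
    one block has mass 1; a null set cannot contain that interval. *)
Lemma nseq_Lq_oo_ge X n : (forall n, 0 <= X n)%E -> (X n <= nseq (Lq +oo%E) X)%E.
Proof.
move=> X0; rewrite leNgt; apply/negP; rewrite /nseq /tilde Lq_ooE.
set r := rearrangement _ _; set s := ess_sup _ _ => sX.
have := ess_sup_ge mu (fun x : R => `|(r \_ `]0%R, +oo[) x|%E); rewrite -/s.
have s0 : (0 <= s)%E.
  by apply: ess_sup_gee; [exact: lebesgue_setT_gt0|apply: nearW => x; rewrite abse_ge0].
case: s s0 sX => [s||//]; last by move=> _; rewrite ltNge leey.
rewrite lee_fin => s0 sX [N [mN N0 hN]].
have : (mu `]0%R, 1%R[%classic <= mu N)%E.
  apply: le_measure; rewrite ?inE// => x; rewrite /= in_itv/= => /andP[x0 x1].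
  apply: hN => /=; apply/negP; rewrite -ltNge patchE mem_set/= ?in_itv/= ?x0//.
  rewrite gee0_abs ?rearrangement_ge0// lt_rearrangement_seq//.
  rewrite /dist_seq (@nneseriesD1 _ _ n)//.
  apply: lt_le_trans (_ : 1 <= _)%E; first by rewrite lte_fin.
  by rewrite leeDl// nneseries_ge0.
by rewrite [X in (_ <= X)%E -> _]N0 lebesgue_measure_itv/= lte_fin ltr01 oppr0 adde0 lee_fin ler10.
Qed.

Lemma lebesgue_subgraph (z : \bar R) : (0 <= z)%E ->
  mu [set y : R | 0 < y /\ (y%:E < z)%E] = z.
Proof.
case: z => [d d0||//].
  rewrite (_ : mkset _ = `]0, d[%classic).
    rewrite lebesgue_measure_itv/= lte_fin oppr0 adde0.
    by move: d0; rewrite lee_fin le_eqVlt => /orP[/eqP <-|->]//; rewrite ltxx.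
  by apply/seteqP; split=> y /=; rewrite in_itv/= lte_fin; [move=> [-> ->]|move/andP].
move=> _; rewrite (_ : mkset _ = `]0, +oo[%classic); first by rewrite lebesgue_measure_itv/= ltry.
by apply/seteqP; split=> y /=; rewrite in_itv/= andbT ltry; [case|].
Qed.

(* Tonelli on the subgraph of f. *)
Lemma layer_cake f : nonneg_measurable f ->
  (\int[mu]_x `|(f \_ `]0%R, +oo[) x| =
   \int[mu]_(y in `]0%R, +oo[) mu (`]0%R, +oo[%classic `&` [set x | (y%:E < f x)%E]))%E.
Proof.
move=> [mf f0]; pose g := f \_ `]0, +oo[.
have mg : measurable_fun setT g by apply/(measurable_restrictT _ _).1.
have g0 x : (0 <= g x)%E.
  by rewrite /g patchE; case: ifPn => //; rewrite inE/= in_itv/= andbT; exact: f0.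
pose A := [set p : R * R | 0 < p.2 /\ (p.2%:E < g p.1)%E].
have mA : measurable A.
  rewrite (_ : A = (setT `&` [set p | (0 < (EFin \o snd) p)%E]) `&`
    (setT `&` [set p | ((EFin \o snd) p < (g \o fst) p)%E])).
    apply: measurableI; first by apply: emeasurable_fun_o_infty => //; exact/measurable_EFinP.
    apply: measurable_lte => //.
    - exact/measurable_EFinP.
    - exact: measurableT_comp.
  by rewrite !setTI.
have m1 : measurable_fun [set: R * R] (fun p => (\1_A p)%:E : \bar R).
  by apply/measurable_EFinP; exact: measurable_indic.
have ind0 p : (0 <= (\1_A p)%:E :> \bar R)%E by rewrite lee_fin.
have indE (B : set R) (h : R -> R) : measurable B -> (forall z, h z = \1_B z) ->
    (\int[mu]_z (h z)%:E = mu B)%E.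
  move=> mB hB; transitivity (\int[mu]_z (\1_B z)%:E)%E.
    by apply: eq_integral => z _; rewrite hB.
  by rewrite integral_indic// setIT.
transitivity (\int[mu]_x \int[mu]_y (\1_A (x, y))%:E)%E.
  apply: eq_integral => x _; rewrite -/g gee0_abs//.
  rewrite (indE [set y : R | 0 < y /\ (y%:E < g x)%E]) ?lebesgue_subgraph//.
  apply: is_interval_measurable => u v [u0 ug] [v0 vg] w /andP[uw wv]; split.
    exact: lt_le_trans uw.
  by apply: le_lt_trans vg; rewrite lee_fin.
rewrite (@fubini_tonelli _ _ _ _ _ mu mu (fun p => (\1_A p)%:E : \bar R) m1 ind0).
rewrite [RHS]integral_mkcond; apply: eq_integral => y _; rewrite patchE.
case: ifPn => [|/negP]; rewrite inE/= in_itv/= andbT => y0; last first.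
  rewrite (indE set0) ?measure0// => x; rewrite indic0 indicE memNset//=.
  by case => y0' _; rewrite y0' in y0.
rewrite (indE (`]0, +oo[%classic `&` [set x | (y%:E < f x)%E]))//.
  exact: emeasurable_fun_o_infty.
move=> x; rewrite !indicE; congr ((nat_of_bool _)%:R); apply/idP/idP; rewrite !inE/=.
  move=> [_]; rewrite /g patchE; case: ifPn => [|_]; first by rewrite inE/=.
  by rewrite -/(0%E : \bar R) lte_fin ltNge (ltW y0).
by move=> [x0 yf]; split => //; rewrite /g patchE mem_set.
Qed.

(** The layer cake formula turns the norm into the integral of the distribution function, which is
    the sum of the indicators of (0, X n); each of them integrates to [X n]. *)
Lemma nseq_Lq_1 X : (forall n, 0 <= X n)%E -> (nseq (Lq 1%E) X = \sum_(n <oo) X n)%E.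
Proof.
move=> X0; rewrite /nseq /tilde Lq_1E layer_cake//.
pose B n := [set y : R | 0 < y /\ (y%:E < X n)%E].
have mB n : measurable (B n).
  apply: is_interval_measurable => u v [u0 ug] [v0 vg] w /andP[uw wv]; split.
    exact: lt_le_trans uw.
  by apply: le_lt_trans vg; rewrite lee_fin.
transitivity (\int[mu]_(y in `]0%R, +oo[) \sum_(n <oo) (\1_(B n) y)%:E)%E.
  apply: eq_integral => y; rewrite inE/= in_itv/= andbT => y0.
  rewrite lebesgue_dist_rearrangement_seq// ?ltW// /dist_seq eseries_mkcond.
  apply: eq_eseriesr => n _; rewrite indicE; case: ifPn => h; first by rewrite mem_set.
  by rewrite memNset// => -[_ yX]; rewrite yX in h.
rewrite integral_nneseries//=; last first.
  move=> n; apply/measurable_EFinP; apply: measurable_indic; exact: mB.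
apply: eq_eseriesr => n _; rewrite integral_indic//; last exact: mB.
rewrite setIidl; first exact: lebesgue_subgraph.
by move=> y [y0 _]; rewrite /= in_itv/= y0.
Qed.

End LebesgueFunctionals.

(** * Non-increasing rearrangements of functions *)

Section Rearrangement.
Variable R : realType.
Notation mu := (@lebesgue_measure R).
Implicit Types (f g : R -> R) (x y : R).

Definition superlevel f y : set R := [set s | y < `|f s|] `&` `]0, 1[.

Lemma fstarE f x : fstar f x =
  ereal_inf [set y%:E | y in [set y : R | 0 <= y /\ (mu (superlevel f y) <= x%:E)%E]].
Proof.
by rewrite /fstar /rearrangement.
Qed.

Lemma fstar_antitone f x y : x <= y -> (fstar f y <= fstar f x)%E.
Proof. exact: rearrangement_antitone. Qed.

Lemma fstar_ge0 f x : (0 <= fstar f x)%E.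
Proof. exact: rearrangement_ge0. Qed.

Lemma measurable_superlevel f y : measurable_fun (`]0, 1[ : set R) f -> measurable (superlevel f y).
Proof.
move=> mf; rewrite /superlevel setIC.
have -> : [set s | y < `|f s|] = [set s | (y%:E < (EFin \o (Num.norm \o f)) s)%E] by [].
apply: emeasurable_fun_o_infty => //; apply/measurable_EFinP.
exact: measurableT_comp.
Qed.

Lemma le_superlevel f x y : measurable_fun (`]0, 1[ : set R) f -> x <= y ->
  (mu (superlevel f y) <= mu (superlevel f x))%E.
Proof.
move=> mf xy; apply: le_measure; rewrite ?inE; [exact: measurable_superlevel..|].
by move=> s [/= h ?]; split => //=; exact: le_lt_trans h.
Qed.

Lemma fstar_le f x y : 0 <= y -> (mu (superlevel f y) <= x%:E)%E -> (fstar f x <= y%:E)%E.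
Proof. by move=> y0 h; rewrite fstarE; apply: ereal_inf_lbound; exists y. Qed.

(** The infimum defining f^* is attained: the level set at [y] is the increasing union of those at y
    + 1/(n+1), each of measure at most [x]. *)
Lemma superlevel_fstar f x y : measurable_fun (`]0, 1[ : set R) f -> fstar f x = y%:E ->
  (mu (superlevel f y) <= x%:E)%E.
Proof.
move=> mf fy; have y0 : 0 <= y by rewrite -lee_fin -fy fstar_ge0.
pose A n := superlevel f (y + n.+1%:R^-1).
have UA : superlevel f y = \bigcup_n A n.
  apply/seteqP; split=> [s [/= ys s01]|s [n _ [/= h s01]]]; last first.
    by split => //=; apply: lt_trans h; rewrite ltrDl invr_gt0.
  have d0 : 0 < `|f s| - y by rewrite subr_gt0.
  have [n _ /(_ n (leqnn n)) /= hn] := near_infty_natSinv_lt (PosNum d0).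
  by exists n => //; split => //=; rewrite -ltrBrDl.
have cv : mu \o A @ \oo --> mu (superlevel f y).
  rewrite UA; apply: nondecreasing_cvg_mu.
  - by move=> n; exact: measurable_superlevel.
  - by apply: bigcup_measurable => n _; exact: measurable_superlevel.
  - move=> n m nm; apply/subsetPset => s [/= h s01]; split => //=.
    apply: le_lt_trans h; rewrite lerD2l lef_pV2 ?posrE ?ltr0n// ler_nat.
    exact: leq_ltn_trans nm _.
rewrite -(cvg_lim _ cv)//; apply: lime_le; first by apply/cvg_ex; eexists; exact: cv.
apply: nearW => n /=; rewrite leNgt; apply/negP => h.
have : ((y + n.+1%:R^-1)%:E <= fstar f x)%E.
  rewrite fstarE; apply: le_ereal_inf_tmp => _ [z [z0 hz] <-]; rewrite lee_fin leNgt.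
  apply/negP => zy; move: (lt_le_trans h (le_superlevel mf (ltW zy))).
  by rewrite ltNge hz.
by rewrite fy lee_fin leNgt ltrDl invr_gt0 ltr0n.
Qed.

(** Off the null set where the decomposition fails, |f| > r0 + r1 forces |f0| > r0 or |f1| > r1. An
    infinite value on the right makes the bound trivial. *)
Lemma fstarD f f0 f1 x y : measurable_fun (`]0, 1[ : set R) f -> measurable_fun (`]0, 1[ : set R) f0 ->
  measurable_fun (`]0, 1[ : set R) f1 ->
  {ae mu, forall s : R, 0 < s < 1 -> f s = f0 s + f1 s} ->
  (fstar f (x + y) <= fstar f0 x + fstar f1 y)%E.
Proof.
move=> mf mf0 mf1 [N [mN N0 hN]].
case E0 : (fstar f0 x) (fstar_ge0 f0 x) => [r0||//] r0_ge0; last first.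
  by rewrite addye ?leey// gt_eqF// (lt_le_trans _ (fstar_ge0 _ _)).
case E1 : (fstar f1 y) (fstar_ge0 f1 y) => [r1||//] r1_ge0; last by rewrite addey ?leey.
apply: fstar_le; first by rewrite addr_ge0.
have h0 := superlevel_fstar mf0 E0; have h1 := superlevel_fstar mf1 E1.
have m0 := measurable_superlevel r0 mf0; have m1 := measurable_superlevel r1 mf1.
have sub : superlevel f (r0 + r1) `<=` superlevel f0 r0 `|` superlevel f1 r1 `|` N.
  move=> s [/= fs s01]; have [es|nes] := pselect (f s = f0 s + f1 s); last first.
    by right; apply: hN => /= h; apply: nes; apply: h; move: s01; rewrite /= in_itv.
  left; have [h|h] := ltP r0 `|f0 s|; first by left; split.
  right; split => //=; rewrite ltNge; apply/negP => h'.
  move: fs; rewrite ltNge es => /negP; apply.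
  by apply: le_trans (ler_normD _ _) _; exact: lerD.
apply: (@le_trans _ _ (mu (superlevel f0 r0 `|` superlevel f1 r1 `|` N))).
  by apply: le_measure; rewrite ?inE//; [exact: measurable_superlevel|apply: measurableU => //; exact: measurableU].
apply: le_trans (measureU2 mu (measurableU _ _ m0 m1) mN) _.
rewrite [X in (_ + X)%E](_ : _ = 0%E)//; rewrite adde0.
apply: le_trans (measureU2 mu m0 m1) _.
by rewrite EFinD; exact: leeD.
Qed.

Lemma fstar_mono f g x : measurable_fun (`]0, 1[ : set R) f -> measurable_fun (`]0, 1[ : set R) g ->
  (forall s, 0 < s < 1 -> `|f s| <= `|g s|) -> (fstar f x <= fstar g x)%E.
Proof.
move=> mf mg fg; rewrite !fstarE; apply: ereal_inf_le_tmp => _ [y [y0 hy] <-].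
exists y => //; split => //; apply: le_trans hy.
apply: le_measure; rewrite ?inE; [exact: measurable_superlevel..|].
by move=> s [/= h s01]; split => //=; apply: lt_le_trans h (fg _ _); rewrite /= in_itv in s01.
Qed.

Lemma fstar_bounded f x y : 0 <= x -> 0 <= y -> (forall s, 0 < s < 1 -> `|f s| <= y) ->
  (fstar f x <= y%:E)%E.
Proof.
move=> x0 y0 fy; apply: fstar_le => //.
have -> : superlevel f y = set0.
  apply/seteqP; split => // s [/= h s01]; move: h; rewrite ltNge fy//.
by rewrite measure0 lee_fin.
Qed.

(** Truncation at height [y], preserving signs. Later [cut f y] is the part of f placed in the A
    space, and [f - cut f y] the part placed in the B space. *)
Definition cut f y s := Num.max (- y) (Num.min (f s) y).

Lemma measurable_cut f y : measurable_fun (`]0, 1[ : set R) f -> measurable_fun (`]0, 1[ : set R) (cut f y).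
Proof.
move=> mf; apply: measurable_maxr; first exact: measurable_cst.
by apply: measurable_minr => //; exact: measurable_cst.
Qed.

Lemma norm_cut f y s : 0 <= y -> `|cut f y s| <= y /\ `|cut f y s| <= `|f s|.
Proof.
move=> y0; rewrite /cut.
case: (lerP (f s) y) => h1; case: (lerP (- y) _) => h2;
  case: (lerP 0 (f s)) => h3; rewrite ?(ger0_norm h3) ?(ltr0_norm h3) ?normrN ?(ger0_norm y0);
  split; lra.
Qed.

Lemma norm_sub_cut f y s : 0 <= y -> `|f s - cut f y s| <= `|f s| /\
  (0 < `|f s - cut f y s| -> y < `|f s|).
Proof.
move=> y0; rewrite /cut normr_gt0 subr_eq0.
case: (lerP (f s) y) => h1; case: (lerP (- y) _) => h2.
- by rewrite subrr normr0 eqxx.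
- by split => [|_]; rewrite ?ltr0_norm; lra.
- by split => [|_]; rewrite ?gtr0_norm; lra.
- exfalso; lra.
Qed.

(** The difference vanishes where |f| <= y, so its support has measure at most [x]. *)
Lemma fstar_sub_cut f x y z : measurable_fun (`]0, 1[ : set R) f -> fstar f x = y%:E -> x <= z ->
  fstar (fun s => f s - cut f y s) z = 0%E.
Proof.
move=> mf fy xz; have y0 : 0 <= y by rewrite -lee_fin -fy fstar_ge0.
apply/eqP; rewrite eq_le fstar_ge0 andbT; apply: fstar_le => //.
apply: (@le_trans _ _ x%:E); last by rewrite lee_fin.
apply: le_trans (superlevel_fstar mf fy); apply: le_measure; rewrite ?inE.
- apply: measurable_superlevel; apply: measurable_funB => //; exact: measurable_cut.
- exact: measurable_superlevel.
- by move=> s [/= h s01]; split => //=; exact: (norm_sub_cut f s y0).2.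
Qed.

End Rearrangement.

(** * Slowly changing weights *)

Section Discretization.
Variable R : realType.
Implicit Types (w : R -> R) (X : nat -> \bar R) (F : (R -> \bar R) -> \bar R).
Implicit Types (t s : R) (n m k : nat) (f : R -> R) (h : R -> \bar R) (I : set R).

Definition en n : R := expR (- n%:R).

Lemma en_gt0 n : 0 < en n. Proof. exact: expR_gt0. Qed.

Lemma en_le1 n : en n <= 1.
Proof. by rewrite -expR0 ler_expR oppr_le0. Qed.

Lemma en_itv n : 0 < en n <= 1. Proof. by rewrite en_gt0 en_le1. Qed.

Lemma block_gt0 n t : block n t -> 0 < t.
Proof. by move=> /blockE[/andP[]]. Qed.

Lemma block_le1 n t : block n t -> t <= 1.
Proof. by move=> /blockE[/andP[]]. Qed.

Lemma block_lt n t : block n t -> en n.+1 < t.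
Proof. by rewrite /block /= in_itv/= => /andP[]. Qed.

Lemma block_le n t : block n t -> t <= en n.
Proof. by rewrite /block /= in_itv/= => /andP[]. Qed.

Lemma en_block n : block n (en n).
Proof. by rewrite /block /= in_itv/= lexx andbT ltr_expR ltrN2 ltr_nat. Qed.

Lemma le_en n m : (n <= m)%N -> en m <= en n.
Proof. by move=> nm; rewrite ler_expR lerN2 ler_nat. Qed.

Lemma lt_block n m s t : (n < m)%N -> block n t -> block m s -> s < t.
Proof.
move=> nm /block_lt h /block_le h'; apply: le_lt_trans h; apply: le_trans h' _.
exact: le_en.
Qed.

Lemma block_lt1 n t : block n.+1 t -> t < 1.
Proof.
move=> /block_le h; apply: le_lt_trans h _.
by rewrite -expR0 ltr_expR oppr_lt0 ltr0n.
Qed.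

(** A change by a bounded factor over [D] blocks: the ratio [expR D%:R] of arguments is a distance D
    in the logarithmic scale. The class is stable under products, inverses and real powers, and
    contains all weights that get sampled at e^-n. *)
Definition coarse w := (forall t, 0 < t <= 1 -> 0 < w t) /\
  forall D : nat, exists2 C : R, 0 < C & forall s t, 0 < t -> t <= s -> s <= 1 ->
    s <= expR D%:R * t -> w s <= C * w t /\ w t <= C * w s.

Lemma coarse_block w D : coarse w -> exists2 C : R, 0 < C & forall n m s t,
  (n <= m)%N -> (m <= n + D)%N -> block n s -> block m t -> w s <= C * w t /\ w t <= C * w s.
Proof.
move=> [_ /(_ D.+1)[C C0 hC]]; exists C => // n m s t nm mn bs bt.
have ratio : s <= expR D.+1%:R * t /\ t <= expR D.+1%:R * s.
  have ls := block_le bs; have lt := block_le bt.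
  have gs := block_lt bs; have gt := block_lt bt.
  have e1 : en n <= expR D.+1%:R * en m.+1.
    rewrite /en -expRD ler_expR -!natr1 lerBrDr -lerBlDl.
    by move: mn; rewrite -(ler_nat R) natrD; lra.
  split; first by apply: le_trans ls (le_trans e1 _); rewrite ler_wpM2l ?expR_ge0// ltW.
  apply: le_trans lt _; apply: le_trans (le_en nm) _.
  apply: (@le_trans _ _ (expR D.+1%:R * en n.+1)).
    by rewrite /en -expRD ler_expR -!natr1; have := ler0n R D; lra.
  by rewrite ler_wpM2l ?expR_ge0// ltW.
have [ts|st] := leP t s.
  by apply: hC => //; [exact: block_gt0 bt|exact: block_le1 bs|case: ratio].
by have [] := hC t s (block_gt0 bs) (ltW st) (block_le1 bt) ratio.2.
Qed.

Lemma coarse_cst (c : R) : 0 < c -> coarse (fun=> c).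
Proof. by move=> c0; split => // D; exists 1 => // *; rewrite mul1r. Qed.

Lemma coarseM w v : coarse w -> coarse v -> coarse (fun t => w t * v t).
Proof.
move=> [w0 hw] [v0 hv]; split=> [t t01|D]; first by rewrite mulr_gt0 ?w0 ?v0.
have [C C0 hC] := hw D; have [C' C'0 hC'] := hv D.
exists (C * C') => [|s t t0 ts s1 r]; first exact: mulr_gt0.
have [h1 h2] := hC s t t0 ts s1 r; have [h3 h4] := hC' s t t0 ts s1 r.
have s0 : 0 < s by exact: lt_le_trans ts.
have t1 : t <= 1 by exact: le_trans s1.
have ws : 0 <= w s by rewrite ltW// w0// s0.
have vs : 0 <= v s by rewrite ltW// v0// s0.
have wt : 0 <= w t by rewrite ltW// w0// t0.
have vt : 0 <= v t by rewrite ltW// v0// t0.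
by split; rewrite mulrACA; apply: ler_pM.
Qed.

(** In logarithms the comparison reads |ln x - ln y| <= |ln C|; multiplying by |e| treats both signs
    of the exponent at once. *)
Lemma coarse_powR w (e : R) : coarse w -> coarse (fun t => w t `^ e).
Proof.
move=> [w0 hw]; split=> [t t01|D]; first by rewrite powR_gt0 ?w0.
have [C C0 hC] := hw D.
have key (x y : R) : 0 < x -> 0 < y -> x <= C * y -> y <= C * x ->
    x `^ e <= expR (`|e| * `|ln C|) * y `^ e.
  move=> x0 y0 xy yx; rewrite /powR !gt_eqF// -expRD ler_expR.
  have h1 : ln x <= ln C + ln y by rewrite -lnM ?posrE// ler_ln ?posrE ?mulr_gt0.
  have h2 : ln y <= ln C + ln x by rewrite -lnM ?posrE// ler_ln ?posrE ?mulr_gt0.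
  have h3 : `|ln x - ln y| <= `|ln C|.
    by apply: le_trans (ler_norm _); rewrite ler_norml; apply/andP; split; lra.
  rewrite -lerBlDr -mulrBr; apply: le_trans (ler_norm _) _.
  by rewrite normrM ler_wpM2l.
exists (expR (`|e| * `|ln C|)) => [|s t t0 ts s1 r]; first exact: expR_gt0.
have [h1 h2] := hC s t t0 ts s1 r.
have s0 : 0 < s by exact: lt_le_trans ts.
by split; apply: key => //; apply: w0; rewrite ?s0 ?t0//= (le_trans ts).
Qed.

Lemma coarse_id : coarse (fun t => t).
Proof.
split=> [t /andP[]//|D]; exists (expR D%:R) => [|s t t0 ts s1 r]; first exact: expR_gt0.
split => //; apply: (le_trans ts); rewrite ler_peMl//; first exact: le_trans (ltW t0) ts.
by rewrite -expR0 ler_expR.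
Qed.

Lemma ell_le1 t : 0 < t <= 1 -> ell t = 1 - ln t.
Proof. by move=> /andP[t0 t1]; rewrite /ell ler0_norm// ln_le0. Qed.

Lemma ell_ge1 t : 1 <= ell t. Proof. by rewrite /ell lerDl. Qed.

Lemma ell_en n : ell (en n) = n.+1%:R.
Proof. by rewrite ell_le1 ?en_itv// /en expRK opprK nat1r. Qed.

Lemma coarse_ell : coarse (@ell R).
Proof.
split=> [t _|D]; first exact: lt_le_trans (ell_ge1 t).
exists D.+1%:R => // s t t0 ts s1 r.
have s0 : 0 < s by exact: lt_le_trans ts.
have t1 : t <= 1 by exact: le_trans s1.
have es : ell s = 1 - ln s by rewrite ell_le1// s0.
have et : ell t = 1 - ln t by rewrite ell_le1// t0.
have l1 : ln t <= ln s by rewrite ler_ln.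
have l2 : ln s <= D%:R + ln t.
  by rewrite -[D%:R]expRK -lnM ?posrE ?expR_gt0// ler_ln ?posrE ?mulr_gt0 ?expR_gt0.
have := ell_ge1 s; have := ell_ge1 t; rewrite es et -natr1 => h1 h2.
have d0 := ler0n R D; split; nra.
Qed.

Definition homogeneous F := forall (r : R) X, 0 <= r -> (forall n, 0 <= X n)%E ->
  (nseq F (fun n => r%:E * X n) <= r%:E * nseq F X)%E.

Lemma ri_homogeneous (E : ri_space R) : homogeneous E.
Proof. by move=> r X r0 X0; rewrite nseqZ. Qed.

Lemma Lq_1_homogeneous : homogeneous (@Lq R 1%E).
Proof.
move=> r X r0 X0; rewrite !nseq_Lq_1//; first by rewrite nneseriesZl.
by move=> n; rewrite mule_ge0.
Qed.

Lemma Lq_oo_homogeneous : homogeneous (@Lq R +oo%E).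
Proof.
move=> r X r0 X0; apply: nseq_Lq_oo_le => n; rewrite mule_ge0//=.
by rewrite lee_wpmul2l// nseq_Lq_oo_ge.
Qed.

(** [C'] is chosen before [I], [h] and [X], so inner norms over an interval that moves with the
    outer variable are bounded uniformly. *)
Lemma tilde_le_seq F w (C : R) : monotone_functional F -> homogeneous F ->
  coarse w -> 0 < C -> exists2 C' : R, 0 < C' & forall I h X,
  (forall n, 0 <= X n)%E -> (forall t, I t -> 0 < t <= 1) ->
  (forall n t, I t -> block n t -> (0 <= h t <= C%:E * X n)%E) ->
  (tilde F I (fun t => (w t)%:E * h t) <=
   C'%:E * nseq F (fun n => (w (en n))%:E * X n))%E.
Proof.
move=> mF hF cw C0; have [K K0 hK] := coarse_block 0 cw.
have w0 := cw.1; exists (K * C) => [|I h X X0 I01 hX]; first exact: mulr_gt0.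
have wX n : (0 <= (w (en n))%:E * X n)%E.
  by rewrite mule_ge0// lee_fin ltW// w0// en_itv.
apply: le_trans (hF _ _ _ wX); last by rewrite ltW// mulr_gt0.
apply: tilde_le => // [n|t It]; first by rewrite mule_ge0// lee_fin ltW// mulr_gt0.
have t01 := I01 _ It; split => //; have bt := idx_block t01.
have /andP[h0 h1] := hX _ _ It bt.
have [wK _] := hK _ _ _ _ (leqnn _) (leq_addr _ _) bt (en_block (idx t)).
have wt0 : 0 <= w t by rewrite ltW// w0.
rewrite gee0_abs ?mule_ge0//; apply: (@le_trans _ _ ((w t)%:E * (C%:E * X (idx t)))%E).
  by rewrite lee_wpmul2l.
rewrite !muleA -!EFinM lee_wpmul2r// lee_fin mulrAC ler_wpM2r// ltW//.
Qed.

(** [X n] is compared with [h] only [m.+1] blocks further in. Over this distance the weight changes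
    by a bounded factor, and the shift of blocks does not alter the distribution. *)
Lemma tilde_ge_seq F w (C : R) m : monotone_functional F -> homogeneous F ->
  coarse w -> 0 < C -> exists2 C' : R, 0 < C' & forall I h X,
  (forall n, 0 <= X n)%E ->
  (forall n t, (0 < X n)%E -> block (n + m.+1) t -> I t /\ (X n <= C%:E * h t)%E) ->
  (nseq F (fun n => (w (en n))%:E * X n) <=
   C'%:E * tilde F I (fun t => (w t)%:E * h t))%E.
Proof.
move=> mF hF cw C0; have [K K0 hK] := coarse_block m.+1 cw.
have w0 := cw.1; exists (K * C) => [|I h X X0 hX]; first exact: mulr_gt0.
have KC0 : 0 < K * C by exact: mulr_gt0.
(* Dividing by the constants beforehand gives a domination with constant 1, as [tilde_ge] requires;
   homogeneity restores them. *)
pose Y n := (((K * C)^-1 * w (en n))%:E * X n)%E.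
have wn0 n : 0 < w (en n) by rewrite w0// en_itv.
have Y0 n : (0 <= Y n)%E by rewrite mule_ge0// lee_fin mulr_ge0 ?invr_ge0 ?ltW.
have -> : (fun n => (w (en n))%:E * X n)%E = (fun n => (K * C)%:E * Y n)%E.
  by apply/funext => n; rewrite /Y muleA -EFinM mulrA divff ?mul1r// gt_eqF.
apply: le_trans (hF _ _ (ltW KC0) Y0) _; apply: lee_wpmul2l; first by rewrite lee_fin ltW.
apply: (@tilde_ge _ _ _ _ _ m) => // n t Yn bt.
have Xn : (0 < X n)%E.
  rewrite lt_neqAle X0 andbT; apply/eqP => X0'; move: Yn; rewrite /Y -X0'.
  by rewrite mule0 ltxx.
have [It hX'] := hX _ _ Xn bt; split => //; apply: le_trans (lee_abs _).
have [wK _] := hK _ _ _ _ (leq_addr _ _) (leqnn _) (en_block n) bt.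
apply: (@le_trans _ _ (((K * C)^-1 * w (en n))%:E * (C%:E * h t))%E).
  by rewrite lee_wpmul2l// lee_fin mulr_ge0 ?invr_ge0 ?ltW.
have h0 : (0 <= h t)%E.
  rewrite -(@pmule_rge0 _ C%:E) ?lte_fin//; apply: le_trans hX'; exact: ltW.
rewrite muleA -EFinM lee_wpmul2r// lee_fin.
rewrite [leLHS](_ : _ = K^-1 * w (en n)); first by rewrite ler_pdivrMl.
by field; rewrite !gt_eqF.
Qed.

End Discretization.

(** * Inner norms over (0, t) and (t, 1), and averages *)

Section InnerFunctionals.
Variable R : realType.
Notation mu := (@lebesgue_measure R).
Implicit Types (w : R -> R) (v : nat -> R) (a c : nat -> \bar R).
Implicit Types (t s : R) (n m k : nat) (f : R -> R) (h : R -> \bar R) (I : set R).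

(** The sample sits at the left end of block n, so it dominates f^* on that block and is dominated
    by f^* on every later one. *)
Definition fseq f n : \bar R := fstar f (en R n.+1).

Definition Sseq v a n : \bar R := ereal_sup [set (v k)%:E * a k | k in [set k | (n <= k)%N]]%E.

Definition Tseq v a n : \bar R := (\sum_(k < n.+1) (v k)%:E * a k)%E.

Lemma fseq_ge0 f n : (0 <= fseq f n)%E. Proof. exact: fstar_ge0. Qed.

Lemma fstar_block_le f n t : block n t -> (fstar f t <= fseq f n)%E.
Proof. by move=> /block_lt /ltW; exact: fstar_antitone. Qed.

Lemma fstar_block_ge f n m t : (n < m)%N -> block m t -> (fseq f n <= fstar f t)%E.
Proof.
by move=> nm /block_le h; apply: fstar_antitone; apply: le_trans h _; exact: le_en.
Qed.

Lemma Sseq_ge v a n k : (n <= k)%N -> ((v k)%:E * a k <= Sseq v a n)%E.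
Proof. by move=> nk; apply: ereal_sup_ubound; exists k. Qed.

Lemma Sseq_le v a n M : (forall k, (n <= k)%N -> (v k)%:E * a k <= M)%E -> (Sseq v a n <= M)%E.
Proof. by move=> h; apply: ge_ereal_sup => _ [k nk <-]; exact: h. Qed.

Lemma Sseq_ge0 v a n : (forall k, 0 <= v k) -> (forall k, 0 <= a k)%E -> (0 <= Sseq v a n)%E.
Proof. by move=> v0 a0; apply: le_trans (Sseq_ge _ _ (leqnn n)); rewrite mule_ge0 ?lee_fin. Qed.

Lemma Tseq_ge0 v a n : (forall k, 0 <= v k) -> (forall k, 0 <= a k)%E -> (0 <= Tseq v a n)%E.
Proof. by move=> v0 a0; apply: sume_ge0 => k _; rewrite mule_ge0 ?lee_fin. Qed.

Lemma Tseq_nd v a n m : (forall k, 0 <= v k) -> (forall k, 0 <= a k)%E -> (n <= m)%N ->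
  (Tseq v a n <= Tseq v a m)%E.
Proof.
move=> v0 a0 nm; rewrite /Tseq -!(big_mkord predT (fun k => (v k)%:E * a k)%E).
rewrite [leRHS](@big_cat_nat _ _ _ n.+1)//= leeDl// sume_ge0// => k _.
by rewrite mule_ge0 ?lee_fin.
Qed.

Lemma block_itv n t : block n t -> 0 < t <= 1.
Proof. by move=> bt; rewrite (block_gt0 bt) (block_le1 bt). Qed.

Lemma coarse_en_ge0 w n : coarse w -> 0 <= w (en R n).
Proof. by move=> cw; rewrite ltW// cw.1// en_itv. Qed.

(** In the lower bound entry k is realized on block k+3, where f^* is at least a_k; for k >= n and t
    in block n+2 that block lies in (0, t). *)
Lemma tilde_Lq_oo_Sseq w : coarse w -> exists2 C : R, 0 < C & forall f,
  (forall n t, block n t ->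
    (tilde (Lq +oo%E) `]0%R, t[ (fun s => (w s)%:E * fstar f s) <=
     C%:E * Sseq (w \o en R) (fseq f) n)%E) /\
  (forall n t, block n.+2 t ->
    (Sseq (w \o en R) (fseq f) n <=
     C%:E * tilde (Lq +oo%E) `]0%R, t[ (fun s => (w s)%:E * fstar f s))%E).
Proof.
move=> cw.
have [C1 C10 h1] := tilde_le_seq (@Lq_oo_monotone R) (@Lq_oo_homogeneous R) cw ltr01.
have [C2 C20 h2] := tilde_ge_seq 2 (@Lq_oo_monotone R) (@Lq_oo_homogeneous R) cw ltr01.
exists (C1 + C2) => [|f]; first exact: addr_gt0.
pose X n k := if (n <= k)%N then fseq f k else 0%E.
have X0 n k : (0 <= X n k)%E by rewrite /X; case: ifP => // _; exact: fseq_ge0.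
split=> n t bt.
  apply: le_trans (h1 _ _ (X n) (X0 n) _ _) _.
  - move=> s /=; rewrite in_itv/= => /andP[-> st].
    by rewrite ltW// (lt_le_trans st)//; exact: block_le1 bt.
  - move=> k s /=; rewrite in_itv/= => /andP[s0 st] bs; rewrite fstar_ge0 mul1e /X.
    rewrite ifT; first exact: fstar_block_le.
    by rewrite leqNgt; apply/negP => kn; have := lt_block kn bs bt; rewrite ltNge ltW.
  have S0 : (0 <= Sseq (w \o en R) (fseq f) n)%E.
    by apply: Sseq_ge0 => k; [exact: coarse_en_ge0|exact: fseq_ge0].
  apply: (@le_trans _ _ (C1%:E * Sseq (w \o en R) (fseq f) n)%E); last first.
    by rewrite lee_wpmul2r// lee_fin lerDl ltW.
  rewrite lee_wpmul2l ?lee_fin ?(ltW C10)//; apply: nseq_Lq_oo_le => k.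
  rewrite mule_ge0 ?lee_fin ?coarse_en_ge0//= /X; case: ifP => [|_]; last by rewrite mule0.
  exact: (@Sseq_ge (w \o en R)).
apply: (@le_trans _ _ (nseq (Lq +oo%E) (fun k => (w (en R k))%:E * X n k))%E).
  apply: Sseq_le => k nk; apply: le_trans (nseq_Lq_oo_ge k _); first by rewrite /X nk.
  by move=> j; rewrite mule_ge0 ?lee_fin ?coarse_en_ge0.
apply: le_trans (h2 `]0, t[%classic (fstar f) (X n) (X0 n) _) _; last first.
  rewrite lee_wpmul2r ?lee_fin ?lerDr ?(ltW C10)//.
  by rewrite /tilde /Lq Lnorm_ge0.
move=> k s; rewrite /X; case: ifP => [nk _ bs|_]; last by rewrite ltxx.
split; last by rewrite mul1e; apply: fstar_block_ge bs; rewrite -ltn_subLR ?subnn.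
rewrite /= in_itv/= (block_gt0 bs); apply: lt_block bt bs; lia.
Qed.

(** In the lower bound entry k <= n is realized on block k+1, which lies to the right of t as soon
    as t is in block n+2. *)
Lemma tilde_Lq_1_Tseq w : coarse w -> exists2 C : R, 0 < C & forall f,
  (forall n t, block n t ->
    (tilde (Lq 1%E) `]t, 1%R[ (fun s => (w s)%:E * fstar f s) <=
     C%:E * Tseq (w \o en R) (fseq f) n)%E) /\
  (forall n t, block n.+2 t ->
    (Tseq (w \o en R) (fseq f) n <=
     C%:E * tilde (Lq 1%E) `]t, 1%R[ (fun s => (w s)%:E * fstar f s))%E).
Proof.
move=> cw.
have [C1 C10 h1] := tilde_le_seq (@Lq_1_monotone R) (@Lq_1_homogeneous R) cw ltr01.
have [C2 C20 h2] := tilde_ge_seq 0 (@Lq_1_monotone R) (@Lq_1_homogeneous R) cw ltr01.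
exists (C1 + C2) => [|f]; first exact: addr_gt0.
pose X n k := if (k < n.+1)%N then fseq f k else 0%E.
have X0 n k : (0 <= X n k)%E by rewrite /X; case: ifP => // _; exact: fseq_ge0.
have wX0 n k : (0 <= (w (en R k))%:E * X n k)%E by rewrite mule_ge0 ?lee_fin ?coarse_en_ge0.
have sumX n : (nseq (Lq 1%E) (fun k => (w (en R k))%:E * X n k) = Tseq (w \o en R) (fseq f) n)%E.
  rewrite nseq_Lq_1// (@nneseries_split _ _ 0 n.+1)// add0n eseries0 ?adde0; last first.
    by move=> k nk _; rewrite /X ltnNge nk mule0.
  by rewrite big_mkord; apply: eq_bigr => -[k kn] _; rewrite /X /= kn.
split=> n t bt.
  apply: le_trans (h1 _ _ (X n) (X0 n) _ _) _.
  - move=> s /=; rewrite in_itv/= => /andP[ts s1].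
    by rewrite (ltW s1) (lt_trans _ ts)//; exact: block_gt0 bt.
  - move=> k s /=; rewrite in_itv/= => /andP[ts s1] bs; rewrite fstar_ge0 mul1e /X.
    rewrite ifT; first exact: fstar_block_le.
    by rewrite ltnNge; apply/negP => kn; have := lt_block kn bt bs; rewrite ltNge ltW.
  rewrite sumX lee_wpmul2r ?lee_fin ?lerDl ?(ltW C20)//.
  by apply: Tseq_ge0 => k; [exact: coarse_en_ge0|exact: fseq_ge0].
rewrite -sumX; apply: le_trans (h2 `]t, 1[%classic (fstar f) (X n) (X0 n) _) _; last first.
  rewrite lee_wpmul2r ?lee_fin ?lerDr ?(ltW C10)//.
  by rewrite /tilde /Lq Lnorm_ge0.
move=> k s; rewrite /X; case: ifP => [kn _ bs|_]; last by rewrite ltxx.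
split; last by rewrite mul1e; apply: fstar_block_ge bs; rewrite addn1.
rewrite /= in_itv/=; apply/andP; split; first by apply: lt_block bs bt; lia.
by rewrite addn1 in bs; exact: block_lt1 bs.
Qed.

Lemma integral_step c : (forall n, 0 <= c n)%E ->
  (\int[mu]_(t in `]0%R, 1%R]) c (idx t) =
   \sum_(n <oo) c n * (en R n - en R n.+1)%:E)%E.
Proof.
move=> c0; rewrite -bigcup_block ge0_integral_bigcup//.
- apply: eq_eseriesr => n _.
  transitivity (\int[mu]_(t in block n) (cst (c n) t))%E.
    by apply: eq_integral => t; rewrite inE => /blockE[_ ->].
  rewrite integral_cst; last exact: measurable_block.
  by congr (_ * _)%E; exact: lebesgue_block.
- by move=> n; exact: measurable_block.
- apply/measurable_fun_bigcup => n; first exact: measurable_block.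
  apply: (@eq_measurable_fun _ _ _ _ _ (fun=> c n)); last exact: measurable_cst.
  by move=> t; rewrite inE => /blockE[_ ->].
- exact: trivIset_block.
Qed.

Lemma le_integral_patch (A B : set R) (g h : R -> \bar R) :
  (forall x, A x -> 0 <= g x)%E -> (forall x, B x -> 0 <= h x)%E ->
  (forall x, A x -> (0 < g x)%E -> B x /\ (g x <= h x)%E) ->
  (\int[mu]_(x in A) g x <= \int[mu]_(x in B) h x)%E.
Proof.
move=> g0 h0 gh; rewrite integral_mkcond [leRHS]integral_mkcond.
apply: le_nonneg_integral => x _; rewrite !patchE.
have Bh : (0 <= if x \in B then h x else point)%E.
  by case: ifPn => //; rewrite inE; exact: h0.
case: ifPn => [|_]; last by rewrite lexx.
rewrite inE => Ax; rewrite g0//=; have := g0 _ Ax; rewrite le_eqVlt => /orP[/eqP <-//|].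
by move=> /(gh _ Ax)[Bx]; rewrite mem_set.
Qed.

Lemma fstar2_ge f t : 0 < t -> (fstar f t <= fstar2 f t)%E.
Proof.
move=> t0; rewrite /fstar2.
have : (\int[mu]_(s in `]0%R, t[) (cst (fstar f t) s) <= \int[mu]_(s in `]0%R, t[) fstar f s)%E.
  apply: le_nonneg_integral => s /=; rewrite in_itv/= => /andP[s0 st].
  by rewrite fstar_ge0 fstar_antitone// ltW.
have e : mu `]0%R, t[%classic = t%:E.
  by rewrite lebesgue_measure_itv/= lte_fin t0 oppr0 adde0.
rewrite integral_cst// [X in (_ * X <= _)%E -> _]e => h.
apply: (@le_trans _ _ ((t^-1)%:E * (fstar f t * t%:E))%E); last first.
  by rewrite lee_wpmul2l// lee_fin invr_ge0 ltW.
by rewrite muleCA -EFinM mulVf ?mule1// gt_eqF.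
Qed.

Lemma fstar2_ge0 f t : 0 < t -> (0 <= fstar2 f t)%E.
Proof. by move=> t0; apply: le_trans (fstar2_ge f t0); exact: fstar_ge0. Qed.

(** Up to constants, e^n times the integral over (0, e^-n) of the step function with value a_k on
    block k: the discrete form of the average [fstar2]. *)
Definition Aseq a n : \bar R := (\sum_(i <oo) (en R i)%:E * a (n + i)%N)%E.

Lemma fstar2_block_le f n t : block n t -> (fstar2 f t <= (expR 1)%:E * Aseq (fseq f) n)%E.
Proof.
move=> bt; have t0 := block_gt0 bt.
pose c k := if (n <= k)%N then fseq f k else 0%E.
have c0 k : (0 <= c k)%E by rewrite /c; case: ifP => // _; exact: fseq_ge0.
have h : (\int[mu]_(s in `]0%R, t[) fstar f s <= \sum_(k <oo) c k * (en R k)%:E)%E.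
  apply: (@le_trans _ _ (\int[mu]_(s in `]0%R, 1%R]) c (idx s))%E).
    apply: le_integral_patch => // [s _|s /=]; first exact: fstar_ge0.
    rewrite !in_itv/= => /andP[s0 st] _.
    have s01 : 0 < s <= 1 by rewrite s0 (ltW (lt_le_trans st (block_le1 bt))).
    split => //; have bs := idx_block s01; rewrite /c ifT; first exact: fstar_block_le.
    by rewrite leqNgt; apply/negP => kn; have := lt_block kn bs bt; rewrite ltNge ltW.
  rewrite integral_step//; apply: lee_nneseries => k _ //.
    by rewrite mule_ge0// lee_fin subr_ge0 le_en.
  by rewrite lee_wpmul2l// lee_fin gerBl expR_ge0.
have e : (\sum_(k <oo) c k * (en R k)%:E = (en R n)%:E * Aseq (fseq f) n)%E.
  rewrite (@nneseries_split _ _ 0 n)//; last by move=> k _; rewrite mule_ge0// lee_fin expR_ge0.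
  rewrite add0n big1_seq ?add0e; last first.
    by move=> k /andP[_]; rewrite mem_index_iota /c => /andP[_ kn]; rewrite leqNgt kn/= mul0e.
  rewrite -nneseries_addn; last by move=> k; rewrite mule_ge0// lee_fin expR_ge0.
  rewrite -nneseriesZl; last by move=> k _; rewrite mule_ge0 ?fseq_ge0// lee_fin expR_ge0.
  apply: eq_eseriesr => k _; rewrite /c leq_addl (addnC k n) muleC muleA -EFinM.
  by rewrite /en natrD opprD expRD.
rewrite /fstar2; apply: (@le_trans _ _ ((t^-1)%:E * ((en R n)%:E * Aseq (fseq f) n))%E).
  by apply: lee_wpmul2l; [rewrite lee_fin invr_ge0 ltW|rewrite -e].
have A0 : (0 <= Aseq (fseq f) n)%E.
  by apply: nneseries_ge0 => k _ _; rewrite mule_ge0 ?fseq_ge0// lee_fin expR_ge0.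
rewrite muleA -EFinM lee_wpmul2r// lee_fin mulrC ler_pdivrMr//.
(* On block n, t exceeds e^-(n+1), so dividing by t instead of e^-n costs at most the factor e. *)
apply: (@le_trans _ _ (expR 1 * en R n.+1)); last by rewrite ler_wpM2l ?expR_ge0// ltW// block_lt.
by rewrite /en -expRD ler_expR -natr1; lra.
Qed.

End InnerFunctionals.

(** * Hardy's inequality: removal of the averages *)

Section Hardy.
Variable R : realType.
Notation mu := (@lebesgue_measure R).
Implicit Types (w : R -> R) (a c : nat -> \bar R) (g kappa q p : R).
Implicit Types (t s : R) (n m k i j : nat) (f : R -> R).

Lemma powR_le_expR g kappa : 0 <= g -> 0 < kappa ->
  exists2 C : R, 0 < C & forall x : R, 0 <= x -> (1 + x) `^ g <= C * expR (kappa * x).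
Proof.
move=> g0 k0; have g1 : 0 < g + 1 by lra.
(* 1 + x is bounded by a multiple of e^(k' x); the power g then gives the exponent g k' <= kappa.
   Dividing by g + 1 avoids the case g = 0. *)
pose k' := kappa / (g + 1); have k'0 : 0 < k' by exact: divr_gt0.
pose m := Num.min 1 k'; have m0 : 0 < m by rewrite lt_min ltr01.
have mi0 : 0 < m^-1 by rewrite invr_gt0.
exists (m^-1 `^ g) => [|x x0]; first exact: powR_gt0.
have h : 1 + x <= m^-1 * expR (k' * x).
  rewrite mulrC ler_pdivlMr//; apply: le_trans (expR_ge1Dx _).
  have m1 : m <= 1 by rewrite ge_min lexx.
  have mk : m <= k' by rewrite ge_min lexx orbT.
  nra.
have x10 : 0 <= 1 + x by lra.
apply: (le_trans (ge0_ler_powR g0 _ _ h)); rewrite ?nnegrE//.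
  by rewrite mulr_ge0 ?expR_ge0 ?(ltW mi0).
rewrite powRM ?expR_ge0 ?(ltW mi0)// ler_wpM2l ?powR_ge0//.
rewrite -expRM ler_expR mulrAC ler_wpM2r// /k' mulrAC ler_pdivrMr//.
nra.
Qed.

Lemma en_powR n q : en R n `^ q = expR (- (n%:R * q)).
Proof. by rewrite /en -expRM mulNr. Qed.

(** Since n + i + 1 <= (n + 1)(1 + i), a power of ell changes at most polynomially in the shift
    i. *)
Lemma ell_powR_shift g n i : g <= 0 ->
  ell (en R n) `^ g <= (1 + i%:R) `^ (- g) * ell (en R (n + i)) `^ g.
Proof.
move=> g0; have i1 : 0 < 1 + i%:R :> R by rewrite ltr_pwDl.
rewrite !ell_en /powR !gt_eqF ?ltr0n// -expRD ler_expR.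
have : ln (n + i).+1%:R <= ln (1 + i%:R) + ln n.+1%:R :> R.
  have n1 : 0 < n.+1%:R :> R by rewrite ltr0n.
  rewrite -lnM ?posrE// ler_ln ?posrE ?ltr0n ?mulr_gt0//.
  rewrite -!natr1 natrD; have := ler0n R n; have := ler0n R i; nra.
nra.
Qed.

(* As q < 1, a geometric factor is left to absorb the averaging in f**. *)
Lemma weight_geometric q g : q < 1 -> g <= 0 -> exists2 C : R, 0 < C &
  forall n i, en R n `^ q * ell (en R n) `^ g * en R i <=
    C * (expR (- ((1 - q) / 2)) ^+ i * (en R (n + i) `^ q * ell (en R (n + i)) `^ g)).
Proof.
move=> q1 g0; have k0 : 0 < (1 - q) / 2 by lra.
have ng0 : 0 <= - g by rewrite oppr_ge0.
have [C C0 hC] := powR_le_expR ng0 k0.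
exists C => // n i; have h1 := ell_powR_shift n i g0; have h2 := hC _ (ler0n R i).
have e0 : 0 <= ell (en R (n + i)) `^ g by exact: powR_ge0.
apply: (@le_trans _ _ (en R n `^ q * (C * expR ((1 - q) / 2 * i%:R) * ell (en R (n + i)) `^ g) * en R i)).
  rewrite ler_wpM2r ?expR_ge0// ler_wpM2l ?powR_ge0//; apply: (le_trans h1).
  by rewrite ler_wpM2r.
rewrite le_eqVlt; apply/orP; left; apply/eqP.
rewrite !en_powR /en -expRM_natr.
transitivity (C * ell (en R (n + i)) `^ g * (expR (- (n%:R * q)) * expR ((1 - q) / 2 * i%:R) * expR (- i%:R))).
  by rewrite /en; ring.
transitivity (C * ell (en R (n + i)) `^ g * (expR (- ((1 - q) / 2) * i%:R) * expR (- ((n + i)%:R * q)))); last first.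
  by rewrite /en; ring.
congr (_ * _); rewrite -!expRD; congr expR; rewrite natrD; by field.
Qed.

Lemma lee_geometric_sum (r : R) (x : nat -> \bar R) (M : \bar R) : 0 <= r < 1 ->
  (0 <= M)%E -> (forall i, 0 <= x i)%E -> (forall i, x i <= (r ^+ i)%:E * M)%E ->
  (\sum_(i <oo) x i <= ((1 - r)^-1)%:E * M)%E.
Proof.
move=> r01 M0 x0 xM; apply: (@le_trans _ _ (\sum_(i <oo) (r ^+ i)%:E * M)%E).
  exact: lee_nneseries.
have r0 i : (0 <= (r ^+ i)%:E)%E by rewrite lee_fin exprn_ge0//; case/andP: r01.
apply: lime_le; first by apply: is_cvg_nneseries => i _ _; exact: mule_ge0.
apply: nearW => n; rewrite -ge0_sume_distrl//; apply: lee_wpmul2r => //.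
apply: le_trans (geometric_series_le r01).
exact: nneseries_lim_ge.
Qed.

(** On block j the weighted average is w(e^-j) times the sum of e^-i a_(j+i), up to constants.
    [weight_geometric] moves the weight onto each a_(j+i) with a factor r^i, so the average is at
    most a convergent sum of r^i S_n. *)
Lemma Bsp_inner p g : 1 < p -> g <= 0 ->
  let w := fun s : R => s `^ p^-1 * ell s `^ g in
  let h := fun f t => ereal_sup [set ((w s)%:E * fstar2 f s)%E | s in `]0%R, t[] in
  exists2 C : R, 0 < C & forall f,
    (forall n t, block n t -> (h f t <= C%:E * Sseq (w \o en R) (fseq f) n)%E) /\
    (forall n t, block n.+1 t -> (Sseq (w \o en R) (fseq f) n <= C%:E * h f t)%E).
Proof.
move=> p1 g0 w h; have p0 : 0 < p by lra.
have q1 : p^-1 < 1 by rewrite invf_lt1.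
have cw : coarse w by apply: coarseM; apply: coarse_powR; [exact: coarse_id|exact: coarse_ell].
have [C C0 hC] := weight_geometric q1 g0.
have [K K0 hK] := coarse_block 2 cw.
set r := expR _ in hC.
have r01 : 0 <= r < 1.
  by rewrite expR_ge0/= -expR0 ltr_expR; lra.
have ri0 : 0 < (1 - r)^-1 by rewrite invr_gt0; lra.
have e0 : 0 < expR 1 :> R := expR_gt0 _.
pose D := K * expR 1 * C * (1 - r)^-1.
have D0 : 0 < D by rewrite !mulr_gt0.
exists (D + K) => [|f]; first exact: addr_gt0.
have S0 n : (0 <= Sseq (w \o en R) (fseq f) n)%E.
  by apply: Sseq_ge0 => k; [exact: coarse_en_ge0|exact: fseq_ge0].
split=> n t bt.
  apply: ge_ereal_sup => _ [s /= sI <-]; move: sI; rewrite in_itv/= => /andP[s0 st].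
  have s01 : 0 < s <= 1 by rewrite s0 (ltW (lt_le_trans st (block_le1 bt))).
  have bs := idx_block s01; set j := idx s in bs.
  have nj : (n <= j)%N by rewrite leqNgt; apply/negP => /lt_block/(_ bs bt); rewrite ltNge ltW.
  have wj0 : 0 <= w (en R j) := coarse_en_ge0 _ cw.
  have A0 : (0 <= Aseq (fseq f) j)%E.
    by apply: nneseries_ge0 => k _ _; rewrite mule_ge0 ?fseq_ge0// lee_fin expR_ge0.
  have ws0 : 0 <= w s by rewrite ltW// cw.1.
  have key : ((w (en R j))%:E * Aseq (fseq f) j <= (C * (1 - r)^-1)%:E * Sseq (w \o en R) (fseq f) n)%E.
    rewrite /Aseq -nneseriesZl; last by move=> k _; rewrite mule_ge0 ?fseq_ge0// lee_fin expR_ge0.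
    rewrite [(C * _)%:E]EFinM (muleC C%:E) -muleA; apply: lee_geometric_sum => // [|i|i].
    - by rewrite mule_ge0// lee_fin ltW.
    - by rewrite !mule_ge0 ?fseq_ge0 ?lee_fin ?expR_ge0.
    rewrite muleA -EFinM; apply: (@le_trans _ _ ((C * (r ^+ i * w (en R (j + i))))%:E * fseq f (j + i))%E).
      by rewrite lee_wpmul2r ?fseq_ge0// lee_fin; exact: hC.
    rewrite mulrCA EFinM -muleA; apply: lee_wpmul2l.
      by rewrite lee_fin exprn_ge0//; case/andP: r01.
    rewrite EFinM -muleA; apply: lee_wpmul2l; first by rewrite lee_fin ltW.
    by apply: (@Sseq_ge _ (w \o en R)); rewrite (leq_trans nj)// leq_addr.
  apply: (@le_trans _ _ ((K * w (en R j))%:E * ((expR 1)%:E * Aseq (fseq f) j))%E).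
    apply: lee_pmul; rewrite ?lee_fin//; [exact: fstar2_ge0| |exact: fstar2_block_le].
    by have [] := hK _ _ _ _ (leqnn _) (leq_addr _ _) bs (en_block R j).
  apply: (@le_trans _ _ ((K * expR 1)%:E * ((w (en R j))%:E * Aseq (fseq f) j))%E).
    by rewrite !muleA -!EFinM mulrAC.
  apply: (@le_trans _ _ (D%:E * Sseq (w \o en R) (fseq f) n)%E).
    have -> : D%:E = ((K * expR 1)%:E * (C * (1 - r)^-1)%:E)%E by rewrite -EFinM /D mulrA.
    by rewrite -muleA; apply: lee_wpmul2l => //; rewrite lee_fin mulr_ge0// ltW.
  by rewrite lee_wpmul2r// lee_fin lerDl ltW.
(* The point e^-(k+2) lies in (0, t) for k >= n and t in block n+1, and f^* is at least a_k
   there. *)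
apply: Sseq_le => k nk; have bk := en_block R k.+2.
have kk2 : (k.+2 <= k + 2)%N by rewrite addn2.
have nk2 : (n.+1 < k.+2)%N by [].
have h0 : ((w (en R k.+2))%:E * fstar2 f (en R k.+2) <= h f t)%E.
  apply: ereal_sup_ubound; exists (en R k.+2) => //.
  by rewrite /= in_itv/= en_gt0; exact: (lt_block nk2 bt bk).
apply: (@le_trans _ _ (K%:E * ((w (en R k.+2))%:E * fstar2 f (en R k.+2)))%E).
  rewrite muleA -EFinM; apply: lee_pmul; rewrite ?lee_fin ?coarse_en_ge0 ?fseq_ge0//.
    exact: (hK k k.+2 _ _ (leqW (leqnSn k)) kk2 (en_block R k) bk).1.
  apply: le_trans (fstar2_ge _ (en_gt0 _ _)); exact: (fstar_block_ge _ _ bk).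
have h00 : (0 <= (w (en R k.+2))%:E * fstar2 f (en R k.+2))%E.
  by rewrite mule_ge0 ?lee_fin ?coarse_en_ge0// fstar2_ge0// en_gt0.
by apply: lee_pmul => //; rewrite lee_fin; lra.
Qed.

Lemma Tseq_shift_le (v : nat -> R) a n i : (forall k, 0 <= v k) -> (forall k, 0 <= a k)%E ->
  (\sum_(j < n.+1) (v (j + i)%N)%:E * a (j + i)%N <= Tseq v a (n + i))%E.
Proof.
move=> v0 a0; rewrite /Tseq -(big_mkord predT (fun k => (v k)%:E * a k)%E).
rewrite -(big_mkord predT (fun j => (v (j + i)%N)%:E * a (j + i)%N)%E).
rewrite (@big_cat_nat _ _ _ i 0 (n + i).+1)//=; last by lia.
rewrite [X in (_ <= _ + X)%E](_ : _ = \sum_(0 <= j < n.+1) (v (j + i)%N)%:E * a (j + i)%N)%E.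
  by rewrite leeDr// sume_ge0// => k _; rewrite mule_ge0 ?lee_fin.
by rewrite -[in LHS](add0n i) big_addn; congr bigop; rewrite /index_iota; congr iota; lia.
Qed.

(** The average at s > t also sees f^* on (0, t), so T_n alone cannot bound the integral. A value
    a_(j+i) entering through block j carries e^(-j/p) e^-i, that is e^(-(j+i)/p) r^i with r =
    e^-(1-1/p); hence the geometrically weighted sum of the T_(n+i). *)
Lemma Asp_inner p : 1 < p ->
  let w := fun s : R => s `^ p^-1 * 1 in
  let h := fun f t => (\int[mu]_(s in `]t, 1%R[)
      ((s `^ p^-1)%:E * fstar2 f s * (s^-1)%:E))%E in
  exists2 C : R, 0 < C & forall f,
    (forall n t, block n t -> (h f t <= C%:E *
      \sum_(i <oo) (expR (- (1 - p^-1)) ^+ i)%:E * Tseq (w \o en R) (fseq f) (n + i))%E) /\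
    (forall n t, block n.+2 t -> (Tseq (w \o en R) (fseq f) n <= C%:E * h f t)%E).
Proof.
move=> p1 w h; have p0 : 0 < p by lra.
set q := p^-1 in w h *; have q1 : q < 1 by rewrite invf_lt1.
have q0 : 0 < q by rewrite invr_gt0.
have cw : coarse w by apply: coarseM; [apply: coarse_powR; exact: coarse_id|exact: coarse_cst].
have w0 k : 0 <= (w \o en R) k by exact: coarse_en_ge0.
have [K K0 hK] := coarse_block 1 cw.
set r := expR _.
have e0 : 0 < expR 1 :> R := expR_gt0 _.
have h0 f s : 0 < s -> (0 <= (s `^ q)%:E * fstar2 f s * (s^-1)%:E)%E.
  move=> s0; apply: mule_ge0; last by rewrite lee_fin invr_ge0 ltW.
  by apply: mule_ge0; [rewrite lee_fin powR_ge0|exact: fstar2_ge0].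
have dl : 0 < 1 - (expR 1)^-1 :> R by rewrite subr_gt0 invf_lt1// -[ltLHS]expR0 ltr_expR.
have leng n : en R n - en R n.+1 = (1 - (expR 1)^-1) * en R n.
  by rewrite /en -natr1 opprD expRD [expR (- 1)]expRN; ring.
pose D := K * (1 - (expR 1)^-1)^-1; have D0 : 0 < D by rewrite mulr_gt0 ?invr_gt0.
exists (expR 1 ^+ 2 + D) => [|f]; first by rewrite addr_gt0 ?exprn_gt0.
split=> n t bt; last first.
  (* Block k carries the value a_(k-1), which f^* dominates there. The normalization makes the
     integral of [c] exactly T_n / D; here D absorbs the factor 1 - 1/e from the length of a block
     and the change K of the weight over one block. *)
  pose c k : \bar R := if (0 < k <= n.+1)%N
    then (((D^-1 * (1 - (expR 1)^-1)^-1) * (w (en R k.-1) * (en R k)^-1))%:E * fseq f k.-1)%E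
    else 0%E.
  have cc0 k : 0 <= (D^-1 * (1 - (expR 1)^-1)^-1) * (w (en R k.-1) * (en R k)^-1).
    apply: mulr_ge0; first by apply: mulr_ge0; rewrite invr_ge0 ltW.
    by apply: mulr_ge0; [exact: w0|rewrite invr_ge0 expR_ge0].
  have c0 k : (0 <= c k)%E.
    by rewrite /c; case: ifP => // _; apply: mule_ge0; [rewrite lee_fin|exact: fseq_ge0].
  have Ec : (\int[mu]_(s in `]0%R, 1%R]) c (idx s) = (D^-1)%:E * Tseq (w \o en R) (fseq f) n)%E.
    rewrite integral_step// (@nneseries_split _ _ 0 n.+2)//; last first.
      by move=> k _; rewrite mule_ge0// lee_fin subr_ge0 le_en.
    rewrite add0n eseries0 ?adde0; last first.
      move=> k nk _; rewrite /c ifF ?mul0e//; apply/negP => /andP[_]; lia.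
    rewrite big_nat_recl//= /c/= mul0e add0e /Tseq ge0_sume_distrr; last first.
      by move=> k _; rewrite mule_ge0 ?fseq_ge0 ?lee_fin.
    rewrite big_mkord; apply: eq_bigr => -[k kn] _ /=; rewrite ltnS -ltnS kn leng.
    rewrite muleAC -EFinM muleA -EFinM; congr (_%:E * _)%E.
    have ek := en_gt0 R k.+1; rewrite /w/=; field.
    by rewrite !gt_eqF.
  have le1 : (\int[mu]_(s in `]0%R, 1%R]) c (idx s) <= h f t)%E.
    apply: le_integral_patch => [s _|s /=|s /=]; first exact: c0.
      rewrite in_itv/= => /andP[ts _]; apply: h0; apply: lt_trans ts.
      exact: block_gt0 bt.
    rewrite in_itv/= => s01; have bs := idx_block s01; set k := idx s in bs *.
    rewrite /c; case: ifP => [/andP[k0 kn] _|_]; last by rewrite ltxx.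
    case: k bs k0 kn => [//|k] bs _ kn; have s0 := block_gt0 bs.
    split; first by rewrite /= in_itv/= (block_lt1 bs) andbT; apply: lt_block bs bt.
    have k1 : (k.+1 <= k + 1)%N by rewrite addn1.
    have wk := (hK k k.+1 _ _ (leqnSn k) k1 (en_block R k) bs).1.
    rewrite muleAC -EFinM; apply: lee_pmul.
    - by rewrite lee_fin; exact: (cc0 k.+1).
    - exact: fseq_ge0.
    - rewrite lee_fin /=; have ->: D^-1 * (1 - (expR 1)^-1)^-1 = K^-1.
        by rewrite /D; field; rewrite !gt_eqF.
      rewrite mulrA; apply: ler_pM; rewrite ?invr_ge0 ?expR_ge0//.
      + by apply: mulr_ge0; [rewrite invr_ge0 ltW|exact: w0].
      + by rewrite ler_pdivrMl//; move: wk; rewrite /w !mulr1.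
      + by rewrite lef_pV2 ?posrE ?en_gt0//; exact: block_le bs.
    - apply: le_trans (fstar2_ge _ s0); exact: (fstar_block_ge _ _ bs).
  rewrite Ec in le1.
  apply: (@le_trans _ _ (D%:E * h f t)%E); last first.
    rewrite lee_wpmul2r// ?lee_fin ?lerDr ?exprn_ge0 ?expR_ge0//.
    apply: integral_ge0 => s /=; rewrite in_itv/= => /andP[ts _]; apply: h0.
    by apply: lt_trans ts; exact: block_gt0 bt.
  apply: (@le_trans _ _ (D%:E * ((D^-1)%:E * Tseq (w \o en R) (fseq f) n))%E).
    by rewrite muleA -EFinM divff ?mul1e// gt_eqF.
  by apply: lee_wpmul2l => //; rewrite lee_fin ltW.
have A0 j : (0 <= Aseq (fseq f) j)%E.
  by apply: nneseries_ge0 => k _ _; rewrite mule_ge0 ?fseq_ge0// lee_fin expR_ge0.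
(* Bound of the integrand on block k: s^q <= e^(-kq), 1/s <= e^(k+1), and the average is at most e
   times [Aseq]. *)
pose c k : \bar R := if (k < n.+1)%N
  then ((en R k `^ q * expR 1 * (en R k.+1)^-1)%:E * Aseq (fseq f) k)%E else 0%E.
have c0 k : (0 <= c k)%E.
  rewrite /c; case: ifP => // _; rewrite mule_ge0// lee_fin.
  by rewrite !mulr_ge0 ?powR_ge0 ?expR_ge0// invr_ge0 expR_ge0.
have T0 k : (0 <= Tseq (w \o en R) (fseq f) k)%E by apply: Tseq_ge0 => // j; exact: fseq_ge0.
have r0 k : 0 <= r ^+ k by rewrite exprn_ge0 ?expR_ge0.
have rT0 : (0 <= \sum_(i <oo) (r ^+ i)%:E * Tseq (w \o en R) (fseq f) (n + i))%E.
  by apply: nneseries_ge0 => k _ _; rewrite mule_ge0 ?lee_fin.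
apply: (@le_trans _ _ ((expR 1 ^+ 2)%:E * \sum_(i <oo) (r ^+ i)%:E * Tseq (w \o en R) (fseq f) (n + i))%E); last first.
  by rewrite lee_wpmul2r// lee_fin lerDl ltW.
apply: (@le_trans _ _ (\int[mu]_(s in `]0%R, 1%R]) c (idx s))%E).
  apply: le_integral_patch => [s /=|s _|s /=]; last 2 first.
  - exact: c0.
  - rewrite in_itv/= => /andP[ts s1] _.
    have s0 : 0 < s by apply: lt_trans ts; exact: block_gt0 bt.
    have s01 : 0 < s <= 1 by rewrite s0 ltW.
    rewrite /= in_itv/=; split => //; have bs := idx_block s01; set k := idx s in bs *.
    rewrite /c ifT; last first.
      by rewrite ltnNge; apply/negP => kn; have := lt_block kn bt bs; rewrite ltNge ltW.
    rewrite muleAC -EFinM [X in (_ <= X%:E * _)%E](_ : _ = en R k `^ q * (en R k.+1)^-1 * expR 1); last by ring.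
    rewrite [(_ * expR 1)%:E]EFinM -muleA; apply: lee_pmul; rewrite ?lee_fin ?fstar2_ge0 ?fstar2_block_le//.
      by rewrite mulr_ge0 ?powR_ge0 ?invr_ge0 ?ltW.
    apply: ler_pM; rewrite ?powR_ge0 ?invr_ge0 ?(ltW s0)//.
      by apply: ge0_ler_powR; rewrite ?nnegrE ?(ltW q0) ?(ltW s0) ?expR_ge0//; exact: block_le bs.
    by rewrite lef_pV2 ?posrE ?en_gt0//; exact/ltW/(block_lt bs).
  rewrite in_itv/= => /andP[ts _]; apply: h0; apply: lt_trans ts.
  exact: block_gt0 bt.
rewrite integral_step// (@nneseries_split _ _ 0 n.+1)//; last first.
  by move=> k _; rewrite mule_ge0// lee_fin subr_ge0 le_en.
rewrite add0n eseries0 ?adde0; last first.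
  by move=> k nk _; rewrite /c ltnNge nk mul0e.
rewrite big_mkord.
have aux (j i : nat) : (0 <= (en R j `^ q * en R i)%:E * fseq f (j + i))%E.
  by rewrite mule_ge0 ?fseq_ge0// lee_fin mulr_ge0 ?powR_ge0 ?expR_ge0.
apply: (@le_trans _ _ (\sum_(j < n.+1) (expR 1 ^+ 2)%:E *
    \sum_(i <oo) (en R j `^ q * en R i)%:E * fseq f (j + i))%E).
  apply: lee_sum => -[j jn] _ /=; rewrite /c jn.
  rewrite muleAC -EFinM.
  apply: (@le_trans _ _ ((expR 1 ^+ 2)%:E * ((en R j `^ q)%:E * Aseq (fseq f) j))%E).
    rewrite muleA -EFinM lee_wpmul2r// lee_fin.
    apply: (@le_trans _ _ (en R j `^ q * expR 1 * (en R j.+1)^-1 * en R j)).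
      rewrite ler_wpM2l ?gerBl ?expR_ge0//.
      by rewrite !mulr_ge0 ?powR_ge0 ?expR_ge0// invr_ge0 expR_ge0.
    rewrite le_eqVlt; apply/orP; left; apply/eqP; rewrite -mulrA.
    have -> : (en R j.+1)^-1 * en R j = expR 1.
      by rewrite /en -expRN -expRD; congr expR; rewrite -natr1; ring.
    by rewrite /en; ring.
  apply: lee_wpmul2l; first by rewrite lee_fin exprn_ge0 ?expR_ge0.
  rewrite -nneseriesZl; last by move=> k _; rewrite mule_ge0 ?fseq_ge0// lee_fin expR_ge0.
  apply: lee_nneseries => k _; first by move=> _; rewrite !mule_ge0 ?fseq_ge0 ?lee_fin ?powR_ge0 ?expR_ge0.
  by rewrite muleA -EFinM.
rewrite -ge0_sume_distrr; last by move=> j _; exact: nneseries_ge0.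
apply: lee_wpmul2l; first by rewrite lee_fin exprn_ge0 ?expR_ge0.
(* After the exchange i is the offset inside the average; for fixed i the sum over j is a piece of
   T_(n+i). *)
rewrite -nneseries_sum; last by move=> i j _; exact: aux.
apply: lee_nneseries => i _; first by move=> _; apply: sume_ge0 => j _; exact: aux.
apply: (@le_trans _ _ ((r ^+ i)%:E * \sum_(j < n.+1) ((w \o en R) (j + i)%N)%:E * fseq f (j + i))%E).
  rewrite ge0_sume_distrr; last by move=> j _; rewrite mule_ge0 ?fseq_ge0 ?lee_fin.
  apply: lee_sum => j _; rewrite muleA -EFinM lee_wpmul2r ?fseq_ge0// lee_fin.
  rewrite /= /w mulr1 !en_powR /r /en -expRM_natr -!expRD ler_expR natrD.
  by rewrite le_eqVlt; apply/orP; left; apply/eqP; ring.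
apply: lee_wpmul2l; first by rewrite lee_fin.
by apply: Tseq_shift_le => // k; exact: fseq_ge0.
Qed.

End Hardy.

(** * Discrete forms of the function norms *)

Section Equivalences.
Variable R : realType.
Notation mu := (@lebesgue_measure R).
Implicit Types (w a b c : R -> R) (X : nat -> \bar R) (p : R) (E : ri_space R).
Implicit Types (t s u : R) (n m k i j : nat) (f : R -> R) (h : R -> \bar R).

Definition equivn (N M : (R -> R) -> \bar R) := exists2 C : R, 0 < C &
  forall f, (N f <= C%:E * M f)%E /\ (M f <= C%:E * N f)%E.

Lemma lee_const_trans (C D : R) (x y z : \bar R) : 0 <= C ->
  (x <= C%:E * y -> y <= D%:E * z -> x <= (C * D)%:E * z)%E.
Proof.
move=> C0 xy yz; apply: (le_trans xy); rewrite EFinM -muleA.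
by apply: lee_wpmul2l.
Qed.

Lemma tilde_equiv E w (C : R) m : coarse w -> 0 < C -> exists2 C' : R, 0 < C' & forall h X,
  (forall n, 0 <= X n)%E ->
  (forall n t, block n t -> (0 <= h t <= C%:E * X n)%E) ->
  (forall n t, block (n + m.+1) t -> (X n <= C%:E * h t)%E) ->
  (tilde E `]0%R, 1%R[ (fun t => (w t)%:E * h t) <=
   C'%:E * nseq E (fun n => (w (en R n))%:E * X n))%E /\
  (nseq E (fun n => (w (en R n))%:E * X n) <=
   C'%:E * tilde E `]0%R, 1%R[ (fun t => (w t)%:E * h t))%E.
Proof.
move=> cw C0.
have [C1 C10 h1] := tilde_le_seq (@ri_monotone R E) (@ri_homogeneous R E) cw C0.
have [C2 C20 h2] := tilde_ge_seq m (@ri_monotone R E) (@ri_homogeneous R E) cw C0.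
exists (C1 + C2) => [|h X X0 hl hu]; first exact: addr_gt0.
split.
  apply: le_trans (h1 `]0, 1[%classic _ _ X0 _ _) _.
  - by move=> t /=; rewrite in_itv/= => /andP[-> /ltW].
  - by move=> n t _; exact: hl.
  by rewrite lee_wpmul2r ?nseq_ge0// lee_fin lerDl ltW.
apply: le_trans (h2 `]0, 1[%classic h _ X0 _) _.
  move=> n t _ bt; split; last exact: hu bt.
  by rewrite /= in_itv/= (block_gt0 bt); move: bt; rewrite addnS; exact: block_lt1.
by rewrite lee_wpmul2r ?tilde_ge0// lee_fin lerDr ltW.
Qed.

Lemma coarse_powid p : coarse (fun s : R => s `^ p).
Proof. by apply: coarse_powR; exact: coarse_id. Qed.

Lemma Lsp_equiv p b E : coarse b ->
  equivn (fnorm (Lsp p b E))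
    (fun f => nseq E (fun n => (en R n `^ p^-1 * b (en R n))%:E * fseq f n))%E.
Proof.
move=> cb; have cw : coarse (fun s => s `^ p^-1 * b s) by apply: coarseM cb; exact: coarse_powid.
have [C C0 h] := tilde_equiv E 0 cw ltr01; exists C => // f.
apply: h => [n|n t bt|n t]; first exact: fseq_ge0.
  by rewrite fstar_ge0 mul1e fstar_block_le.
by rewrite mul1e addn1; exact: fstar_block_ge.
Qed.

Definition weight p a (s : R) : R := s `^ p^-1 * a s.

Lemma coarse_weight p a : coarse a -> coarse (weight p a).
Proof. by move=> ca; apply: coarseM ca; exact: coarse_powid. Qed.

Notation Sq p a f := (Sseq (weight p a \o en R) (fseq f)).
Notation Tq p a f := (Tseq (weight p a \o en R) (fseq f)).

Lemma Sq_ge0 p a f n : coarse a -> (0 <= Sq p a f n)%E.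
Proof.
move=> ca; apply: Sseq_ge0 => k; last exact: fseq_ge0.
by apply: coarse_en_ge0; exact: coarse_weight.
Qed.

Lemma Tq_ge0 p a f n : coarse a -> (0 <= Tq p a f n)%E.
Proof.
move=> ca; apply: Tseq_ge0 => k; last exact: fseq_ge0.
by apply: coarse_en_ge0; exact: coarse_weight.
Qed.

Lemma Lnorm_tilde_ge0 (q : \bar R) (I : set R) h : (0 <= tilde (Lq q) I h)%E.
Proof. exact: Lnorm_ge0. Qed.

Lemma LL_equiv p b E a : coarse b -> coarse a ->
  equivn (fnorm (LL p b E a (Lq +oo%E)))
    (fun f => nseq E (fun n => (b (en R n))%:E * Sq p a f n))%E.
Proof.
move=> cb ca; have [C C0 h] := tilde_Lq_oo_Sseq (coarse_weight p ca).
have [C' C'0 h'] := tilde_equiv E 1 cb C0; exists C' => // f.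
have [h1 h2] := h f; apply: h' => [n|n t bt|n t].
- exact: Sq_ge0.
- by rewrite Lnorm_tilde_ge0 h1.
- by rewrite addn2; exact: h2.
Qed.

Lemma LR_equiv p b E a : coarse b -> coarse a ->
  equivn (fnorm (LR p b E a (Lq 1%E)))
    (fun f => nseq E (fun n => (b (en R n))%:E * Tq p a f n))%E.
Proof.
move=> cb ca; have [C C0 h] := tilde_Lq_1_Tseq (coarse_weight p ca).
have [C' C'0 h'] := tilde_equiv E 1 cb C0; exists C' => // f.
have [h1 h2] := h f; apply: h' => [n|n t bt|n t].
- exact: Tq_ge0.
- by rewrite Lnorm_tilde_ge0 h1.
- by rewrite addn2; exact: h2.
Qed.

(** The constants of the inner comparisons do not depend on u, so the outer comparison may treat the
    inner norm as a function of u. In the lower bound entry k is realized on block k+2, inside (0,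
    u) when k >= n and u is in block n+1. *)
Lemma LLL_equiv p c E b F a : coarse c -> coarse b -> coarse a ->
  equivn (fnorm (LLL p c E b (ri_norm F) a (Lq +oo%E)))
    (fun f => nseq E (fun n => (c (en R n))%:E *
       nseq F (fun k => (b (en R k))%:E * (if (n <= k)%N then Sq p a f k else 0))))%E.
Proof.
move=> cc cb ca; have [C C0 h] := tilde_Lq_oo_Sseq (coarse_weight p ca).
have [C1 C10 h1] := tilde_le_seq (@ri_monotone R F) (@ri_homogeneous R F) cb C0.
have [C2 C20 h2] := tilde_ge_seq 1 (@ri_monotone R F) (@ri_homogeneous R F) cb C0.
have C12 : 0 < C1 + C2 by exact: addr_gt0.
have [C' C'0 h'] := tilde_equiv E 0 cc C12; exists C' => // f.
have [hf1 hf2] := h f.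
have X0 n k : (0 <= if (n <= k)%N then Sq p a f k else 0)%E.
  by case: ifP => // _; exact: Sq_ge0.
apply: h' => [n|n u bu|n u bu]; first exact: nseq_ge0.
  rewrite tilde_ge0/=; apply: le_trans (h1 `]0, u[%classic _ _ (X0 n) _ _) _.
  - move=> t /=; rewrite in_itv/= => /andP[-> tu].
    by rewrite (ltW (lt_le_trans tu (block_le1 bu))).
  - move=> k t /=; rewrite in_itv/= => /andP[t0 tu] bt; rewrite Lnorm_tilde_ge0/=.
    rewrite ifT; first exact: hf1.
    by rewrite leqNgt; apply/negP => kn; have := lt_block kn bt bu; rewrite ltNge ltW.
  - by rewrite lee_wpmul2r ?nseq_ge0// lee_fin lerDl ltW.
apply: le_trans (h2 `]0, u[%classic
    (fun t => tilde (Lq +oo%E) `]0%R, t[ (weighted p a f)) _ (X0 n) _) _; last first.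
  by rewrite lee_wpmul2r ?tilde_ge0// lee_fin lerDr ltW.
move=> k t; case: ifP => [nk _ bt|_]; last by rewrite ltxx.
split; last by apply: hf2; rewrite -addn2.
rewrite /= in_itv/= (block_gt0 bt); apply: lt_block bu bt; lia.
Qed.

(** Here the entries k <= n are realized on blocks up to n+2, which lie to the right of u only from
    block n+3 on; hence the larger lag in the outer comparison. *)
Lemma LRR_equiv p c E b F a : coarse c -> coarse b -> coarse a ->
  equivn (fnorm (LRR p c E b (ri_norm F) a (Lq 1%E)))
    (fun f => nseq E (fun n => (c (en R n))%:E *
       nseq F (fun k => (b (en R k))%:E * (if (k <= n)%N then Tq p a f k else 0))))%E.
Proof.
move=> cc cb ca; have [C C0 h] := tilde_Lq_1_Tseq (coarse_weight p ca).
have [C1 C10 h1] := tilde_le_seq (@ri_monotone R F) (@ri_homogeneous R F) cb C0.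
have [C2 C20 h2] := tilde_ge_seq 1 (@ri_monotone R F) (@ri_homogeneous R F) cb C0.
have C12 : 0 < C1 + C2 by exact: addr_gt0.
have [C' C'0 h'] := tilde_equiv E 2 cc C12; exists C' => // f.
have [hf1 hf2] := h f.
have X0 n k : (0 <= if (k <= n)%N then Tq p a f k else 0)%E.
  by case: ifP => // _; exact: Tq_ge0.
apply: h' => [n|n u bu|n u bu]; first exact: nseq_ge0.
  rewrite tilde_ge0/=; apply: le_trans (h1 `]u, 1[%classic _ _ (X0 n) _ _) _.
  - move=> t /=; rewrite in_itv/= => /andP[ut t1].
    by rewrite (ltW t1) (lt_trans (block_gt0 bu) ut).
  - move=> k t /=; rewrite in_itv/= => /andP[ut t1] bt; rewrite Lnorm_tilde_ge0/=.
    rewrite ifT; first exact: hf1.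
    by rewrite leqNgt; apply/negP => kn; have := lt_block kn bu bt; rewrite ltNge ltW.
  - by rewrite lee_wpmul2r ?nseq_ge0// lee_fin lerDl ltW.
apply: le_trans (h2 `]u, 1[%classic
    (fun t => tilde (Lq 1%E) `]t, 1%R[ (weighted p a f)) _ (X0 n) _) _; last first.
  by rewrite lee_wpmul2r ?tilde_ge0// lee_fin lerDr ltW.
move=> k t; case: ifP => [kn _ bt|_]; last by rewrite ltxx.
split; last by apply: hf2; rewrite -addn2.
rewrite /= in_itv/=; apply/andP; split; first by apply: lt_block bt bu; lia.
by move: bt; rewrite addnS; exact: block_lt1.
Qed.

Lemma tilde_mul1 F (I : set R) h : tilde F I (fun t => 1%:E * h t)%E = tilde F I h.
Proof. by congr tilde; apply/funext => t; rewrite mul1e. Qed.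

Lemma nseq_mul1 F X : nseq F (fun n => 1%:E * X n)%E = nseq F X.
Proof. by congr nseq; apply/funext => t; rewrite mul1e. Qed.

Lemma coarse_ell_powR (g : R) : coarse (fun t : R => ell t `^ g).
Proof. by apply: coarse_powR; exact: coarse_ell. Qed.

Lemma Bsp_equiv p (alpha : R) E : 1 < p -> alpha < 1 ->
  equivn (fnorm (Bsp p alpha E))
    (fun f => nseq E (Sq p (fun s => ell s `^ (alpha - 1)) f)).
Proof.
move=> p1 a1; have g0 : alpha - 1 <= 0 by lra.
have [C C0 h] := Bsp_inner p1 g0.
have [C' C'0 h'] := tilde_equiv E 0 (coarse_cst ltr01) C0; exists C' => // f.
have [h1 h2] := h f.
have ca := coarse_ell_powR (alpha - 1).
have := h' _ (Sq p (fun s => ell s `^ (alpha - 1)) f) _ _ _.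
rewrite nseq_mul1 => {}h'.
have := h' (fun t => ereal_sup [set ((s `^ p^-1 * ell s `^ (alpha - 1))%:E * fstar2 f s)%E
              | s in `]0%R, t[]).
rewrite tilde_mul1; apply.
- by move=> n; exact: Sq_ge0.
- move=> n t bt; rewrite h1// andbT.
  (* The point t/2 witnesses that the supremum runs over a nonempty set of nonnegative values. *)
  have t20 : 0 < t / 2 by rewrite divr_gt0// (block_gt0 bt).
  apply: (@le_trans _ _ (((t / 2) `^ p^-1 * ell (t / 2) `^ (alpha - 1))%:E * fstar2 f (t / 2))%E).
    by apply: mule_ge0; [rewrite lee_fin mulr_ge0 ?powR_ge0|exact: fstar2_ge0].
  apply: ereal_sup_ubound; exists (t / 2) => //.
  rewrite /= in_itv/= t20/=; have := block_gt0 bt; lra.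
- by move=> n t; rewrite addn1; exact: h2.
Qed.

(** The weights r^i left by [Asp_inner] are summed in the norm of E. As d_n <= (1+i)^(1-beta)
    d_(n+i), half of the exponential rate pays for this polynomial factor, and the other half, r'
    with r' r' = r, gives convergence. *)
Lemma Asp_equiv p (beta : R) E : 1 < p -> beta < 1 ->
  equivn (fnorm (Asp p beta E))
    (fun f => nseq E (fun n => (ell (en R n) `^ (beta - 1))%:E * Tq p (fun=> 1%R) f n))%E.
Proof.
move=> p1 b1; have g0 : beta - 1 <= 0 by lra.
have p0 : 0 < p by lra.
have q1 : p^-1 < 1 by rewrite invf_lt1.
have cd := coarse_ell_powR (beta - 1).
have [C C0 h] := Asp_inner p1.
have [C1 C10 h1] := tilde_le_seq (@ri_monotone R E) (@ri_homogeneous R E) cd C0.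
have [C2 C20 h2] := tilde_ge_seq 1 (@ri_monotone R E) (@ri_homogeneous R E) cd C0.
have k0 : 0 < (1 - p^-1) / 2 by lra.
have ng0 : 0 <= - (beta - 1) by rewrite oppr_ge0.
have [C3 C30 h3] := powR_le_expR ng0 k0.
set r := expR (- (1 - p^-1)) in h.
pose r' : R := expR (- ((1 - p^-1) / 2)).
have r01 : 0 <= r' < 1 by rewrite expR_ge0/= -expR0 ltr_expR; lra.
have ri0 : 0 < (1 - r')^-1 by rewrite invr_gt0; lra.
exists (C1 * (C3 * (1 - r')^-1) + C2) => [|f]; first by rewrite addr_gt0 ?mulr_gt0.
have c1 := coarse_cst (@ltr01 R).
have [hf1 hf2] := h f.
have T0 n : (0 <= Tq p (fun=> 1%R) f n)%E by exact: Tq_ge0.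
have d0 n : 0 <= ell (en R n) `^ (beta - 1) by exact: powR_ge0.
pose Y n := ((ell (en R n) `^ (beta - 1))%:E * Tq p (fun=> 1%R) f n)%E.
have Y0 n : (0 <= Y n)%E by rewrite mule_ge0 ?lee_fin.
pose H t := (\int[mu]_(s in `]t, 1%R[) ((s `^ p^-1)%:E * fstar2 f s * (s^-1)%:E))%E.
have H0 t : 0 < t -> (0 <= H t)%E.
  move=> t0; apply: integral_ge0 => s; rewrite /= in_itv/= => /andP[ts _].
  have s0 : 0 < s by exact: lt_trans ts.
  apply: mule_ge0; last by rewrite lee_fin invr_ge0 ltW.
  by apply: mule_ge0; [rewrite lee_fin powR_ge0|exact: fstar2_ge0].
have r0 i : 0 <= r ^+ i by rewrite exprn_ge0 ?expR_ge0.
have r'0 i : 0 <= r' ^+ i by rewrite exprn_ge0 ?expR_ge0.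
pose X n := (\sum_(i <oo) (r ^+ i)%:E * Tq p (fun=> 1%R) f (n + i))%E.
have X0 n : (0 <= X n)%E by apply: nneseries_ge0 => i _ _; rewrite mule_ge0 ?lee_fin.
have upper : (nseq E (fun n => (ell (en R n) `^ (beta - 1))%:E * X n) <=
    (C3 * (1 - r')^-1)%:E * nseq E Y)%E.
  apply: (@le_trans _ _ (nseq E (fun n => C3%:E * \sum_(i <oo) (r' ^+ i)%:E * Y (n + i)%N)%E)).
    apply: nseq_le; first exact: ri_monotone.
      by move=> n; rewrite mule_ge0 ?lee_fin.
    move=> n; rewrite -nneseriesZl; last by move=> i _; rewrite mule_ge0 ?lee_fin.
    rewrite -nneseriesZl; last by move=> i _; rewrite mule_ge0 ?lee_fin.
    apply: lee_nneseries => [i _ _|i _]; first by rewrite !mule_ge0 ?lee_fin.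
    rewrite /Y !muleA -!EFinM lee_wpmul2r// lee_fin.
    apply: (@le_trans _ _ ((1 + i%:R) `^ (- (beta - 1)) * ell (en R (n + i)) `^ (beta - 1) * r ^+ i)).
      by rewrite ler_wpM2r//; exact: ell_powR_shift.
    rewrite mulrAC ler_wpM2r//.
    apply: (@le_trans _ _ (C3 * expR ((1 - p^-1) / 2 * i%:R) * r ^+ i)).
      by rewrite ler_wpM2r//; exact: h3.
    rewrite -mulrA ler_wpM2l ?(ltW C30)//.
    rewrite /r /r' -!expRM_natr -expRD ler_expR.
    by rewrite le_eqVlt; apply/orP; left; apply/eqP; field; rewrite gt_eqF.
  rewrite nseqZ ?(ltW C30)//; last first.
    by move=> n; apply: nneseries_ge0 => i _ _; rewrite mule_ge0 ?lee_fin.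
  rewrite EFinM -muleA; apply: lee_wpmul2l; first by rewrite lee_fin ltW.
  exact: nseq_geometric_left.
split.
  apply: le_trans (h1 `]0, 1[%classic H X X0 _ _) _.
  - by move=> t /=; rewrite in_itv/= => /andP[-> /ltW].
  - move=> n t _ bt; rewrite H0 ?(block_gt0 bt)//=; exact: hf1.
  apply: (@le_trans _ _ (C1%:E * ((C3 * (1 - r')^-1)%:E * nseq E Y))%E).
    by apply: lee_wpmul2l => //; rewrite lee_fin ltW.
  by rewrite muleA -EFinM lee_wpmul2r ?nseq_ge0// lee_fin lerDl ltW.
apply: le_trans (h2 `]0, 1[%classic H _ T0 _) _.
  move=> n t _ bt; split; last by apply: hf2; rewrite -addn2.
  by rewrite /= in_itv/= (block_gt0 bt); move: bt; rewrite addnS; exact: block_lt1.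
by rewrite lee_wpmul2r ?tilde_ge0// lee_fin lerDr !mulr_ge0// ltW.
Qed.

End Equivalences.

(** * The functions b and rho *)

Section Weights.
Variable R : realType.
Implicit Types (w b : R -> R) (v : nat -> R) (E : ri_space R) (s t u : R) (n m k i D : nat).

Lemma powR_div (e x y : R) : 0 < x -> 0 < y -> (x / y) `^ e = x `^ e / y `^ e.
Proof.
move=> x0 y0; rewrite /powR !gt_eqF ?divr_gt0// lnM ?posrE ?invr_gt0// lnV ?posrE//.
by rewrite mulrDr mulrN expRD expRN.
Qed.

Lemma powR_ge1 (e x : R) : 0 < e -> 1 <= x -> 1 <= x `^ e.
Proof.
move=> e0 x1; rewrite /powR gt_eqF; last exact: lt_le_trans x1.
by rewrite -[leLHS]expR0 ler_expR mulr_ge0 ?(ltW e0)// ln_ge0.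
Qed.

(** Potter's bound. The first inequality comes from t^e b(t) being almost increasing, the second
    from t^-e b(t) being almost decreasing. *)
Lemma slowly_varying_le b (e : R) : slowly_varying b -> 0 < e ->
  exists2 C : R, 0 < C & forall s t, 0 < s -> s <= t -> t < 1 ->
    b s <= C * ((t / s) `^ e * b t) /\ b t <= C * ((t / s) `^ e * b s).
Proof.
move=> [_ b0 hb] e0.
have [[h hh [c [C [c0 C0 hC]]]] [g hg [c' [C' [c'0 C'0 hC']]]]] := hb e e0.
exists (C / c + C' / c') => [|s t s0 st t1]; first by rewrite addr_gt0 ?divr_gt0.
have t0 : 0 < t by exact: lt_le_trans st.
have s1 : s < 1 by exact: le_lt_trans t1.
have si : s \in `]0, 1[ by rewrite in_itv/= s0.
have ti : t \in `]0, 1[ by rewrite in_itv/= t0.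
have bs : 0 < b s by rewrite b0// s0.
have bt : 0 < b t by rewrite b0// t0.
have ps : 0 < s `^ e by exact: powR_gt0.
have pt : 0 < t `^ e by exact: powR_gt0.
have qe := powR_div e t0 s0.
have q0 : 0 < (t / s) `^ e by rewrite qe divr_gt0.
have /andP[hs1 hs2] := hC s ltac:(by rewrite s0).
have /andP[ht1 ht2] := hC t ltac:(by rewrite t0).
have /andP[gs1 gs2] := hC' s ltac:(by rewrite s0).
have /andP[gt1 gt2] := hC' t ltac:(by rewrite t0).
have hst := hh s t si ti st; have gst := hg t s ti si st.
have cc : 0 < C / c by exact: divr_gt0.
have cc' : 0 < C' / c' by exact: divr_gt0.
split.
  have : b s <= (C / c) * ((t / s) `^ e * b t).
    have -> : (C / c) * ((t / s) `^ e * b t) = (C / c * (t `^ e * b t)) / s `^ e.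
      by rewrite qe; field; rewrite !gt_eqF.
    rewrite ler_pdivlMr// mulrC; apply: (le_trans hs2).
    rewrite -mulrA ler_pM2l// ler_pdivlMl//; apply: le_trans ht1.
    by rewrite ler_pM2l.
  move=> /le_trans; apply; apply: ler_wpM2r; last by lra.
  by rewrite mulr_ge0 ?ltW.
have : b t <= (C' / c') * ((t / s) `^ e * b s).
  rewrite powRN in gs1 gs2; rewrite powRN in gt1 gt2.
  have -> : (C' / c') * ((t / s) `^ e * b s) = (C' / c' * ((s `^ e)^-1 * b s)) * t `^ e.
    by rewrite qe; field; rewrite !gt_eqF.
  rewrite -ler_pdivrMr// mulrC; apply: (le_trans gt2).
  rewrite -mulrA ler_pM2l// ler_pdivlMl//; apply: le_trans gs1.
  by rewrite ler_pM2l.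
move=> /le_trans; apply; apply: ler_wpM2r; last by lra.
by rewrite mulr_ge0 ?ltW.
Qed.

Lemma extend1_gt0 b s : slowly_varying b -> 0 < s -> 0 < extend1 b s.
Proof. by move=> [_ b0 _] s0; rewrite /extend1; case: ifP => // s1; rewrite b0// s0. Qed.

(** Potter's bound on (0, oo). The two powers are added because s and t come in no fixed order; one
    of them is at least 1 and carries the estimate. *)
Lemma extend1_le b (e : R) : slowly_varying b -> 0 < e ->
  exists2 C : R, 0 < C & forall s t, 0 < s -> 0 < t ->
    extend1 b s <= C * (((t / s) `^ e + (s / t) `^ e) * extend1 b t).
Proof.
move=> hb e0; have [C C0 hC] := slowly_varying_le hb e0.
have b0 s : 0 < s < 1 -> 0 < b s by case: hb => _ + _; exact.
have h2 : 0 < (2^-1 : R) < 1 by rewrite invr_gt0 invf_lt1// ltr0n ltr1n.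
have bh : 0 < b 2^-1 by exact: b0.
pose q := (2 : R) `^ e; have q0 : 0 < q by exact: powR_gt0.
(* For s < 1 <= t the number b(1/2) mediates between b(s) and 1. The ratio between s and 1/2, taken
   in either order, is at most 2 t/s, which produces q = 2^e. *)
have near1 s t : 0 < s -> s < 1 -> 1 <= t ->
    b s <= C * q * b 2^-1 * (t / s) `^ e /\ 1 <= C * q * (b 2^-1)^-1 * (t / s) `^ e * b s.
  move=> s0 s1 t1; have bs : 0 < b s by rewrite b0// s0.
  have ts0 : 0 < t / s by rewrite divr_gt0// (lt_le_trans _ t1).
  have key x : 0 < x -> x <= 2 * (t / s) -> x `^ e <= q * (t / s) `^ e.
    move=> x0 xle; rewrite /q -powRM ?(ltW ts0)//.
    by apply: ge0_ler_powR => //; rewrite ?nnegrE; lra.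
  have is1 : 1 <= s^-1 by rewrite invf_ge1// ltW.
  have tsi : s^-1 <= t / s by rewrite ler_peMl// invr_ge0 ltW.
  suff [h1 h1'] : exists2 x, x `^ e <= q * (t / s) `^ e &
      b s <= C * (x `^ e * b 2^-1) /\ b 2^-1 <= C * (x `^ e * b s).
    move=> [k1 k2]; split.
      have -> : C * q * b 2^-1 * (t / s) `^ e = C * ((q * (t / s) `^ e) * b 2^-1) by ring.
      by apply: (le_trans k1); rewrite ler_pM2l// ler_pM2r.
    rewrite -(ler_pM2l bh) mulr1; apply: (le_trans k2).
    have -> : b 2^-1 * (C * q * (b 2^-1)^-1 * (t / s) `^ e * b s) = C * ((q * (t / s) `^ e) * b s).
      by field; rewrite gt_eqF.
    by rewrite ler_pM2l// ler_pM2r.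
  have [sh|hs] := leP s 2^-1.
    exists (2^-1 / s); last by apply: hC => //; case/andP: h2.
    by apply: key; [rewrite divr_gt0|nra].
  exists (s / 2^-1); last by have [? ?] := hC _ _ (proj1 (andP h2)) (ltW hs) s1.
  by apply: key; [rewrite divr_gt0|rewrite invrK; nra].
pose K := 1 + C + C * q * b 2^-1 + C * q * (b 2^-1)^-1.
have c1 : 0 < C * q * b 2^-1 by rewrite !mulr_gt0.
have c2 : 0 < C * q * (b 2^-1)^-1 by rewrite !mulr_gt0 ?invr_gt0.
have K0 : 0 < K by rewrite /K; lra.
exists K => // s t s0 t0.
have ext x := extend1_gt0 hb x.
have p1 : 0 < (t / s) `^ e by rewrite powR_gt0// divr_gt0.
have p2 : 0 < (s / t) `^ e by rewrite powR_gt0// divr_gt0.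
have fin M x : 0 <= M -> M <= K -> 0 <= x -> x <= (t / s) `^ e + (s / t) `^ e ->
    M * (x * extend1 b t) <= K * (((t / s) `^ e + (s / t) `^ e) * extend1 b t).
  move=> M0 MK x0 xle; have bt := ext _ t0.
  apply: ler_pM => //; first by rewrite mulr_ge0// ltW.
  by rewrite ler_pM2r.
have [st|ts] := leP s t.
  apply: le_trans (fin _ ((t / s) `^ e) _ _ _ _); last 4 first.
  - exact: (ltW K0).
  - exact: lexx.
  - exact: ltW.
  - by lra.
  have ge1 : 1 <= (t / s) `^ e.
    by apply: powR_ge1 => //; rewrite ler_pdivlMr// mul1r.
  rewrite /extend1; case: ifP => s1; case: ifP => t1.
  - apply: (le_trans (hC _ _ s0 st t1).1); rewrite ler_wpM2r//; last by rewrite /K; lra.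
    by rewrite mulr_ge0 ?ltW// b0// t0.
  - rewrite mulr1; apply: (le_trans (near1 s t s0 s1 _).1); first by rewrite leNgt t1.
    by rewrite ler_wpM2r ?(ltW p1)// /K; lra.
  - by move: s1; rewrite (le_lt_trans st t1).
  - rewrite mulr1; have : 1 <= K by rewrite /K; lra.
    by nra.
apply: le_trans (fin _ ((s / t) `^ e) _ _ _ _); last 4 first.
- exact: (ltW K0).
- exact: lexx.
- exact: ltW.
- by lra.
have ge1 : 1 <= (s / t) `^ e.
  by apply: powR_ge1 => //; rewrite ler_pdivlMr// mul1r ltW.
rewrite /extend1; case: ifP => s1; case: ifP => t1.
- apply: (le_trans (hC _ _ t0 (ltW ts) s1).2); rewrite ler_wpM2r//; last by rewrite /K; lra.
  by rewrite mulr_ge0 ?ltW// b0// t0.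
- by move: t1; rewrite (lt_trans ts s1).
- have := (near1 t s t0 t1 _).2; rewrite leNgt s1 => /(_ isT) /le_trans; apply.
  have bt : 0 < b t by rewrite b0// t0.
  by rewrite mulrA ler_pM2r// ler_pM2r// /K; lra.
- rewrite mulr1; have : 1 <= K by rewrite /K; lra.
  by nra.
Qed.

End Weights.

(** * The fundamental function and the tail norm *)

Section BuildingBlocks.
Variable R : realType.
Implicit Types (w b : R -> R) (v : nat -> R) (E : ri_space R) (s t u : R) (n m k i D : nat).

(** Iterating the one-step comparison of the samples covers D blocks. Enlarging [C'] by 1 makes its
    powers increase, so the bound for D steps serves any smaller number of steps. *)
Lemma coarse_of_seq w v (C C' : R) : (forall t, 0 < t <= 1 -> 0 < w t) -> 0 < C -> 0 < C' ->
  (forall n, 0 < v n) ->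
  (forall n t, block n t -> w t <= C * v n /\ v n <= C * w t) ->
  (forall n, v n <= C' * v n.+1 /\ v n.+1 <= C' * v n) -> coarse w.
Proof.
move=> w0 C0 C'0 v0 wv vv; split => // D.
pose K := C' + 1; have K1 : 1 <= K by rewrite /K; lra.
have vK n : v n <= K * v n.+1 /\ v n.+1 <= K * v n.
  by have [h1 h2] := vv n; have := v0 n; have := v0 n.+1; rewrite /K; split; nra.
have vi n i : v n <= K ^+ i * v (n + i)%N /\ v (n + i)%N <= K ^+ i * v n.
  elim: i => [|i [h1 h2]]; first by rewrite addn0 expr0 !mul1r.
  have K0 : 0 <= K ^+ i by rewrite exprn_ge0//; lra.
  have [h3 h4] := vK (n + i)%N; rewrite addnS exprSr; split.
    by apply: (le_trans h1); rewrite -mulrA ler_wpM2l.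
  by apply: (le_trans h4); rewrite -mulrA mulrCA ler_wpM2l//; lra.
exists (C * (K ^+ D * C)) => [|s t t0 ts s1 r]; first by rewrite !mulr_gt0// exprn_gt0//; lra.
have s01 : 0 < s <= 1 by rewrite (lt_le_trans t0 ts).
have t01 : 0 < t <= 1 by rewrite t0 (le_trans ts).
have bs := idx_block s01; have bt := idx_block t01.
have st : (idx s <= idx t)%N by apply: le_truncn; rewrite lerN2 ler_ln// posrE; case/andP: s01.
have tD : (idx t <= idx s + D)%N.
  have h : - ln t <= - ln s + D%:R.
    have := @ler_ln R s (expR D%:R * t); rewrite !posrE mulr_gt0 ?expR_gt0//.
    case/andP: (s01) => -> _ /(_ isT isT); rewrite r => /esym.
    by rewrite lnM ?posrE ?expR_gt0// expRK; lra.
  rewrite -ltnS; have : (idx t)%:R < (idx s + D).+1%:R :> R.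
    apply: (@le_lt_trans _ _ (- ln t)); first by rewrite truncn_le oppr_ge0 ln_le0//; case/andP: t01.
    apply: (le_lt_trans h); rewrite -natr1 natrD addrAC ltrD2r natr1; exact: truncnS_gt.
  by rewrite ltr_nat.
have [i iD ti] : exists2 i, (i <= D)%N & idx t = (idx s + i)%N.
  by exists (idx t - idx s)%N; rewrite ?subnKC// leq_subLR.
have [h1 h2] := wv _ _ bs; have [h3 h4] := wv _ _ bt; have [h5 h6] := vi (idx s) i.
rewrite ti in h3 h4.
have KD : K ^+ i <= K ^+ D by rewrite ler_weXn2l.
have Ki0 : 0 <= K ^+ i by rewrite exprn_ge0//; lra.
have ws := w0 _ s01; have wt := w0 _ t01; have C00 := ltW C0.
split.
  apply: (le_trans h1); rewrite -!mulrA ler_wpM2l//; apply: (le_trans h5).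
  apply: ler_pM => //; exact: ltW.
apply: (le_trans h3); rewrite -!mulrA ler_wpM2l//; apply: (le_trans h6).
by apply: ler_pM => //; exact: ltW.
Qed.

(** The fundamental function at the integer [m], in a form to which the relabelling lemmas apply. *)
Definition window E m : \bar R := nseq E (fun k => if (k < m)%N then 1 else 0)%E.

Lemma indic_nonneg_measurable (A : set R) : measurable A ->
  nonneg_measurable (fun x => (\1_A x)%:E : \bar R).
Proof.
move=> mA; split; last by move=> x _; rewrite lee_fin.
by apply/measurable_EFinP; exact: measurable_indic.
Qed.

Lemma le_fundamental E s t : s <= t -> (fundamental E s <= fundamental E t)%E.
Proof.
move=> st; apply: ri_monotone; [exact: indic_nonneg_measurable..|].
move=> x x0; rewrite lee_fin !indicE !mem_setE !in_itv/= x0/= ler_nat.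
by case: (ltP x s) => [/lt_le_trans/(_ st) ->|_].
Qed.

Lemma fundamental_nat E n : fundamental E n%:R = window E n.
Proof.
rewrite /window nseq_truncn; last by move=> k; case: ifP.
have e x : 0 < x -> (\1_(`]0, n%:R[%classic : set R) x)%:E =
    ((fun k => if (k < n)%N then 1 else 0)%E \o Num.truncn (R:=R)) x :> \bar R.
  move=> x0; rewrite /= indicE mem_setE in_itv/= x0/= truncn_lt_nat ?ltW//.
  by case: (ltP x n%:R).
apply/eqP; rewrite eq_le; apply/andP; split; apply: ri_monotone.
- exact: indic_nonneg_measurable.
- by apply: truncn_nonneg_measurable => k; case: ifP.
- by move=> x /e ->.
- by apply: truncn_nonneg_measurable => k; case: ifP.
- exact: indic_nonneg_measurable.
- by move=> x /e ->.
Qed.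

Lemma fundamental_lty E s : (fundamental E s < +oo)%E.
Proof.
apply: ri_indic => //.
  by move=> x; rewrite /= !in_itv/= andbT => /andP[].
by rewrite lebesgue_measure_itv/=; case: ifP => _; rewrite ?ltry// -EFinB ltry.
Qed.

Lemma fundamental_gt0 E s : 0 < s -> (0 < fundamental E s)%E.
Proof.
move=> s0; have hn := indic_nonneg_measurable (measurable_itv `]0, s[).
rewrite lt_neqAle (ri_ge0 _ hn) andbT; apply/eqP => /esym/(ri_eq0 E hn)[N [mN N0 hN]].
have : (lebesgue_measure (`]0%R, s[%classic : set R) <= lebesgue_measure N)%E.
  apply: le_measure; rewrite ?inE// => x xI; apply: hN => /= h.
  have : 0 < x by move: xI; rewrite /= in_itv/= => /andP[].
  by move=> /h/eqP; rewrite indicE mem_set// eqe oner_eq0.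
by rewrite [X in (_ <= X)%E -> _]N0 lebesgue_measure_itv/= lte_fin s0 oppr0 adde0 lee_fin leNgt s0.
Qed.

(** Division by i + 1 sends the first m + i indices into the first m, with fibres of at most i + 1
    elements. So the fundamental function grows at most linearly. *)
Lemma window_double E m i : (0 < m)%N -> (window E (m + i) <= i.+1%:R%:E * window E m)%E.
Proof.
move=> m0; apply: (@nseq_quasi _ _ _ _ (fun k => k %/ i.+1)%N i).
- by move=> n; case: ifP.
- by move=> n; case: ifP.
- move=> n; case: ifP => // nm; last by case: ifP.
  rewrite ifT// ltn_divLR//; apply: (leq_trans nm); nia.
- move=> n k nk e.
  rewrite (divn_eq n i.+1) (divn_eq k i.+1) e subnDl.
  by apply: leq_trans (leq_subr _ _) _; rewrite -ltnS ltn_mod.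
Qed.

Lemma fundamental_ellE E t : (fundamental_ell E t)%:E = fundamental E (ell t).
Proof.
by rewrite /fundamental_ell fineK// ge0_fin_numE ?fundamental_lty// ltW// fundamental_gt0// (lt_le_trans _ (ell_ge1 t)).
Qed.

Lemma fundamental_ell_en E n : (fundamental_ell E (en R n))%:E = window E n.+1.
Proof. by rewrite fundamental_ellE ell_en fundamental_nat. Qed.

Lemma fundamental_ell_gt0 E t : 0 < fundamental_ell E t.
Proof. by rewrite -lte_fin fundamental_ellE fundamental_gt0// (lt_le_trans _ (ell_ge1 t)). Qed.

Lemma block_ell n t : block n t -> n.+1%:R <= ell t <= n.+2%:R.
Proof.
move=> bt; rewrite ell_le1 ?(block_itv bt)//; have t0 := block_gt0 bt.
have := block_lt bt; have := block_le bt.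
rewrite -ler_ln ?posrE ?en_gt0// -ltr_ln ?posrE ?en_gt0// /en !expRK -!natr1.
by move=> h1 h2; apply/andP; split; lra.
Qed.

Lemma fundamental_ell_shift E n i :
  fundamental_ell E (en R (n + i)) <= i.+1%:R * fundamental_ell E (en R n).
Proof.
have := @window_double E n.+1 i isT; rewrite addSn.
by rewrite -lee_fin EFinM !fundamental_ell_en.
Qed.

Lemma fundamental_ell_nd E n m : (n <= m)%N ->
  fundamental_ell E (en R n) <= fundamental_ell E (en R m).
Proof. by move=> nm; rewrite -lee_fin !fundamental_ellE le_fundamental// !ell_en ler_nat. Qed.

Lemma double_bounds (x y z : R) : 0 <= x -> x <= z -> z <= y -> y <= 2 * x ->
  z <= 2 * x /\ x <= 2 * z.
Proof. by move=> *; split; lra. Qed.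

Lemma coarse_fundamental_ell E : coarse (fundamental_ell E).
Proof.
apply: (@coarse_of_seq _ (fun n => fundamental_ell E (en R n)) 2 2) => //.
- by move=> t _; exact: fundamental_ell_gt0.
- by move=> n; exact: fundamental_ell_gt0.
- move=> n t bt; have /andP[h1 h2] := block_ell bt.
  have : fundamental_ell E (en R n) <= fundamental_ell E t.
    by rewrite -lee_fin !fundamental_ellE le_fundamental// ell_en.
  have : fundamental_ell E t <= fundamental_ell E (en R n.+1).
    by rewrite -lee_fin !fundamental_ellE le_fundamental// ell_en.
  have := fundamental_ell_shift E n 1; rewrite addn1 => k1 k2 k3.
  exact: double_bounds (ltW (fundamental_ell_gt0 E (en R n))) k3 k2 k1.
- move=> n; have := fundamental_ell_shift E n 1; have := fundamental_ell_nd E (leqnSn n).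
  rewrite addn1 => k1 k2.
  by have [] := double_bounds (ltW (fundamental_ell_gt0 E (en R n))) k1 (lexx _) k2.
Qed.

Lemma fine_le_mul (C x : R) (y : \bar R) : y \is a fin_num ->
  (x%:E <= C%:E * y)%E -> x <= C * fine y.
Proof. by case: y => // y _; rewrite -EFinM lee_fin. Qed.

Lemma fine_mul_le (C x : R) (y : \bar R) : y \is a fin_num ->
  (y <= C%:E * x%:E)%E -> fine y <= C * x.
Proof. by case: y => // y _; rewrite -EFinM lee_fin. Qed.

Lemma shift_bounds (x y z : R) : 0 <= x -> 0 <= y -> 0 <= z -> y <= x -> x <= z * y ->
  x <= (1 + z) * y /\ y <= (1 + z) * x.
Proof.
move=> x0 y0 z0 yx xzy; have zx := mulr_ge0 z0 x0.
by rewrite !mulrDl !mul1r; split; lra.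
Qed.

Section Tail.
Variables (E1 : ri_space R) (beta : R).
Hypothesis beta1 : beta < 1.
Hypothesis hE1 : (E1 (fun u => ((1 + u) `^ (beta - 1))%:E) < +oo)%E.

Definition dseq n : R := ell (en R n) `^ (beta - 1).

(** Discrete stand-in for [tail_norm] at e^-n, kept in the extended reals until its finiteness is
    established. *)
Definition tailseq n : \bar R := nseq E1 (fun k => (dseq k)%:E * (if (n <= k)%N then 1 else 0))%E.

Lemma dseq_gt0 n : 0 < dseq n.
Proof. by rewrite powR_gt0// (lt_le_trans _ (ell_ge1 _)). Qed.

Let tail0 n k : (0 <= (dseq k)%:E * (if (n <= k)%N then 1 else 0) :> \bar R)%E.
Proof. by rewrite mule_ge0 ?lee_fin ?(ltW (dseq_gt0 _))//; case: ifP. Qed.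

Lemma powR_sum_nonneg_measurable (g : R) : nonneg_measurable (fun u : R => ((1 + u) `^ g)%:E).
Proof.
split; last by move=> x _; rewrite lee_fin powR_ge0.
apply/measurable_EFinP; apply: (measurableT_comp (measurable_powR _)).
by apply: measurable_funD => //; exact: measurable_cst.
Qed.

(** For n the integer part of x, 1 + x <= 2(n + 1). So the step function with values d_n is at most
    2^(1-beta) (1+x)^(beta-1), whose E1 norm is finite by hypothesis. *)
Lemma tailseq0_lty : (tailseq 0 < +oo)%E.
Proof.
have g0 : beta - 1 <= 0 by rewrite subr_le0 ltW.
pose c : R := 2 `^ (- (beta - 1)).
have c0 : 0 <= c by exact: powR_ge0.
apply: (@le_lt_trans _ _ (c%:E * E1 (fun u => ((1 + u) `^ (beta - 1))%:E))%E).
  rewrite -ri_homo//; last exact: powR_sum_nonneg_measurable.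
  rewrite /tailseq nseq_truncn//; apply: ri_monotone.
  - exact: truncn_nonneg_measurable.
  - have [m1 m2] := powR_sum_nonneg_measurable (beta - 1); split.
      exact: measurable_funeM.
    by move=> x x0; rewrite mule_ge0 ?lee_fin ?powR_ge0.
  move=> x x0 /=; rewrite mule1 -EFinM lee_fin /dseq ell_en.
  have /andP[h1 h2] := truncn_itv (ltW x0).
  set n := Num.truncn x in h1 h2 *.
  have n1 : 0 < n.+1%:R :> R by rewrite ltr0n.
  have x1 : 0 < 1 + x by lra.
  rewrite /c /powR !gt_eqF// -expRD ler_expR.
  have : ln (1 + x) <= ln 2 + ln n.+1%:R :> R.
    rewrite -lnM ?posrE// ler_ln ?posrE ?mulr_gt0//.
    by move: h2; rewrite -natr1; have := ler0n R n; lra.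
  nra.
have := hE1; case: (E1 _) (ri_ge0 E1 (powR_sum_nonneg_measurable (beta - 1))) => [r _ _|//|//].
by rewrite -EFinM ltry.
Qed.

Lemma tailseq_le n m : (n <= m)%N -> (tailseq m <= tailseq n)%E.
Proof.
move=> nm; apply: nseq_le => //; first exact: ri_monotone.
move=> k; apply: lee_wpmul2l; first by rewrite lee_fin ltW// dseq_gt0.
by case: ifP => [mk|_]; [rewrite (leq_trans nm mk)|case: ifP].
Qed.

(** A shift by i lowers the entries d_k by at most a power of 1 + i, so the tail norm falls only
    polynomially in n. The power of u in rho outweighs this later. *)
Lemma tailseq_shift n i : (tailseq n <= ((1 + i%:R) `^ (- (beta - 1)))%:E * tailseq (n + i))%E.
Proof.
have g0 : beta - 1 <= 0 by rewrite subr_le0 ltW.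
have c0 : 0 <= (1 + i%:R : R) `^ (- (beta - 1)) by exact: powR_ge0.
rewrite /tailseq -(nseqZ E1 c0 (tail0 (n + i))).
apply: le_trans (@nseq_shift _ E1 _ i _); last by move=> k; rewrite mule_ge0 ?lee_fin.
apply: nseq_le => //; first exact: ri_monotone.
move=> k; rewrite leq_add2r muleA -EFinM; apply: lee_wpmul2r; first by case: ifP.
by rewrite lee_fin; exact: ell_powR_shift.
Qed.

(** The entry at n alone has the norm on the left: [nseq_inj] moves it there from index 0. This
    gives the bound of d_n by a multiple of tau_n that P1 needs. *)
Lemma dseq_le_tailseq n : ((dseq n)%:E * window E1 1 <= tailseq n)%E.
Proof.
have d0 := ltW (dseq_gt0 n).
have w0 k : (0 <= if (k < 1)%N then 1 else 0 :> \bar R)%E by case: ifP.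
rewrite /window -(nseqZ E1 d0 w0).
have e k : (0 < (dseq n)%:E * (if (k < 1)%N then 1 else 0) :> \bar R)%E -> k = 0%N.
  by case: k => //= k; rewrite mule0 ltxx.
apply: (@nseq_inj _ _ _ _ (fun k => (k + n)%N)) => //.
- by move=> k; rewrite mule_ge0 ?lee_fin//; case: ifP.
- by move=> k /e ->; rewrite /= !add0n leqnn.
- by move=> k m /e -> /e ->.
Qed.

Lemma tail_norm_tailseq : exists2 C : R, 0 < C & forall n t, block n t ->
  (tilde E1 `]0%R, t[ (fun s => (ell s `^ (beta - 1))%:E) <= C%:E * tailseq n)%E /\
  (tailseq n <= C%:E * tilde E1 `]0%R, t[ (fun s => (ell s `^ (beta - 1))%:E))%E.
Proof.
have cd := coarse_ell_powR (beta - 1).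
have [C1 C10 h1] := tilde_le_seq (@ri_monotone R E1) (@ri_homogeneous R E1) cd ltr01.
have [C2 C20 h2] := tilde_ge_seq 0 (@ri_monotone R E1) (@ri_homogeneous R E1) cd ltr01.
exists (C1 + C2) => [|n t bt]; first exact: addr_gt0.
pose X k : \bar R := if (n <= k)%N then 1%E else 0%E.
have X0 k : (0 <= X k)%E by rewrite /X; case: ifP.
have e : (fun s : R => (ell s `^ (beta - 1))%:E) = (fun s => (ell s `^ (beta - 1))%:E * (fun=> 1%:E) s)%E.
  by apply/funext => s; rewrite mule1.
rewrite e; split.
  apply: le_trans (h1 `]0, t[%classic (fun=> 1%:E) X X0 _ _) _.
  - move=> s /=; rewrite in_itv/= => /andP[-> st].
    by rewrite ltW// (lt_le_trans st)//; exact: block_le1 bt.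
  - move=> k s /=; rewrite in_itv/= => /andP[s0 st] bs; rewrite lee_fin ler01/= mul1e /X ifT//.
    by rewrite leqNgt; apply/negP => kn; have := lt_block kn bs bt; rewrite ltNge ltW.
  by rewrite lee_wpmul2r ?nseq_ge0// lee_fin lerDl ltW.
apply: le_trans (h2 `]0, t[%classic (fun=> 1%:E) X X0 _) _; last first.
  by rewrite lee_wpmul2r ?tilde_ge0// lee_fin lerDr ltW.
move=> k s; rewrite /X; case: ifP => [nk _ bs|_]; last by rewrite ltxx.
split; last by rewrite mul1e.
by rewrite /= in_itv/= (block_gt0 bs); apply: lt_block bt bs; rewrite addn1.
Qed.

Lemma tailseq_lty n : (tailseq n < +oo)%E.
Proof. by apply: le_lt_trans tailseq0_lty; exact: tailseq_le. Qed.

Lemma tailseq_gt0 n : (0 < tailseq n)%E.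
Proof.
apply: lt_le_trans (dseq_le_tailseq n).
by rewrite mule_gt0 ?lte_fin ?dseq_gt0// -fundamental_nat fundamental_gt0.
Qed.

Lemma tail_normE t : 0 < t <= 1 ->
  (tail_norm beta E1 t)%:E = tilde E1 `]0%R, t[ (fun s => (ell s `^ (beta - 1))%:E).
Proof.
move=> t01; rewrite /tail_norm fineK// ge0_fin_numE ?tilde_ge0//.
have [C C0 /(_ _ _ (idx_block t01))[h _]] := tail_norm_tailseq.
by apply: le_lt_trans h _; rewrite lte_mul_pinfty ?lee_fin ?(ltW C0)// tailseq_lty.
Qed.

Lemma tail_norm_fine : exists2 C : R, 0 < C & forall n t, block n t ->
  tail_norm beta E1 t <= C * fine (tailseq n) /\ fine (tailseq n) <= C * tail_norm beta E1 t.
Proof.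
have [C C0 h] := tail_norm_tailseq; exists C => // n t bt; have [h1 h2] := h _ _ bt.
have f : tailseq n \is a fin_num by rewrite ge0_fin_numE ?tailseq_lty// ltW// tailseq_gt0.
have e := tail_normE (block_itv bt).
rewrite -e in h1 h2; split; first exact: fine_le_mul f h1.
exact: fine_mul_le f h2.
Qed.

Lemma fine_tailseq_gt0 n : 0 < fine (tailseq n).
Proof. by rewrite fine_gt0// tailseq_gt0 tailseq_lty. Qed.

Lemma tail_norm_gt0 t : 0 < t <= 1 -> 0 < tail_norm beta E1 t.
Proof.
move=> t01; have [C C0 h] := tail_norm_fine; have [_ h2] := h _ _ (idx_block t01).
have := lt_le_trans (fine_tailseq_gt0 (idx t)) h2.
by rewrite pmulr_rgt0.
Qed.

Lemma fine_tailseq_le n m : (n <= m)%N -> fine (tailseq m) <= fine (tailseq n).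
Proof.
move=> nm; apply: fine_le; last exact: tailseq_le.
all: by rewrite ge0_fin_numE ?tailseq_lty// ltW// tailseq_gt0.
Qed.

Lemma fine_tailseq_shift n i :
  fine (tailseq n) <= (1 + i%:R) `^ (- (beta - 1)) * fine (tailseq (n + i)).
Proof.
have f m : tailseq m \is a fin_num by rewrite ge0_fin_numE ?tailseq_lty// ltW// tailseq_gt0.
apply: (fine_le_mul (f (n + i)%N)); rewrite (fineK (f n)); exact: tailseq_shift.
Qed.

Lemma coarse_tail_norm : coarse (tail_norm beta E1).
Proof.
have [C C0 h] := tail_norm_fine.
have q0 : 0 < (1 + 1%:R : R) `^ (- (beta - 1)) by rewrite powR_gt0.
apply: (@coarse_of_seq _ (fun n => fine (tailseq n)) C (1 + (1 + 1%:R : R) `^ (- (beta - 1)))) => //.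
- exact: tail_norm_gt0.
- exact: fine_tailseq_gt0.
move=> n; have h1 := fine_tailseq_shift n 1; have h2 := fine_tailseq_le (leqnSn n).
rewrite addn1 in h1; have h3 := fine_tailseq_gt0 n.+1; have h4 := fine_tailseq_gt0 n.
exact: shift_bounds (ltW h4) (ltW h3) (ltW q0) h2 h1.
Qed.

End Tail.
End BuildingBlocks.

(** * Geometric decay of rho and of the interpolation weights *)

Section Rho.
Variable R : realType.
Implicit Types (w b : R -> R) (v : nat -> R) (s t u : R) (n m k i D : nat).

Lemma coarseV w : coarse w -> coarse (fun t => (w t)^-1).
Proof.
move=> [w0 hw]; split=> [t t01|D]; first by rewrite invr_gt0 w0.
have [C C0 hC] := hw D; exists C => // s t t0 ts s1 r.
have [h1 h2] := hC s t t0 ts s1 r.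
have s01 : 0 < w s by rewrite w0// (lt_le_trans t0 ts).
have t01 : 0 < w t by rewrite w0// t0 (le_trans ts).
by split; rewrite -ler_pdivrMr ?invr_gt0// invrK mulrC ler_pdivrMr// mulrC.
Qed.

(** Arithmetic core of the decay of rho: a, f, t are the values of ell^(alpha-1), of the fundamental
    function and of the tail norm at n, primed at n+i; j and g bound the change of the last two, and
    X is an exponential dominating j g. *)
Lemma quotient_bound (C K a a' f f' t t' j g X : R) : 0 < C -> 0 < K -> 0 <= a' -> a' <= a ->
  0 < f -> 0 < f' -> f' <= j * f -> 0 < t -> 0 < t' -> t <= C * (g * t') -> j * g <= K * X ->
  a' * f' / t' <= C * K * X * (a * f / t).
Proof.
move=> C0 K0 a'0 aa f0 f'0 fj t0 t'0 tg jg.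
have a0 : 0 <= a by exact: le_trans aa.
rewrite ler_pdivrMr//; apply: (@le_trans _ _ (a * (j * f))).
  by apply: ler_pM => //; exact: ltW.
have j0 : 0 < j by rewrite -(pmulr_lgt0 _ f0); exact: lt_le_trans fj.
have -> : C * K * X * (a * f / t) * t' = (C * (K * X)) * t' / t * (a * f) by ring.
have -> : a * (j * f) = j * (a * f) by ring.
apply: ler_wpM2r; first by rewrite mulr_ge0// ltW.
rewrite ler_pdivlMr//; apply: (@le_trans _ _ (j * (C * (g * t')))).
  by rewrite ler_pM2l.
have -> : j * (C * (g * t')) = C * (j * g) * t' by ring.
by rewrite ler_pM2r// ler_pM2l.
Qed.

Variables (E0 E1 : ri_space R) (b : R -> R) (p0 p1 alpha beta : R).
Hypothesis hb : slowly_varying b.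
Hypothesis hp0 : 1 < p0.
Hypothesis hp01 : p0 < p1.
Hypothesis halpha : alpha < 1.
Hypothesis hbeta : beta < 1.
Hypothesis hE1 : (E1 (fun u => ((1 + u) `^ (beta - 1))%:E) < +oo)%E.

Let p00 : 0 < p0. Proof. exact: lt_trans hp0. Qed.
Let p10 : 0 < p1. Proof. exact: lt_trans hp01. Qed.

Notation rh := (rho p0 p1 alpha beta E0 E1).

Definition rs n : R := rh (en R n).

Lemma delta_gt0 : 0 < p0^-1 - p1^-1.
Proof. by rewrite subr_gt0 ltf_pV2. Qed.

Lemma coarse_rho : coarse rh.
Proof.
apply: coarseM; first exact: coarse_powid.
apply: coarseM; last by apply: coarseV; exact: coarse_tail_norm.
by apply: coarseM; [exact: coarse_ell_powR|exact: coarse_fundamental_ell].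
Qed.

Lemma rho_gt0 t : 0 < t <= 1 -> 0 < rh t.
Proof. exact: coarse_rho.1. Qed.

Lemma rs_gt0 n : 0 < rs n.
Proof. by apply: rho_gt0; exact: en_itv. Qed.

Lemma tail_norm_en_gt0 n : 0 < tail_norm beta E1 (en R n).
Proof. by apply: tail_norm_gt0 => //; exact: en_itv. Qed.

Lemma rsE n : rs n * (tail_norm beta E1 (en R n) * weight p1 (fun=> 1) (en R n)) =
  fundamental_ell E0 (en R n) * weight p0 (fun s => ell s `^ (alpha - 1)) (en R n).
Proof.
have t0 := tail_norm_en_gt0 n.
have -> : weight p0 (fun s => ell s `^ (alpha - 1)) (en R n) =
    (en R n `^ (p0^-1 - p1^-1) * en R n `^ p1^-1) * ell (en R n) `^ (alpha - 1).
  rewrite /weight -powRD; last by apply/implyP => _; rewrite gt_eqF// en_gt0.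
  by rewrite subrK.
rewrite /rs /rho /weight mulr1; move: (_ `^ _) (_ `^ p1^-1) (_ `^ (alpha - 1)) t0.
move: (tail_norm _ _ _) (fundamental_ell _ _) => x y z z1 z2 x0.
by field; rewrite gt_eqF.
Qed.

Lemma tail_norm_shift : exists2 C : R, 0 < C & forall n i,
  tail_norm beta E1 (en R n) <=
    C * ((1 + i%:R) `^ (1 - beta) * tail_norm beta E1 (en R (n + i))).
Proof.
have [C C0 h] := tail_norm_fine hbeta hE1; exists (C * C) => [|n i]; first exact: mulr_gt0.
have [h1 _] := h _ _ (en_block R n); have [_ h2] := h _ _ (en_block R (n + i)).
apply: (le_trans h1); rewrite -mulrA ler_pM2l//.
apply: (le_trans (fine_tailseq_shift hbeta hE1 n i)).
by rewrite opprB mulrCA ler_wpM2l ?powR_ge0.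
Qed.

(** With delta = 1/p0 - 1/p1, passing from n to n+i gains e^(-i delta) from the power of u, and
    loses at most a multiple of (1+i)^(2-beta) through the fundamental function and the tail norm.
    Half of delta pays for the loss, the other half is the rate. *)
Lemma rs_decay : exists C r : R, [/\ 0 < C, 0 < r < 1 &
  forall n i, rs (n + i) <= C * r ^+ i * rs n].
Proof.
have d0 := delta_gt0; have d20 : 0 < (p0^-1 - p1^-1) / 2 by rewrite divr_gt0.
have [C C0 h] := tail_norm_shift.
have g0 : 0 <= 1 + (1 - beta) by rewrite addr_ge0// subr_ge0 ltW.
have [K K0 hK] := powR_le_expR g0 d20.
exists (C * K), (expR (- ((p0^-1 - p1^-1) / 2))); split; first exact: mulr_gt0.
  by rewrite expR_gt0/= -[ltRHS]expR0 ltr_expR oppr_lt0.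
move=> n i; have t0 := tail_norm_en_gt0 n; have t1 := tail_norm_en_gt0 (n + i).
have hphi := fundamental_ell_shift E0 n i.
have phi0 := fundamental_ell_gt0 E0 (en R n).
have phi1 := fundamental_ell_gt0 E0 (en R (n + i)).
have htail := h n i; have hexp := hK _ (ler0n R i).
have hell : ell (en R (n + i)) `^ (alpha - 1) <= ell (en R n) `^ (alpha - 1).
  rewrite !ell_en /powR !gt_eqF ?ltr0n// ler_expR.
  rewrite -subr_ge0 -mulrBr nmulr_rge0 ?subr_lt0// subr_le0 ler_ln ?posrE ?ltr0n//.
  by rewrite ler_nat ltnS leq_addr.
have hen : en R (n + i) `^ (p0^-1 - p1^-1) =
    expR (- ((p0^-1 - p1^-1) / 2)) ^+ i * expR (- ((p0^-1 - p1^-1) / 2 * i%:R)) * en R n `^ (p0^-1 - p1^-1).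
  rewrite !en_powR -expRM_natr -!expRD; congr expR; rewrite natrD.
  by move: (p0^-1 - p1^-1) => x; field.
have jg : i.+1%:R * (1 + i%:R) `^ (1 - beta) <= K * expR ((p0^-1 - p1^-1) / 2 * i%:R).
  apply: le_trans hexp; rewrite [leRHS]powRD; last by apply/implyP => _; rewrite gt_eqF// ltr_pwDl.
  by rewrite [X in _ <= X * _]powRr1 ?nat1r.
have hQ := quotient_bound C0 K0 (powR_ge0 _ _) hell phi0 phi1 hphi t0 t1 htail jg.
rewrite /rs /rho hen; move: hQ.
move: (_ * fundamental_ell E0 (en R (n + i)) / _) => Q.
move: (_ * fundamental_ell E0 (en R n) / _) => Q' hQ.
have := powR_ge0 (en R n) (p0^-1 - p1^-1); move: (en R n `^ _) => e e0.
set q := expR (- (_ / 2)).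
apply: (@le_trans _ _ (q ^+ i * expR (- ((p0^-1 - p1^-1) / 2 * i%:R)) * e *
   (C * K * expR ((p0^-1 - p1^-1) / 2 * i%:R) * Q'))).
  by rewrite ler_wpM2l// !mulr_ge0 ?exprn_ge0 ?expR_ge0.
rewrite expRN; have := expR_gt0 ((p0^-1 - p1^-1) / 2 * i%:R).
move: (expR _) (q ^+ i) => x y x0; rewrite le_eqVlt; apply/orP; left; apply/eqP.
by field; rewrite gt_eqF.
Qed.

Lemma extend1_ratio (K : R) : 0 < K -> exists2 C : R, 0 < C & forall x y, 0 < x -> 0 < y ->
  x <= K * y -> y <= K * x -> extend1 b x <= C * extend1 b y.
Proof.
move=> K0; have [C C0 hC] := extend1_le hb (@ltr01 R).
exists (C * (K + K)) => [|x y x0 y0 xy yx]; first by rewrite mulr_gt0// addr_gt0.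
have q1 : (y / x) `^ 1 <= K by rewrite powRr1 ?ler_pdivrMr// divr_ge0 ?ltW.
have q2 : (x / y) `^ 1 <= K by rewrite powRr1 ?ler_pdivrMr// divr_ge0 ?ltW.
have ey := extend1_gt0 hb y0.
by rewrite -mulrA; apply: (le_trans (hC _ _ x0 y0)); rewrite ler_pM2l// ler_pM2r// lerD.
Qed.

Lemma coarse_b_rho : coarse (extend1 b \o rh).
Proof.
split=> [t t01|D]; first by apply: extend1_gt0 => //; exact: rho_gt0.
have [r0 /(_ D)[K K0 hK]] := coarse_rho.
have [C C0 hC] := extend1_ratio K0; exists C => // s t t0 ts s1 r.
have [h1 h2] := hK s t t0 ts s1 r.
have s01 : 0 < rh s by apply: r0; rewrite (lt_le_trans t0 ts).
have t01 : 0 < rh t by apply: r0; rewrite t0 (le_trans ts).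
split; first exact: (hC _ _ s01 t01 h1 h2).
exact: (hC _ _ t01 s01 h2 h1).
Qed.

(** Here z stands for y/x. Potter's bound with exponent eta/2 costs z^(eta/2) + z^(-eta/2); times
    z^eta this leaves the exponents 3 eta/2 and eta/2, both positive, hence the rate r^(eta/2). *)
Lemma power_decay (C r eta : R) : 0 < C -> 0 < r < 1 -> 0 < eta ->
  exists C' r' : R, [/\ 0 < C', 0 < r' < 1 & forall (z : R) i, 0 < z -> z <= C * r ^+ i ->
    z `^ eta * (z `^ (eta / 2) + (z^-1) `^ (eta / 2)) <= C' * r' ^+ i].
Proof.
move=> C0 /andP[r0 r1] e0; have e20 : 0 < eta / 2 by exact: divr_gt0.
pose e3 := eta + eta / 2; have e30 : 0 < e3 by exact: addr_gt0.
have r'1 : r `^ (eta / 2) < 1.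
  by rewrite /powR gt_eqF// -[ltRHS]expR0 ltr_expR pmulr_rlt0// ln_lt0// r0.
exists (C `^ e3 + C `^ (eta / 2)), (r `^ (eta / 2)); split.
- by rewrite addr_gt0 ?powR_gt0.
- by rewrite powR_gt0.
move=> z i z0 zC; have ri : 0 < r ^+ i by exact: exprn_gt0.
have pe (e : R) : 0 < e -> z `^ e <= C `^ e * (r ^+ i) `^ e.
  move=> e'; rewrite -powRM ?(ltW C0) ?(ltW ri)//; apply: ge0_ler_powR => //.
  - exact: ltW.
  - by rewrite nnegrE ltW.
  - by rewrite nnegrE mulr_ge0 ?ltW.
have zz : z `^ eta * (z `^ (eta / 2) + z^-1 `^ (eta / 2)) = z `^ e3 + z `^ (eta / 2).
  rewrite mulrDr -powRD; last by apply/implyP => _; rewrite gt_eqF.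
  congr (_ + _); rewrite /powR !gt_eqF ?invr_gt0// -expRD lnV ?posrE//; congr expR.
  by field.
rewrite zz mulrDl; have -> : (r `^ (eta / 2)) ^+ i = (r ^+ i) `^ (eta / 2).
  rewrite /powR !gt_eqF// lnXn// -expRM_natr; congr expR.
  by rewrite -[ln r *+ i]mulr_natr mulrA.
apply: lerD; last exact: pe.
apply: (le_trans (pe _ e30)); rewrite ler_wpM2l ?powR_ge0//.
rewrite /powR gt_eqF// ler_expR; have : ln (r ^+ i) <= 0 by rewrite ln_le0// exprn_ile1// ltW.
by move=> l0; rewrite /e3 mulrDl gerDr mulr_ge0_le0// ltW.
Qed.

Lemma negative_power_decay (C r theta : R) : 0 < C -> 0 < r < 1 -> 0 < theta ->
  exists C' r' : R, [/\ 0 < C', 0 < r' < 1 & forall x y i, 0 < x -> 0 < y ->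
    y <= C * r ^+ i * x ->
    x `^ (- theta) * extend1 b x <= C' * (r' ^+ i * (y `^ (- theta) * extend1 b y))].
Proof.
move=> C0 r01 th0.
have [C' [r' [C'0 r'01 hr']]] := power_decay C0 r01 th0.
have t20 : 0 < theta / 2 by exact: divr_gt0.
have [B B0 hB] := extend1_le hb t20.
exists (B * C'), r'; split; [exact: mulr_gt0|by []|move=> x y i x0 y0 hxy].
have hbx := hB _ _ x0 y0; have by0 := extend1_gt0 hb y0; have bx0 := extend1_gt0 hb x0.
have z0 : 0 < y / x by exact: divr_gt0.
have := hr' (y / x) i z0; rewrite ler_pdivrMr// => /(_ hxy); rewrite invf_div => hz.
have e : x `^ (- theta) = y `^ (- theta) * (y / x) `^ theta.
  rewrite powR_div// !powRN mulrA mulVf ?mul1r// gt_eqF//; exact: powR_gt0.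
apply: (@le_trans _ _ (y `^ (- theta) * (y / x) `^ theta *
    (B * (((y / x) `^ (theta / 2) + (x / y) `^ (theta / 2)) * extend1 b y)))).
  by rewrite e ler_wpM2l// mulr_ge0// powR_ge0.
move: hz by0; move: (_ + _) (extend1 b y) ((y / x) `^ theta) => S v z hz v0.
have := powR_ge0 y (- theta); move: (y `^ (- theta)) => w w0.
have -> : w * z * (B * (S * v)) = B * (w * v) * (z * S) by ring.
have -> : B * C' * (r' ^+ i * (w * v)) = B * (w * v) * (C' * r' ^+ i) by ring.
by rewrite ler_wpM2l// !mulr_ge0// ltW.
Qed.

Lemma positive_power_decay (C r eta : R) : 0 < C -> 0 < r < 1 -> 0 < eta ->
  exists C' r' : R, [/\ 0 < C', 0 < r' < 1 & forall x y i, 0 < x -> 0 < y ->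
    y <= C * r ^+ i * x ->
    y `^ eta * extend1 b y <= C' * (r' ^+ i * (x `^ eta * extend1 b x))].
Proof.
move=> C0 r01 th0.
have [C' [r' [C'0 r'01 hr']]] := power_decay C0 r01 th0.
have t20 : 0 < eta / 2 by exact: divr_gt0.
have [B B0 hB] := extend1_le hb t20.
exists (B * C'), r'; split; [exact: mulr_gt0|by []|move=> x y i x0 y0 hxy].
have hby := hB _ _ y0 x0; have by0 := extend1_gt0 hb y0; have bx0 := extend1_gt0 hb x0.
have z0 : 0 < y / x by exact: divr_gt0.
have := hr' (y / x) i z0; rewrite ler_pdivrMr// => /(_ hxy); rewrite invf_div => hz.
have e : y `^ eta = x `^ eta * (y / x) `^ eta.
  rewrite powR_div// mulrCA divff ?mulr1// gt_eqF//; exact: powR_gt0.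
apply: (@le_trans _ _ (x `^ eta * (y / x) `^ eta *
    (B * (((x / y) `^ (eta / 2) + (y / x) `^ (eta / 2)) * extend1 b x)))).
  by rewrite e ler_wpM2l// mulr_ge0// powR_ge0.
rewrite [_ + _]addrC.
move: hz bx0; move: (_ + _) (extend1 b x) ((y / x) `^ eta) => S v z hz v0.
have := powR_ge0 x eta; move: (x `^ eta) => w w0.
have -> : w * z * (B * (S * v)) = B * (w * v) * (z * S) by ring.
have -> : B * C' * (r' ^+ i * (w * v)) = B * (w * v) * (C' * r' ^+ i) by ring.
by rewrite ler_wpM2l// !mulr_ge0// ltW.
Qed.

Lemma rs_negative_decay (theta : R) : 0 < theta -> exists C r : R, [/\ 0 < C, 0 < r < 1 &
  forall n i, rs n `^ (- theta) * extend1 b (rs n) <=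
    C * (r ^+ i * (rs (n + i) `^ (- theta) * extend1 b (rs (n + i))))].
Proof.
move=> th0; have [C [r [C0 r01 hr]]] := rs_decay.
have [C' [r' [C'0 r'01 h]]] := negative_power_decay C0 r01 th0.
exists C', r'; split => // n i; exact: h (rs_gt0 n) (rs_gt0 (n + i)) (hr n i).
Qed.

Lemma rs_positive_decay (eta : R) : 0 < eta -> exists C r : R, [/\ 0 < C, 0 < r < 1 &
  forall n i, rs (n + i) `^ eta * extend1 b (rs (n + i)) <=
    C * (r ^+ i * (rs n `^ eta * extend1 b (rs n)))].
Proof.
move=> th0; have [C [r [C0 r01 hr]]] := rs_decay.
have [C' [r' [C'0 r'01 h]]] := positive_power_decay C0 r01 th0.
exists C', r'; split => // n i; exact: h (rs_gt0 n) (rs_gt0 (n + i)) (hr n i).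
Qed.

Lemma rs_step : exists2 C : R, 0 < C & forall n, rs n <= C * rs n.+1 /\ rs n.+1 <= C * rs n.
Proof.
have [C C0 h] := coarse_block 1 coarse_rho; exists C => // n.
by apply: (h n n.+1 _ _ (leqnSn n) _ (en_block R n) (en_block R n.+1)); rewrite addn1.
Qed.

End Rho.

(** * Discrete Holmstedt formula *)

Section SequenceNormConstants.
Variable R : realType.
Implicit Types (a c : nat -> \bar R) (E : ri_space R) (x y z : \bar R) (n m k i j : nat).

Lemma mule_unbounded y z : (0 < y)%E ->
  (forall M : R, 0 < M -> (M%:E * y <= z)%E) -> z = +oo%E.
Proof.
move=> y0 h; apply/eqyP => A A0.
case: y y0 h => [y|_ h|//]; last first.
  by apply: le_trans (h 1 ltr01); rewrite mul1e leey.
rewrite lte_fin => y0 h; apply: le_trans (h (A / y) _); last exact: divr_gt0.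
by rewrite -EFinM divfK// gt_eqF.
Qed.

(** Homogeneity covers real factors only. An infinite x is approached by real factors M, and
    positivity of the norm of [c] then forces the norm of [a] to be infinite. *)
Lemma nseq_cst_le E c a x : (forall n, 0 <= c n)%E -> (0 < nseq E c)%E -> (0 <= x)%E ->
  (forall n, c n * x <= a n)%E -> (nseq E c * x <= nseq E a)%E.
Proof.
move=> c0 N0 x0 h.
have key (M : R) : 0 <= M -> (M%:E <= x)%E -> (M%:E * nseq E c <= nseq E a)%E.
  move=> M0 Mx; rewrite -(nseqZ E M0 c0); apply: nseq_le; first exact: ri_monotone.
    by move=> n; rewrite mule_ge0.
  by move=> n; apply: le_trans (h n); rewrite muleC lee_wpmul2l.
move: N0 key; move: (nseq E c) (nseq E a) => y z y0 key.
case: x x0 h key => [r r0 h key|_ h key|//].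
  by rewrite muleC; apply: key.
rewrite (@mule_unbounded y z) ?leey// => M M0.
by apply: key; [exact: ltW|rewrite leey].
Qed.

Lemma nseq_cst_ge E c x : (forall n, 0 <= c n)%E -> (0 < nseq E c)%E -> (0 <= x)%E ->
  (nseq E (fun n => c n * x) <= nseq E c * x)%E.
Proof.
move=> c0 N0; case: x => [r|_|//]; last by rewrite gt0_muley// leey.
rewrite lee_fin => r0; rewrite muleC -(nseqZ E r0 c0); apply: nseq_le.
- exact: ri_monotone.
- by move=> n; rewrite mule_ge0.
- by move=> n; rewrite muleC.
Qed.

Lemma window_gt0 E n : (0 < window E n.+1)%E.
Proof. by rewrite -fundamental_nat fundamental_gt0. Qed.

Lemma nseq_point E k x : (0 <= x)%E ->
  (nseq E (fun n => if n == k then x else 0) <= window E 1 * x)%E.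
Proof.
move=> x0; pose c n : \bar R := (if (n < 1)%N then 1 else 0)%E.
have c0 n : (0 <= c n)%E by rewrite /c; case: ifP.
apply: le_trans (nseq_cst_ge c0 (window_gt0 E 0) x0).
apply: (@nseq_inj _ _ _ _ (subn^~ k)).
- by move=> n; case: ifP.
- by move=> n; rewrite mule_ge0.
- by move=> n; case: eqP => [-> _|_]; rewrite ?ltxx// subnn /c mul1e.
- by move=> n m; case: eqP => [->|_]; rewrite ?ltxx//; case: eqP => [->|_]; rewrite ?ltxx.
Qed.

(** A crude l_1 bound. It suffices for the cross estimates and the discrete Hardy inequalities,
    where the resulting sums are controlled by geometric weights. *)
Lemma nseq_le_sum E a : (forall n, 0 <= a n)%E ->
  (nseq E a <= \sum_(k <oo) window E 1 * a k)%E.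
Proof.
move=> a0; pose A k n : \bar R := if n == k then a k else 0%E.
have A0 k n : (0 <= A k n)%E by rewrite /A; case: ifP.
apply: (@le_trans _ _ (nseq E (fun n => \sum_(k <oo) A k n)%E)).
  apply: nseq_le => //; first exact: ri_monotone.
  move=> n; rewrite (@nneseriesD1 _ _ n)// {1}/A eqxx leeDl//.
  exact: nneseries_ge0.
apply: le_trans (nseq_series E A0) _; apply: lee_nneseries => k _; first by move=> _; exact: nseq_ge0.
exact: nseq_point.
Qed.

Lemma tail_series n (f : nat -> \bar R) : (forall k, 0 <= f k)%E ->
  (\sum_(k <oo) (if (n <= k)%N then f k else 0) = \sum_(i <oo) f (n + i)%N)%E.
Proof.
move=> f0; rewrite (@nneseries_split _ _ 0 n)//; last by move=> k _; case: ifP.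
rewrite add0n big1_seq ?add0e; last first.
  by move=> k /andP[_]; rewrite mem_index_iota => /andP[_ kn]; rewrite leqNgt kn.
rewrite -nneseries_addn; last by move=> k; case: ifP.
by apply: eq_eseriesr => k _; rewrite leq_addl addnC.
Qed.

Lemma head_series n (f : nat -> \bar R) : (forall k, 0 <= f k)%E ->
  (\sum_(k <oo) (if (k <= n)%N then f k else 0) = \sum_(k < n.+1) f k)%E.
Proof.
move=> f0; rewrite (@nneseries_split _ _ 0 n.+1)//; last by move=> k _; case: ifP.
rewrite add0n eseries0 ?adde0; last by move=> k nk _; rewrite leqNgt nk.
by rewrite big_mkord; apply: eq_bigr => -[k kn] _ /=; rewrite -ltnS kn.
Qed.

End SequenceNormConstants.

(* In the application s, om, d, phi, tau and rho are the values at u = e^-n of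
   u^(1/p0) ell^(alpha-1)(u), u^(1/p1), ell^(beta-1)(u), phi_E0(ell(u)),
   the tail norm of ell^(beta-1) in E1, and rho(u). *)
Record admissible (R : realType) (E0 E1 : ri_space R)
    (s om d phi tau rho : nat -> R) (D r : R) : Prop := Admissible {
  adm_s0 : forall n, 0 < s n ;
  adm_om0 : forall n, 0 < om n ;
  adm_d0 : forall n, 0 < d n ;
  adm_tau0 : forall n, 0 < tau n ;
  adm_rho0 : forall n, 0 < rho n ;
  adm_D0 : 0 < D ;
  adm_r01 : 0 < r < 1 ;
  adm_s_step : forall n, s n <= D * s n.+1 ;
  adm_om_step : forall n, om n <= D * om n.+1 ;
  adm_d_step : forall n, d n <= D * d n.+1 ;
  adm_tau_step : forall n, tau n <= D * tau n.+1 ;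
  adm_rho_step : forall n, rho n <= D * rho n.+1 ;
  adm_phiE : forall n, (phi n)%:E = window E0 n.+1 ;
  adm_phi_nd : forall n m, (n <= m)%N -> phi n <= phi m ;
  adm_tau_le : forall n,
    ((tau n)%:E <= D%:E * nseq E1 (fun k => (d k)%:E * (if (n <= k)%N then 1 else 0)))%E ;
  adm_tau_ge : forall n,
    (nseq E1 (fun k => (d k)%:E * (if (n <= k)%N then 1 else 0)) <= D%:E * (tau n)%:E)%E ;
  adm_d_tau : forall n, d n <= D * tau n ;
  adm_tau_ni : forall n m, (n <= m)%N -> tau m <= D * tau n ;
  adm_om_decay : forall n i, om (n + i)%N <= D * r ^+ i * om n ;
  adm_rho_decay : forall n i, rho (n + i)%N <= D * r ^+ i * rho n ;
  adm_rhoE : forall n, rho n * (tau n * om n) = phi n * s n }.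

Section DiscreteHolmstedt.
Variable R : realType.
Variables (E0 E1 : ri_space R) (s om d phi tau rho : nat -> R) (D r : R).
Hypothesis adm : admissible E0 E1 s om d phi tau rho D r.
Let s0 := adm_s0 adm.
Let om0 := adm_om0 adm.
Let d0 := adm_d0 adm.
Let tau0 := adm_tau0 adm.
Let rho0 := adm_rho0 adm.
Let D0 := adm_D0 adm.
Let r01 := adm_r01 adm.
Let s_step := adm_s_step adm.
Let om_step := adm_om_step adm.
Let d_step := adm_d_step adm.
Let tau_step := adm_tau_step adm.
Let rho_step := adm_rho_step adm.
Let phiE := adm_phiE adm.
Let phi_nd := adm_phi_nd adm.
Let tau_le := adm_tau_le adm.
Let tau_ge := adm_tau_ge adm.
Let d_tau := adm_d_tau adm.
Let tau_ni := adm_tau_ni adm.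
Let om_decay := adm_om_decay adm.
Let rho_decay := adm_rho_decay adm.
Let rhoE := adm_rhoE adm.

Implicit Types (a c : nat -> \bar R) (x y z : \bar R) (n m k i j : nat).

Definition normB a := nseq E0 (Sseq s a).
Definition normA a := nseq E1 (fun k => (d k)%:E * Tseq om a k)%E.

Definition P0a a n := nseq E0 (fun k => if (n <= k)%N then Sseq s a k else 0)%E.
Definition P0 a n := (P0a a n + (phi n)%:E * Sseq s a n)%E.
Definition P1a a n := nseq E1 (fun k => (d k)%:E * (if (k <= n)%N then Tseq om a k else 0))%E.
Definition P1 a n := ((tau n)%:E * Tseq om a n + P1a a n)%E.

Let s0' n : 0 <= s n. Proof. exact: ltW. Qed.
Let om0' n : 0 <= om n. Proof. exact: ltW. Qed.
Let d0' n : 0 <= d n. Proof. exact: ltW. Qed.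
Let tau0' n : 0 <= tau n. Proof. exact: ltW. Qed.
Let rho0' n : 0 <= rho n. Proof. exact: ltW. Qed.
Let D0' : 0 <= D. Proof. exact: ltW. Qed.
Let r0' : 0 <= r. Proof. by case/andP: r01 => /ltW. Qed.
Let r1' : 0 <= r < 1. Proof. by case/andP: r01 => /ltW -> ->. Qed.

Lemma phi_gt0 n : 0 < phi n.
Proof. by rewrite -lte_fin phiE window_gt0. Qed.

Let phi0' n : 0 <= phi n. Proof. exact: ltW (phi_gt0 n). Qed.

Let K : R := (1 - r)^-1.
Let K0 : 0 <= K. Proof. by rewrite /K invr_ge0 subr_ge0 ltW//; case/andP: r01. Qed.
Let ri k : 0 <= r ^+ k. Proof. exact: exprn_ge0. Qed.

Section OneSequence.
Variable a : nat -> \bar R.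
Hypothesis a0 : forall n, (0 <= a n)%E.
Notation S := (Sseq s a).
Notation T := (Tseq om a).

Let S0 n : (0 <= S n)%E. Proof. exact: Sseq_ge0. Qed.
Let T0 n : (0 <= T n)%E. Proof. exact: Tseq_ge0. Qed.

Lemma Sseq_ni n m : (n <= m)%N -> (S m <= S n)%E.
Proof. by move=> nm; apply: Sseq_le => k mk; apply: Sseq_ge; exact: leq_trans mk. Qed.

Lemma normB_ge0 : (0 <= normB a)%E. Proof. exact: nseq_ge0. Qed.
Lemma normA_ge0 : (0 <= normA a)%E. Proof. exact: nseq_ge0. Qed.

Lemma P0a_ge0 n : (0 <= P0a a n)%E. Proof. exact: nseq_ge0. Qed.
Lemma P1a_ge0 n : (0 <= P1a a n)%E. Proof. exact: nseq_ge0. Qed.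

(** S is non-increasing, so it is at least S_n on the first n + 1 indices, and phi_n is the norm of
    their indicator. *)
Lemma phi_Sseq_le n : ((phi n)%:E * S n <= normB a)%E.
Proof.
rewrite phiE; apply: nseq_cst_le => //.
- by move=> k; case: ifP.
- exact: window_gt0.
- by move=> k; case: ifP => kn; [rewrite mul1e; exact: Sseq_ni|rewrite mul0e].
Qed.

Lemma P0_le_normB n : (P0 a n <= 2%:E * normB a)%E.
Proof.
rewrite (_ : 2%:E = 1%E + 1%E)%E// ge0_muleDl// !mul1e; apply: leeD.
  apply: nseq_le; first exact: ri_monotone.
    by move=> k; case: ifP.
  by move=> k; case: ifP.
exact: phi_Sseq_le.
Qed.

Let tw0 n k : (0 <= (d k)%:E * (if (n <= k)%N then 1 else 0) :> \bar R)%E.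
Proof. by rewrite mule_ge0 ?lee_fin//; case: ifP. Qed.

Let tw_gt0 n : (0 < nseq E1 (fun k => (d k)%:E * (if (n <= k)%N then 1 else 0)))%E.
Proof.
rewrite -(@pmule_rgt0 _ D%:E) ?lte_fin//.
by apply: lt_le_trans (tau_le n); rewrite lte_fin.
Qed.

(** Dually, T is non-decreasing, so it is at least T_n on the indices k >= n, over which d has norm
    comparable to tau_n. *)
Lemma tau_Tseq_le n : ((tau n)%:E * T n <= D%:E * normA a)%E.
Proof.
apply: (@le_trans _ _ (D%:E * nseq E1 (fun k => (d k)%:E * (if (n <= k)%N then 1 else 0)) * T n)%E).
  by apply: lee_wpmul2r.
rewrite -muleA; apply: lee_wpmul2l; first by rewrite lee_fin.
apply: nseq_cst_le => // k; rewrite -muleA; apply: lee_wpmul2l; first by rewrite lee_fin.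
by case: ifP => nk; [rewrite mul1e; exact: Tseq_nd|rewrite mul0e].
Qed.

Lemma P1_le_normA n : (P1 a n <= (D + 1)%:E * normA a)%E.
Proof.
rewrite EFinD ge0_muleDl ?lee_fin// mul1e; apply: leeD; first exact: tau_Tseq_le.
apply: nseq_le; first exact: ri_monotone.
  by move=> k; rewrite mule_ge0 ?lee_fin//; case: ifP.
by move=> k; apply: lee_wpmul2l; [rewrite lee_fin|case: ifP].
Qed.

(** [gseq] and [hseq] are the contributions of the single entry a_n to P0 and to P1. By the choice
    of rho they differ by the factor rho_n, which links the two halves of the formula. *)
Definition gseq n : \bar R := ((phi n * s n)%:E * a n)%E.
Definition hseq n : \bar R := ((tau n * om n)%:E * a n)%E.

Lemma gseq_ge0 n : (0 <= gseq n)%E.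
Proof. by rewrite mule_ge0 ?lee_fin ?mulr_ge0. Qed.

Lemma hseq_ge0 n : (0 <= hseq n)%E.
Proof. by rewrite mule_ge0 ?lee_fin ?mulr_ge0. Qed.

Lemma gseqE n : gseq n = ((rho n)%:E * hseq n)%E.
Proof. by rewrite /gseq /hseq muleA -EFinM rhoE. Qed.

Lemma gseq_le_normB n : (gseq n <= normB a)%E.
Proof.
apply: le_trans (phi_Sseq_le n); rewrite /gseq EFinM -muleA.
by apply: lee_wpmul2l; [rewrite lee_fin|exact: Sseq_ge].
Qed.

Lemma hseq_le_Tseq n : (hseq n <= (tau n)%:E * T n)%E.
Proof.
rewrite /hseq EFinM -muleA; apply: lee_wpmul2l; first by rewrite lee_fin.
by rewrite /Tseq big_ord_recr/= leeDr// sume_ge0// => k _; rewrite mule_ge0 ?lee_fin.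
Qed.

Lemma gseq_le_normA n : (gseq n <= (rho n * D)%:E * normA a)%E.
Proof.
rewrite gseqE EFinM -muleA; apply: lee_wpmul2l; first by rewrite lee_fin.
exact: le_trans (hseq_le_Tseq n) (tau_Tseq_le n).
Qed.

(** A supremum is at most the sum of its terms, and monotonicity of phi allows phi_m to be replaced
    by phi_k for k >= n >= m. *)
Lemma phi_Sseq_series n m : (m <= n)%N -> ((phi m)%:E * S n <= \sum_(i <oo) gseq (n + i))%E.
Proof.
move=> mn; have p0 := phi_gt0 m.
rewrite muleC -lee_pdivlMr//; apply: Sseq_le => k nk.
rewrite lee_pdivlMr//; apply: (@le_trans _ _ (gseq k)).
  rewrite muleC muleA -EFinM.
  by rewrite lee_wpmul2r// lee_fin ler_wpM2r// phi_nd// (leq_trans mn).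
rewrite -[in leLHS](subnKC nk); set i := (k - n)%N.
rewrite (@nneseriesD1 _ (fun i => gseq (n + i)) i)//=; last by move=> j _; exact: gseq_ge0.
by rewrite leeDl// nneseries_ge0// => j _ _; exact: gseq_ge0.
Qed.

Lemma P0_le n : (P0 a n <= \sum_(i <oo) \sum_(j <oo) gseq (n + i + j) + \sum_(i <oo) gseq (n + i))%E.
Proof.
apply: leeD; last exact: phi_Sseq_series.
have S0' k : (0 <= if (n <= k)%N then S k else 0)%E by case: ifP.
apply: le_trans (nseq_le_sum E0 S0') _.
(* The constant of the l_1 bound is the norm of one unit entry, that is phi_0; the preceding lemma
   with m = 0 then bounds phi_0 S_(n+i). *)
rewrite -phiE; apply: (@le_trans _ _ (\sum_(k <oo) if (n <= k)%N then (phi 0)%:E * S k else 0)%E).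
  apply: lee_nneseries => k _; first by move=> _; rewrite mule_ge0 ?lee_fin.
  by case: ifP => // _; rewrite mule0.
rewrite tail_series; last by move=> k; rewrite mule_ge0 ?lee_fin.
apply: lee_nneseries => i _; first by move=> _; rewrite mule_ge0 ?lee_fin.
exact: phi_Sseq_series.
Qed.

Lemma tau_Tseq_sum n : ((tau n)%:E * T n <= D%:E * \sum_(j < n.+1) hseq j)%E.
Proof.
rewrite /Tseq !ge0_sume_distrr; last 2 first.
- by move=> j _; exact: hseq_ge0.
- by move=> j _; rewrite mule_ge0 ?lee_fin.
apply: lee_sum => j _; rewrite /hseq !muleA -!EFinM lee_wpmul2r// lee_fin mulrA.
by rewrite ler_wpM2r// tau_ni// -ltnS.
Qed.

Definition w1 : R := fine (window E1 1).

Lemma w1E : window E1 1 = w1%:E.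
Proof.
rewrite /w1 fineK// ge0_fin_numE ?nseq_ge0// -fundamental_nat.
exact: fundamental_lty.
Qed.

Lemma w1_gt0 : 0 < w1.
Proof. by rewrite -lte_fin -w1E window_gt0. Qed.

Lemma P1_le n : (P1 a n <= D%:E * \sum_(j < n.+1) hseq j +
  (w1 * (D * D))%:E * \sum_(k < n.+1) \sum_(j < k.+1) hseq j)%E.
Proof.
apply: leeD; first exact: tau_Tseq_sum.
have T0' k : (0 <= (d k)%:E * (if (k <= n)%N then T k else 0))%E.
  by rewrite mule_ge0 ?lee_fin//; case: ifP.
have w10 := ltW w1_gt0.
have wDD : (0 <= (w1 * (D * D))%:E)%E by rewrite lee_fin !mulr_ge0.
have h0 k : (0 <= \sum_(j < k.+1) hseq j)%E by apply: sume_ge0 => j _; exact: hseq_ge0.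
apply: le_trans (nseq_le_sum E1 T0') _; rewrite w1E.
apply: (@le_trans _ _ (\sum_(k <oo) if (k <= n)%N then (w1 * (D * D))%:E * (\sum_(j < k.+1) hseq j) else 0)%E).
  apply: lee_nneseries => k _; first by move=> _; rewrite mule_ge0 ?lee_fin.
  case: ifP => _; last by rewrite !mule0.
  rewrite (EFinM w1) -[leRHS]muleA; apply: lee_wpmul2l; first by rewrite lee_fin.
  apply: (@le_trans _ _ ((D * tau k)%:E * T k)%E); first by rewrite lee_wpmul2r// lee_fin.
  rewrite (EFinM D D) (EFinM D (tau k)) -!muleA; apply: lee_wpmul2l; first by rewrite lee_fin.
  exact: tau_Tseq_sum.
rewrite head_series; last by move=> k; rewrite mule_ge0.
by rewrite ge0_sume_distrr.
Qed.

(** When the terms are dominated by a geometrically decaying v, each of the nested tail sums of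
    [P0_le] costs a factor K C over its first bound. *)
Lemma P0_le_weight (v : nat -> R) (C : R) x n : (forall k, 0 <= v k) -> 0 <= C ->
  (forall k i, v (k + i)%N <= C * r ^+ i * v k) -> (0 <= x)%E ->
  (forall k, gseq k <= (v k)%:E * x)%E ->
  (P0 a n <= (K * C * (K * C) + K * C)%:E * ((v n)%:E * x))%E.
Proof.
move=> v0 C0 vd x0 gv; have vx0 k : (0 <= (v k)%:E * x)%E by rewrite mule_ge0 ?lee_fin.
have KC0 : 0 <= K * C by exact: mulr_ge0.
have inner k : (\sum_(i <oo) gseq (k + i) <= (K * C)%:E * ((v k)%:E * x))%E.
  rewrite (EFinM K C) -muleA; apply: lee_geometric_sum => //.
  - by rewrite mule_ge0 ?lee_fin.
  - by move=> i; exact: gseq_ge0.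
  - move=> i; apply: le_trans (gv _) _; rewrite !muleA -!EFinM lee_wpmul2r// lee_fin.
    by rewrite [r ^+ i * C]mulrC; exact: vd.
apply: le_trans (P0_le n) _; rewrite EFinD ge0_muleDl ?lee_fin ?mulr_ge0//.
apply: leeD; last exact: inner.
rewrite (EFinM (K * C)) -muleA (EFinM K C) -muleA; apply: lee_geometric_sum => //.
- by rewrite !mule_ge0 ?lee_fin ?mulr_ge0.
- by move=> i; apply: nneseries_ge0 => j _ _; exact: gseq_ge0.
- move=> i; apply: le_trans (inner _) _; rewrite !muleA -!EFinM lee_wpmul2r// lee_fin.
  apply: (@le_trans _ _ (K * C * (C * r ^+ i * v n))); first by rewrite ler_wpM2l.
  by rewrite le_eqVlt; apply/orP; left; apply/eqP; ring.
Qed.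

Lemma lee_geometric_head (x : nat -> \bar R) M n : (0 <= M)%E ->
  (forall j, (j <= n)%N -> x j <= (r ^+ (n - j))%:E * M)%E ->
  (\sum_(j < n.+1) x j <= K%:E * M)%E.
Proof.
move=> M0 xM; apply: (@le_trans _ _ (\sum_(j < n.+1) (r ^+ j)%:E * M)%E).
  rewrite (reindex_inj rev_ord_inj)/=; apply: lee_sum => -[j /= jn] _.
  by rewrite subSS; apply: le_trans (xM _ _) _; rewrite ?leq_subr// subKn// -ltnS.
rewrite -(big_mkord predT (fun j => (r ^+ j)%:E * M)%E).
have rM0 j : (0 <= (r ^+ j)%:E * M)%E by rewrite mule_ge0 ?lee_fin.
apply: (@le_trans _ _ (\sum_(j <oo) (r ^+ j)%:E * M)%E); first exact: nneseries_lim_ge.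
exact: lee_geometric_sum.
Qed.

Lemma P1_le_weight (v : nat -> R) (C : R) x n : (forall k, 0 <= v k) -> 0 <= C ->
  (forall k i, v k <= C * r ^+ i * v (k + i)%N) -> (0 <= x)%E ->
  (forall k, hseq k <= (v k)%:E * x)%E ->
  (P1 a n <= (D * (K * C) + w1 * (D * D) * (K * C * (K * C)))%:E * ((v n)%:E * x))%E.
Proof.
move=> v0 C0 vd x0 hv; have vx0 k : (0 <= (v k)%:E * x)%E by rewrite mule_ge0 ?lee_fin.
have KC0 : 0 <= K * C by exact: mulr_ge0.
have w10 := ltW w1_gt0.
have vj j m : (j <= m)%N -> v j <= C * r ^+ (m - j) * v m.
  by move=> jm; rewrite -[X in _ * v X](subnKC jm); exact: vd.
have inner m : (\sum_(j < m.+1) hseq j <= (K * C)%:E * ((v m)%:E * x))%E.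
  rewrite (EFinM K C) -muleA; apply: lee_geometric_head => [|j jm].
    by rewrite mule_ge0 ?lee_fin.
  apply: le_trans (hv _) _; rewrite !muleA -!EFinM lee_wpmul2r// lee_fin.
  by rewrite [r ^+ _ * C]mulrC; exact: vj.
have wD0 : 0 <= w1 * (D * D) by rewrite !mulr_ge0.
apply: le_trans (P1_le n) _; rewrite EFinD ge0_muleDl ?lee_fin ?mulr_ge0//.
apply: leeD.
  by rewrite (EFinM D) -muleA; apply: lee_wpmul2l; [rewrite lee_fin|exact: inner].
rewrite (EFinM (w1 * _)) -muleA; apply: lee_wpmul2l; first by rewrite lee_fin.
rewrite (EFinM (K * C)) -muleA (EFinM K C) -muleA.
apply: (@lee_geometric_head (fun k => \sum_(j < k.+1) hseq j)%E) => [|j jn].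
  by rewrite !mule_ge0 ?lee_fin ?mulr_ge0.
apply: le_trans (inner _) _; rewrite !muleA -!EFinM lee_wpmul2r// lee_fin.
apply: (@le_trans _ _ (K * C * (C * r ^+ (n - j) * v n))); first by rewrite ler_wpM2l// vj.
by rewrite le_eqVlt; apply/orP; left; apply/eqP; ring.
Qed.

End OneSequence.

(** Cross estimate: g_k is at most D rho_k times the A norm, and rho decays geometrically. It
    controls P0 of the summand that lies in the A space. *)
Lemma P0_normA : exists2 C : R, 0 <= C & forall a n, (forall k, 0 <= a k)%E ->
  (P0 a n <= C%:E * ((rho n)%:E * normA a))%E.
Proof.
pose C := K * D * (K * D) + K * D; have C0 : 0 <= C by rewrite addr_ge0 ?mulr_ge0.
exists (C * D) => [|a n a0]; first exact: mulr_ge0.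
have x0 : (0 <= D%:E * normA a)%E by rewrite mule_ge0 ?lee_fin// normA_ge0.
have := @P0_le_weight a a0 rho D (D%:E * normA a)%E n rho0' D0' rho_decay x0.
rewrite -/C => h; apply: le_trans (h _) _.
  by move=> k; rewrite muleA -EFinM; exact: gseq_le_normA.
rewrite (EFinM C D) -muleA; apply: lee_wpmul2l; first by rewrite lee_fin.
by rewrite muleCA.
Qed.

(** The mirror image: h_k = g_k / rho_k is at most the B norm divided by rho_k, and 1/rho_k grows
    geometrically, as the head sums in P1 require. *)
Lemma P1_normB : exists2 C : R, 0 <= C & forall a n, (forall k, 0 <= a k)%E ->
  (P1 a n <= C%:E * (((rho n)^-1)%:E * normB a))%E.
Proof.
pose C := D * (K * D) + w1 * (D * D) * (K * D * (K * D)).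
have w10 := ltW w1_gt0.
exists C => [|a n a0]; first by rewrite addr_ge0 ?mulr_ge0.
apply: (@P1_le_weight a a0 (fun k => (rho k)^-1) D) => //.
- by move=> k; rewrite invr_ge0.
- by move=> k i; rewrite ler_pdivlMr// mulrC ler_pdivrMr//; exact: rho_decay.
- exact: normB_ge0.
- move=> k; rewrite -(@lee_pmul2l _ (rho k)%:E) ?lte_fin// -gseqE muleA -EFinM.
  rewrite divff ?gt_eqF// mul1e; exact: gseq_le_normB.
Qed.

Section Splitting.
Variables a a0 a1 : nat -> \bar R.
Hypothesis a_ge0 : forall n, (0 <= a n)%E.
Hypothesis a0_ge0 : forall n, (0 <= a0 n)%E.
Hypothesis a1_ge0 : forall n, (0 <= a1 n)%E.
Hypothesis a01 : forall n, (a n <= a0 n.+1 + a1 n.+1)%E.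

Lemma Sseq_split n : (Sseq s a n <= D%:E * (Sseq s a0 n + Sseq s a1 n))%E.
Proof.
apply: Sseq_le => k nk.
apply: (@le_trans _ _ ((D * s k.+1)%:E * (a0 k.+1 + a1 k.+1))%E).
  by apply: lee_pmul; rewrite ?lee_fin.
rewrite EFinM -muleA; apply: lee_wpmul2l; first by rewrite lee_fin.
by rewrite ge0_muleDr//; apply: leeD; apply: Sseq_ge; exact: leqW.
Qed.

(** The splitting moves index k to k+1. A head sum then reaches n+1, whereas a tail supremum absorbs
    the move; this is why P1 of the summands is taken at n+1. *)
Lemma Tseq_split n : (Tseq om a n <= D%:E * (Tseq om a0 n.+1 + Tseq om a1 n.+1))%E.
Proof.
have sh c : (forall k, 0 <= c k)%E -> (\sum_(k < n.+1) (om k.+1)%:E * c k.+1 <= Tseq om c n.+1)%E.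
  by move=> c0; rewrite /Tseq [leRHS]big_ord_recl/= leeDr// mule_ge0 ?lee_fin.
apply: (@le_trans _ _ (D%:E * (\sum_(k < n.+1) (om k.+1)%:E * a0 k.+1 + \sum_(k < n.+1) (om k.+1)%:E * a1 k.+1))%E).
  rewrite -big_split/= ge0_sume_distrr; last first.
    by move=> k _; rewrite adde_ge0// mule_ge0 ?lee_fin.
  apply: lee_sum => k _; rewrite -ge0_muleDr// muleA -EFinM.
  by apply: lee_pmul; rewrite ?lee_fin.
by apply: lee_wpmul2l; [rewrite lee_fin|apply: leeD; exact: sh].
Qed.

Lemma P0_split n : (P0 a n <= D%:E * (P0 a0 n + P0 a1 n))%E.
Proof.
have S00 k : (0 <= Sseq s a0 k)%E by exact: Sseq_ge0.
have S10 k : (0 <= Sseq s a1 k)%E by exact: Sseq_ge0.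
have P00 k : (0 <= P0a a0 k)%E by exact: P0a_ge0.
have P10 k : (0 <= P0a a1 k)%E by exact: P0a_ge0.
have pS0 c k : (forall k, 0 <= c k)%E -> (0 <= (phi k)%:E * Sseq s c k)%E.
  by move=> c0; rewrite mule_ge0 ?lee_fin// Sseq_ge0.
rewrite [X in (_ * X)%E](_ : _ = (P0a a0 n + P0a a1 n) +
    ((phi n)%:E * Sseq s a0 n + (phi n)%:E * Sseq s a1 n))%E; last by rewrite /P0 addeACA.
rewrite ge0_muleDr ?adde_ge0 ?pS0//; apply: leeD; last first.
  rewrite -ge0_muleDr// muleCA; apply: lee_wpmul2l; first by rewrite lee_fin.
  exact: Sseq_split.
have ip (c : nat -> \bar R) k : (forall k, 0 <= c k)%E -> (0 <= if (n <= k)%N then c k else 0)%E.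
  by move=> c0; case: ifP.
apply: le_trans (lee_wpmul2l _ (nseqD E0 (fun k => ip _ k S00) (fun k => ip _ k S10))); last first.
  by rewrite lee_fin.
rewrite -(nseqZ E0 D0' (fun k => adde_ge0 (ip _ k S00) (ip _ k S10))).
apply: nseq_le; first exact: ri_monotone.
  by move=> k; apply: ip => j; exact: Sseq_ge0.
by move=> k; case: ifP => _; [exact: Sseq_split|rewrite adde0 mule0].
Qed.

Lemma P1_split n : (P1 a n <= (D * D)%:E * (P1 a0 n.+1 + P1 a1 n.+1))%E.
Proof.
have T00 k : (0 <= Tseq om a0 k)%E by exact: Tseq_ge0.
have T10 k : (0 <= Tseq om a1 k)%E by exact: Tseq_ge0.
have P00 k : (0 <= P1a a0 k)%E by exact: P1a_ge0.
have P10 k : (0 <= P1a a1 k)%E by exact: P1a_ge0.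
have pT0 c k : (forall k, 0 <= c k)%E -> (0 <= (tau k)%:E * Tseq om c k)%E.
  by move=> c0; rewrite mule_ge0 ?lee_fin// Tseq_ge0.
rewrite [X in (_ * X)%E](_ : _ = ((tau n.+1)%:E * Tseq om a0 n.+1 + (tau n.+1)%:E * Tseq om a1 n.+1)
    + (P1a a0 n.+1 + P1a a1 n.+1))%E; last by rewrite /P1 addeACA.
rewrite ge0_muleDr ?adde_ge0 ?pT0//; apply: leeD.
  rewrite -ge0_muleDr//.
  apply: (@le_trans _ _ ((D * tau n.+1)%:E * (D%:E * (Tseq om a0 n.+1 + Tseq om a1 n.+1)))%E).
    by apply: lee_pmul; rewrite ?lee_fin ?Tseq_ge0//; exact: Tseq_split.
  by rewrite !muleA -!EFinM mulrAC.
pose W c k := ((d k)%:E * (if (k <= n.+1)%N then Tseq om c k else 0))%E.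
have W0 c k : (forall k, 0 <= c k)%E -> (0 <= W c k)%E.
  by move=> c0; rewrite mule_ge0 ?lee_fin//; case: ifP => // _; exact: Tseq_ge0.
apply: le_trans (lee_wpmul2l _ (nseqD E1 (fun k => W0 _ k a0_ge0) (fun k => W0 _ k a1_ge0))); last first.
  by rewrite lee_fin mulr_ge0.
have WW k : (0 <= W a0 k + W a1 k)%E by rewrite adde_ge0// W0.
apply: le_trans (lee_wpmul2l _ (nseq_shift E1 1 WW)); last by rewrite lee_fin mulr_ge0.
have WW1 k : (0 <= W a0 (k + 1)%N + W a1 (k + 1)%N)%E by exact: WW.
rewrite -(nseqZ E1 (mulr_ge0 D0' D0') WW1).
apply: nseq_le; first exact: ri_monotone.
  by move=> k; rewrite mule_ge0 ?lee_fin//; case: ifP => // _; exact: Tseq_ge0.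
move=> k; rewrite /W addn1 ltnS; case: ifP => _; last by rewrite !mule0 adde0 mule0.
apply: (@le_trans _ _ ((D * d k.+1)%:E * (D%:E * (Tseq om a0 k.+1 + Tseq om a1 k.+1)))%E).
  by apply: lee_pmul; rewrite ?lee_fin ?Tseq_ge0//; exact: Tseq_split.
by rewrite -ge0_muleDr// !muleA -!EFinM mulrAC.
Qed.

End Splitting.

Lemma holmstedt_lower : exists2 C : R, 0 < C & forall a a0 a1 n,
  (forall k, 0 <= a k)%E -> (forall k, 0 <= a0 k)%E -> (forall k, 0 <= a1 k)%E ->
  (forall k, a k <= a0 k.+1 + a1 k.+1)%E ->
  (P0 a n + (rho n)%:E * P1 a n <= C%:E * (normB a0 + (rho n)%:E * normA a1))%E.
Proof.
have [A A0 hA] := P0_normA; have [B B0 hB] := P1_normB.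
pose C0 := D * (2 + A); pose C1 := D * D * (D * B + (D + 1)).
have C00 : 0 <= C0 by rewrite mulr_ge0// addr_ge0.
have C10 : 0 <= C1 by rewrite !mulr_ge0// !addr_ge0// mulr_ge0.
exists (C0 + C1 + 1) => [|a a0 a1 n a_0 a00 a10 h]; first lra.
have nB := normB_ge0 a0; have nA := normA_ge0 a1.
have nA' : (0 <= (rho n)%:E * normA a1)%E by rewrite mule_ge0 ?lee_fin.
have sum0 : (0 <= normB a0 + (rho n)%:E * normA a1)%E by rewrite adde_ge0.
have h0 : (P0 a n <= C0%:E * (normB a0 + (rho n)%:E * normA a1))%E.
  apply: le_trans (P0_split a_0 a00 a10 h n) _; rewrite (EFinM D) -muleA.
  apply: lee_wpmul2l; first by rewrite lee_fin.
  rewrite EFinD ge0_muleDl ?lee_fin//; apply: leeD.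
    by apply: le_trans (P0_le_normB a00 n) _; apply: lee_wpmul2l; rewrite ?lee_fin// leeDl.
  by apply: le_trans (hA _ n a10) _; apply: lee_wpmul2l; rewrite ?lee_fin// leeDr.
have h1 : ((rho n)%:E * P1 a n <= C1%:E * (normB a0 + (rho n)%:E * normA a1))%E.
  apply: (@le_trans _ _ ((D * D)%:E * ((rho n)%:E * P1 a0 n.+1 + (rho n)%:E * P1 a1 n.+1))%E).
    have p0 c : (forall k, 0 <= c k)%E -> (0 <= P1 c n.+1)%E.
      by move=> c0; rewrite adde_ge0 ?P1a_ge0// mule_ge0 ?lee_fin// Tseq_ge0.
    rewrite -ge0_muleDr ?p0// muleCA; apply: lee_wpmul2l; first by rewrite lee_fin.
    exact: P1_split.
  rewrite (EFinM (D * D)) -muleA; apply: lee_wpmul2l; first by rewrite lee_fin mulr_ge0.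
  rewrite (EFinD (D * B)) ge0_muleDl ?lee_fin ?mulr_ge0 ?addr_ge0//; apply: leeD.
    apply: (@le_trans _ _ ((D * B)%:E * normB a0)%E); last first.
      by apply: lee_wpmul2l; rewrite ?lee_fin ?mulr_ge0// leeDl.
    (* The cross estimate at n+1 carries 1/rho_(n+1); replacing rho_n by D rho_(n+1) cancels it. *)
    apply: (@le_trans _ _ ((D * rho n.+1)%:E * (B%:E * (((rho n.+1)^-1)%:E * normB a0)))%E).
      apply: lee_pmul; rewrite ?lee_fin//; last exact: hB.
      by rewrite adde_ge0 ?P1a_ge0// mule_ge0 ?lee_fin// Tseq_ge0.
    rewrite !muleA -!EFinM; apply: lee_wpmul2r => //; rewrite lee_fin.
    have rn := rho0 n.+1; rewrite le_eqVlt; apply/orP; left; apply/eqP; field.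
    by rewrite gt_eqF.
  apply: (@le_trans _ _ ((D + 1)%:E * ((rho n)%:E * normA a1))%E).
    rewrite muleCA; apply: lee_wpmul2l; first by rewrite lee_fin.
    exact: P1_le_normA.
  by apply: lee_wpmul2l; rewrite ?lee_fin ?addr_ge0// leeDr.
apply: (@le_trans _ _ ((C0 + C1)%:E * (normB a0 + (rho n)%:E * normA a1))%E).
  rewrite (EFinD C0 C1) (ge0_muleDl _ _) ?lee_fin//; apply: leeD; [exact: h0|exact: h1].
by apply: lee_wpmul2r => //; rewrite lee_fin lerDl.
Qed.

(** As a0 vanishes up to n, for k < n its supremum is at most S_n of a. A constant S_n on the first
    n + 1 indices has norm phi_n S_n; the remaining indices give the tail part of P0. *)
Lemma holmstedt_upperB a a0 n : (forall k, 0 <= a k)%E -> (forall k, 0 <= a0 k)%E ->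
  (forall k, a0 k <= a k)%E -> (forall k, (k <= n)%N -> a0 k = 0%E) ->
  (normB a0 <= P0 a n)%E.
Proof.
move=> a_0 a00 a0a a0z.
have S0 k : (0 <= Sseq s a k)%E by exact: Sseq_ge0.
pose X k := (if (n <= k)%N then Sseq s a k else 0)%E.
pose Y k := ((if (k < n.+1)%N then 1 else 0) * Sseq s a n)%E.
have X0 k : (0 <= X k)%E by rewrite /X; case: ifP.
have Y0 k : (0 <= Y k)%E by rewrite mule_ge0//; case: ifP.
apply: (@le_trans _ _ (nseq E0 (fun k => X k + Y k)%E)).
  apply: nseq_le; first exact: ri_monotone.
    by move=> k; exact: Sseq_ge0.
  move=> k; apply: Sseq_le => j kj; have [jn|nj] := leqP j n.
    by rewrite a0z// mule0 adde_ge0.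
  apply: (@le_trans _ _ ((s j)%:E * a j)%E); first by apply: lee_wpmul2l; rewrite ?lee_fin.
  have [nk|kn] := leqP n k.
    rewrite /X nk; apply: le_trans (leeDl _ (Y0 k)); exact: Sseq_ge.
  apply: le_trans (leeDr _ (X0 k)); rewrite /Y ltnS (ltnW kn) mul1e.
  by apply: Sseq_ge; exact: ltnW.
apply: le_trans (nseqD E0 X0 Y0) _; apply: leeD => //.
rewrite phiE; apply: nseq_cst_ge => //; last exact: window_gt0.
by move=> k; case: ifP.
Qed.

(** As a1 is capped by a_n, beyond n its sums exceed T_n of a by at most a_n times the geometric
    tail of om, that is K D om_n a_n <= K D T_n; hence B = 1 + K D. *)
Lemma holmstedt_upperA : exists2 C : R, 0 < C & forall a a1 n,
  (forall k, 0 <= a k)%E -> (forall k, 0 <= a1 k)%E ->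
  (forall k, a1 k <= a k)%E -> (forall k, a1 k <= a n)%E ->
  (normA a1 <= C%:E * P1 a n)%E.
Proof.
pose B := 1 + K * D; have B0 : 0 <= B by rewrite addr_ge0 ?mulr_ge0.
have B1 : 1 <= B by rewrite lerDl mulr_ge0.
exists (B * D + 1) => [|a a1 n a_0 a10 a1a a1n]; first by rewrite ltr_wpDl// mulr_ge0.
have T0 k : (0 <= Tseq om a k)%E by exact: Tseq_ge0.
pose X k := ((d k)%:E * (if (k <= n)%N then Tseq om a k else 0))%E.
pose c k := ((d k)%:E * (if (n <= k)%N then 1 else 0))%E : \bar R.
have X0 k : (0 <= X k)%E by rewrite mule_ge0 ?lee_fin//; case: ifP.
have c0 k : (0 <= c k)%E by rewrite mule_ge0 ?lee_fin//; case: ifP.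
have BT0 : (0 <= B%:E * Tseq om a n)%E by rewrite mule_ge0 ?lee_fin.
have Y0 k : (0 <= c k * (B%:E * Tseq om a n))%E by exact: mule_ge0.
have cg : (0 < nseq E1 c)%E.
  rewrite -(@pmule_rgt0 _ D%:E) ?lte_fin//.
  by apply: lt_le_trans (tau_le n); rewrite lte_fin.
have Tb k : (n <= k)%N -> (Tseq om a1 k <= B%:E * Tseq om a n)%E.
  move=> nk; have omn : ((om n)%:E * a n <= Tseq om a n)%E.
    by rewrite /Tseq big_ord_recr/= leeDr// sume_ge0// => j _; rewrite mule_ge0 ?lee_fin.
  have x0 j : (0 <= (om j)%:E * a1 j)%E by rewrite mule_ge0 ?lee_fin.
  rewrite /B EFinD ge0_muleDl ?lee_fin ?mulr_ge0// mul1e.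
  rewrite {1}/Tseq -(big_mkord predT (fun j => (om j)%:E * a1 j)%E).
  apply: le_trans (nneseries_lim_ge _ _) _; first by move=> *; exact: x0.
  rewrite (@nneseries_split _ _ 0 n)//; apply: leeD.
    rewrite add0n big_mkord /Tseq big_ord_recr/=.
    apply: (@le_trans _ _ (\sum_(i < n) (om i)%:E * a i)%E).
      by apply: lee_sum => i _; apply: lee_wpmul2l; rewrite ?lee_fin.
    by rewrite leeDl// mule_ge0 ?lee_fin.
  rewrite add0n -(nneseries_addn _ x0) (EFinM K D) -muleA.
  apply: lee_geometric_sum => //; first by rewrite mule_ge0 ?lee_fin.
  move=> i; apply: (@le_trans _ _ ((D * r ^+ i * om n)%:E * a n)%E).
    by apply: lee_pmul; rewrite ?lee_fin// addnC.
  rewrite (mulrC D) -mulrA EFinM -muleA; apply: lee_wpmul2l; first by rewrite lee_fin.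
  by rewrite EFinM -muleA; apply: lee_wpmul2l; rewrite ?lee_fin.
apply: (@le_trans _ _ (nseq E1 (fun k => X k + c k * (B%:E * Tseq om a n))%E)).
  apply: nseq_le; first exact: ri_monotone.
    by move=> k; rewrite mule_ge0 ?lee_fin// Tseq_ge0.
  move=> k; have [kn|nk] := leqP k n.
    apply: le_trans (leeDl _ (Y0 k)); rewrite /X kn; apply: lee_wpmul2l; first by rewrite lee_fin.
    by apply: lee_sum => j _; apply: lee_wpmul2l; rewrite ?lee_fin.
  apply: le_trans (leeDr _ (X0 k)); rewrite /c (ltnW nk) mule1.
  by apply: lee_wpmul2l; [rewrite lee_fin|apply: Tb; exact: ltnW].
apply: le_trans (nseqD E1 X0 Y0) _.
have P10 : (0 <= P1 a n)%E by rewrite adde_ge0 ?P1a_ge0// mule_ge0 ?lee_fin.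
have -> : ((B * D + 1)%:E * P1 a n = P1 a n + (B * D)%:E * P1 a n)%E.
  by rewrite EFinD ge0_muleDl ?lee_fin ?mulr_ge0// mul1e addeC.
apply: leeD; first by rewrite /P1 leeDr// mule_ge0 ?lee_fin.
apply: le_trans (nseq_cst_ge c0 cg BT0) _.
apply: (@le_trans _ _ (D%:E * (tau n)%:E * (B%:E * Tseq om a n))%E).
  by apply: lee_wpmul2r => //; exact: tau_ge.
rewrite -muleA (muleCA (tau n)%:E) muleA -EFinM (mulrC D); apply: lee_wpmul2l.
  by rewrite lee_fin mulr_ge0.
exact: (leeDl _ (P1a_ge0 a n)).
Qed.

End DiscreteHolmstedt.

(** * Discrete Hardy inequalities *)

Lemma lee_lincomb (R : realType) (A B c d : R) (x y z : \bar R) :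
  0 <= A -> 0 <= B -> 0 <= c -> 0 <= d -> (0 <= z)%E ->
  (x <= c%:E * z)%E -> (y <= d%:E * z)%E ->
  (A%:E * x + B%:E * y <= (A * c + B * d)%:E * z)%E.
Proof.
move=> A0 B0 c0 d0 z0 xz yz.
rewrite EFinD ge0_muleDl ?lee_fin ?mulr_ge0// !EFinM -!muleA.
by apply: leeD; apply: lee_wpmul2l; rewrite ?lee_fin.
Qed.

Section DiscreteHardy.
Variable R : realType.
Variables (E0 E1 : ri_space R) (s om d phi tau rho : nat -> R) (D r : R).
Hypothesis adm : admissible E0 E1 s om d phi tau rho D r.
Implicit Types (a : nat -> \bar R) (w : nat -> R) (E : ri_space R) (n m k i j : nat).

Notation P0 := (P0 E0 s phi).
Notation P1 := (P1 E1 om d tau).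
Notation gseq := (gseq s phi).
Notation hseq := (hseq om tau).

(** Growth of w turns the simple and the double tail sums of [P0_le] into geometrically weighted
    shifts [L] and [LL] of w g; each layer costs 1/(1 - q) in the norm. *)
Lemma hardy_left w (C q : R) : (forall n, 0 < w n) -> 0 < C -> 0 < q < 1 ->
  (forall n i, w n <= C * (q ^+ i * w (n + i)%N)) ->
  exists2 C' : R, 0 < C' & forall E a, (forall k, 0 <= a k)%E ->
    (nseq E (fun n => (w n)%:E * P0 a n) <= C'%:E * nseq E (fun n => (w n)%:E * gseq a n))%E.
Proof.
move=> w0 C0 /andP[q0 q1] wd; have qi k : 0 <= q ^+ k by rewrite exprn_ge0// ltW.
have q01 : 0 <= q < 1 by rewrite ltW.
have Q0 : 0 < (1 - q)^-1 by rewrite invr_gt0 subr_gt0.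
have C0' := ltW C0; have CC := mulr_ge0 C0' C0'.
exists (C * C * ((1 - q)^-1 * (1 - q)^-1) + C * (1 - q)^-1) => [|E a a0].
  by rewrite addr_gt0 ?mulr_gt0.
pose G n := ((w n)%:E * gseq a n)%E.
have g0 k : (0 <= gseq a k)%E by exact: gseq_ge0 adm _ a0 k.
have w0' k : 0 <= w k by exact: ltW.
have G0 k : (0 <= G k)%E by rewrite mule_ge0 ?lee_fin.
pose L n := (\sum_(i <oo) (q ^+ i)%:E * G (n + i)%N)%E.
have L0 k : (0 <= L k)%E by apply: nneseries_ge0 => i _ _; rewrite mule_ge0 ?lee_fin.
pose LL n := (\sum_(i <oo) (q ^+ i)%:E * L (n + i)%N)%E.
have LL0 k : (0 <= LL k)%E by apply: nneseries_ge0 => i _ _; rewrite mule_ge0 ?lee_fin.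
have inner n : ((w n)%:E * \sum_(i <oo) gseq a (n + i) <= C%:E * L n)%E.
  rewrite -!nneseriesZl//; last by move=> i _; rewrite mule_ge0 ?lee_fin.
  apply: lee_nneseries => i _; first by move=> _; rewrite mule_ge0 ?lee_fin.
  rewrite /G; move: (gseq a (n + i)) (g0 (n + i)%N) => x x_0.
  by rewrite !muleA -!EFinM -mulrA lee_wpmul2r// lee_fin.
have gs0 n : (0 <= \sum_(i <oo) gseq a (n + i))%E by exact: nneseries_ge0.
have outer n : ((w n)%:E * \sum_(i <oo) \sum_(j <oo) gseq a (n + i + j) <= (C * C)%:E * LL n)%E.
  rewrite -!nneseriesZl//; last by move=> i _; rewrite mule_ge0 ?lee_fin.
  apply: lee_nneseries => i _; first by move=> _; rewrite mule_ge0 ?lee_fin.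
  apply: (@le_trans _ _ ((C * (q ^+ i * w (n + i)%N))%:E * \sum_(j <oo) gseq a (n + i + j))%E).
    by rewrite lee_wpmul2r// lee_fin.
  apply: (@le_trans _ _ ((C * q ^+ i)%:E * (C%:E * L (n + i)%N))%E).
    rewrite mulrA EFinM -muleA; apply: lee_wpmul2l; first by rewrite lee_fin mulr_ge0.
    exact: inner.
  by rewrite !muleA -!EFinM mulrAC.
have nL : (nseq E L <= ((1 - q)^-1)%:E * nseq E G)%E by exact: nseq_geometric_left.
have nLL : (nseq E LL <= ((1 - q)^-1 * (1 - q)^-1)%:E * nseq E G)%E.
  apply: le_trans (nseq_geometric_left E q01 L0) _.
  by rewrite EFinM -muleA; apply: lee_wpmul2l => //; rewrite lee_fin ltW.
have x0 n : (0 <= (C * C)%:E * LL n)%E by rewrite mule_ge0 ?lee_fin.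
have y0 n : (0 <= C%:E * L n)%E by rewrite mule_ge0 ?lee_fin.
apply: (@le_trans _ _ (nseq E (fun n => (C * C)%:E * LL n + C%:E * L n)%E)).
  apply: nseq_le; first exact: ri_monotone.
    move=> n; rewrite mule_ge0 ?lee_fin// adde_ge0//; first exact: P0a_ge0.
    by rewrite mule_ge0 ?lee_fin ?(ltW (phi_gt0 adm n))// Sseq_ge0// => k; exact/ltW/(adm_s0 adm).
  move=> n; apply: (@le_trans _ _ ((w n)%:E * (\sum_(i <oo) \sum_(j <oo) gseq a (n + i + j) +
      \sum_(i <oo) gseq a (n + i)))%E).
    by apply: lee_wpmul2l; [rewrite lee_fin|exact: (P0_le adm)].
  by rewrite ge0_muleDr//; [exact: leeD|apply: nneseries_ge0].
apply: le_trans (nseqD E x0 y0) _.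
rewrite (nseqZ E CC LL0) (nseqZ E C0' L0).
by apply: lee_lincomb => //; rewrite ?mulr_ge0 ?(ltW Q0)//; exact: nseq_ge0.
Qed.

(** Decay of w does the same for the head sums of [P1_le], with shifts in the opposite direction. *)
Lemma hardy_right w (C q : R) : (forall n, 0 < w n) -> 0 < C -> 0 < q < 1 ->
  (forall n i, w (n + i)%N <= C * (q ^+ i * w n)) ->
  exists2 C' : R, 0 < C' & forall E a, (forall k, 0 <= a k)%E ->
    (nseq E (fun n => (w n)%:E * P1 a n) <= C'%:E * nseq E (fun n => (w n)%:E * hseq a n))%E.
Proof.
move=> w0 C0 /andP[q0 q1] wd; have qi k : 0 <= q ^+ k by rewrite exprn_ge0// ltW.
have q01 : 0 <= q < 1 by rewrite ltW.
have Q0 : 0 < (1 - q)^-1 by rewrite invr_gt0 subr_gt0.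
have D0 := adm_D0 adm; have w10 := w1_gt0 E1; have D0' := ltW D0; have w10' := ltW w10.
pose A := D * C; pose B := w1 E1 * (D * D) * (C * C).
have A0 : 0 < A by exact: mulr_gt0.
have B0 : 0 < B by rewrite !mulr_gt0.
exists (A * (1 - q)^-1 + B * ((1 - q)^-1 * (1 - q)^-1)) => [|E a a0].
  by rewrite addr_gt0 ?mulr_gt0.
pose G n := ((w n)%:E * hseq a n)%E.
have h0 k : (0 <= hseq a k)%E by exact: hseq_ge0 adm _ a0 k.
have w0' k : 0 <= w k by exact: ltW.
have G0 k : (0 <= G k)%E by rewrite mule_ge0 ?lee_fin.
have wj j n : (j <= n)%N -> w n <= C * (q ^+ (n - j) * w j).
  by move=> jn; rewrite -[in leLHS](subnKC jn).
pose L n := (\sum_(j < n.+1) (q ^+ (n - j))%:E * G j)%E.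
have L0 k : (0 <= L k)%E by apply: sume_ge0 => i _; rewrite mule_ge0 ?lee_fin.
pose LL n := (\sum_(j < n.+1) (q ^+ (n - j))%:E * L j)%E.
have LL0 k : (0 <= LL k)%E by apply: sume_ge0 => i _; rewrite mule_ge0 ?lee_fin.
have hs0 n : (0 <= \sum_(j < n.+1) hseq a j)%E by exact: sume_ge0.
have inner n : ((w n)%:E * \sum_(j < n.+1) hseq a j <= C%:E * L n)%E.
  rewrite !ge0_sume_distrr//; last by move=> i _; rewrite mule_ge0 ?lee_fin.
  apply: lee_sum => -[j jn] _ /=.
  rewrite /G; move: (hseq a j) (h0 j) => x x_0.
  by rewrite !muleA -!EFinM -mulrA lee_wpmul2r// lee_fin wj.
have outer n : ((w n)%:E * \sum_(k < n.+1) \sum_(j < k.+1) hseq a j <= (C * C)%:E * LL n)%E.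
  rewrite [leLHS]ge0_sume_distrr// [leRHS]ge0_sume_distrr//; last first.
    by move=> i _; rewrite mule_ge0 ?lee_fin.
  apply: lee_sum => -[k kn] _ /=.
  apply: (@le_trans _ _ ((C * (q ^+ (n - k) * w k))%:E * \sum_(j < k.+1) hseq a j)%E).
    by apply: lee_wpmul2r; rewrite ?hs0 ?lee_fin ?wj.
  apply: (@le_trans _ _ ((C * q ^+ (n - k))%:E * (C%:E * L k))%E).
    rewrite mulrA EFinM -muleA; apply: lee_wpmul2l; first by rewrite lee_fin mulr_ge0// ltW.
    exact: inner.
  by rewrite !muleA -!EFinM mulrAC.
have nL : (nseq E L <= ((1 - q)^-1)%:E * nseq E G)%E by exact: nseq_geometric_right.
have nLL : (nseq E LL <= ((1 - q)^-1 * (1 - q)^-1)%:E * nseq E G)%E.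
  apply: le_trans (nseq_geometric_right E q01 L0) _.
  by rewrite EFinM -muleA; apply: lee_wpmul2l => //; rewrite lee_fin ltW.
have x0 n : (0 <= A%:E * L n)%E by rewrite mule_ge0 ?lee_fin// ltW.
have y0 n : (0 <= B%:E * LL n)%E by rewrite mule_ge0 ?lee_fin// ltW.
apply: (@le_trans _ _ (nseq E (fun n => A%:E * L n + B%:E * LL n)%E)).
  apply: nseq_le; first exact: ri_monotone.
    move=> n; rewrite mule_ge0 ?lee_fin// adde_ge0//; last exact: P1a_ge0.
    rewrite mule_ge0 ?lee_fin ?(ltW (adm_tau0 adm n))// Tseq_ge0// => k.
    exact/ltW/(adm_om0 adm).
  move=> n; apply: (@le_trans _ _ ((w n)%:E * (D%:E * \sum_(j < n.+1) hseq a j +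
     (w1 E1 * (D * D))%:E * \sum_(k < n.+1) \sum_(j < k.+1) hseq a j))%E).
    by apply: lee_wpmul2l; [rewrite lee_fin|exact: (P1_le adm)].
  have s0 : (0 <= \sum_(k < n.+1) \sum_(j < k.+1) hseq a j)%E by exact: sume_ge0.
  have wDD : 0 <= w1 E1 * (D * D) by rewrite !mulr_ge0.
  rewrite ge0_muleDr; [|by rewrite mule_ge0 ?lee_fin..].
  rewrite muleCA (muleCA (w n)%:E); apply: leeD.
    rewrite (EFinM D C) -muleA; apply: lee_wpmul2l; first by rewrite lee_fin ltW.
    exact: inner.
  rewrite (EFinM (w1 E1 * (D * D))) -muleA; apply: lee_wpmul2l.
    by rewrite lee_fin.
  exact: outer.
apply: le_trans (nseqD E x0 y0) _.
rewrite (nseqZ E (ltW A0) L0) (nseqZ E (ltW B0) LL0).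
have Q1 := ltW Q0; apply: lee_lincomb => //; [exact: ltW|exact: ltW|exact: mulr_ge0|exact: nseq_ge0].
Qed.

End DiscreteHardy.

(** * The K-functional *)

Section Instance.
Variable R : realType.
Variables (E0 E1 : ri_space R) (p0 p1 alpha beta : R).
Hypothesis hp0 : 1 < p0.
Hypothesis hp01 : p0 < p1.
Hypothesis halpha : alpha < 1.
Hypothesis hbeta : beta < 1.
Hypothesis hE1 : (E1 (fun u => ((1 + u) `^ (beta - 1))%:E) < +oo)%E.

Lemma coarse_step (w : R -> R) : coarse w -> exists2 C : R, 0 < C & forall n,
  w (en R n) <= C * w (en R n.+1).
Proof.
move=> cw; have [C C0 h] := coarse_block 1 cw; exists C => // n.
by apply: (h n n.+1 _ _ (leqnSn n) _ (en_block R n) (en_block R n.+1)).1; rewrite addn1.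
Qed.

Lemma le_mul_trans (x y C D : R) : 0 <= y -> C <= D -> x <= C * y -> x <= D * y.
Proof. by move=> y0 CD xC; apply: le_trans xC _; rewrite ler_wpM2r. Qed.

Lemma le_divl (x y w C : R) : 0 < w -> x * w <= C * y -> x <= w^-1 * C * y.
Proof. by move=> w0 h; rewrite -mulrA mulrC ler_pdivlMr. Qed.

Lemma weight_decay p n i : weight p (fun=> 1) (en R (n + i)) =
  expR (- p^-1) ^+ i * weight p (fun=> 1) (en R n).
Proof.
rewrite /weight !mulr1 !en_powR -expRM_natr -expRD natrD; congr expR.
by rewrite mulNr mulrDl opprD addrC; congr (- _ - _); rewrite mulrC.
Qed.

Lemma admissible_rs : exists D r : R,
  admissible E0 E1 (weight p0 (fun t => ell t `^ (alpha - 1)) \o en R)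
    (weight p1 (fun=> 1) \o en R) (dseq beta)
    (fundamental_ell E0 \o en R) (tail_norm beta E1 \o en R)
    (rs E0 E1 p0 p1 alpha beta) D r.
Proof.
have c1 : coarse (fun=> 1 : R) by exact: coarse_cst.
have cs := coarse_weight p0 (coarse_ell_powR (alpha - 1)).
have co := coarse_weight p1 c1.
have cd := coarse_ell_powR (R := R) (beta - 1).
have ct := coarse_tail_norm hbeta hE1.
have cr := coarse_rho E0 p0 p1 alpha hbeta hE1.
have [C1 C10 h1] := coarse_step cs; have [C2 C20 h2] := coarse_step co.
have [C3 C30 h3] := coarse_step cd; have [C4 C40 h4] := coarse_step ct.
have [C5 C50 h5] := coarse_step cr.
have [C6 C60 h6] := tail_norm_fine hbeta hE1.
have [C7 [r [C70 /andP[r0 r1] h7]]] := rs_decay E0 hp0 hp01 halpha hbeta hE1.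
have w0 := w1_gt0 E1.
have tf n : tailseq E1 beta n \is a fin_num.
  by rewrite ge0_fin_numE ?tailseq_lty// ltW// tailseq_gt0.
have p10 : 0 < p1 by apply: lt_trans hp01; exact: lt_trans hp0.
(* om decays at the rate q and rho at the rate r; the larger of the two serves both. *)
pose q : R := expR (- p1^-1); pose rr := Num.max r q.
have q0 : 0 < q by exact: expR_gt0.
have q1 : q < 1 by rewrite -[ltRHS]expR0 ltr_expR oppr_lt0 invr_gt0.
have C66 : 0 < C6 * C6 by exact: mulr_gt0.
have C6w : 0 < (w1 E1)^-1 * C6 by rewrite mulr_gt0 ?invr_gt0.
(* One constant for all comparisons: the sum dominates each summand. The summand 1 serves the decay
   of om, which is an exact power. *)
pose D := 1 + C1 + C2 + C3 + C4 + C5 + C6 + C7 + C6 * C6 + (w1 E1)^-1 * C6.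
have [d0 d1 d2 d3 d4] : [/\ 0 < D, 1 <= D, C1 <= D, C2 <= D & C3 <= D] by split; rewrite /D; lra.
have [d5 d6 d7 d8] : [/\ C4 <= D, C5 <= D, C6 <= D & C7 <= D] by split; rewrite /D; lra.
have [d9 d10] : C6 * C6 <= D /\ (w1 E1)^-1 * C6 <= D by split; rewrite /D; lra.
have s0 n : 0 < weight p0 (fun t => ell t `^ (alpha - 1)) (en R n) by apply: cs.1; exact: en_itv.
have om0 n : 0 < weight p1 (fun=> 1) (en R n) by apply: co.1; exact: en_itv.
have dd0 n : 0 < dseq beta n by exact: dseq_gt0.
have tau0 n : 0 < tail_norm beta E1 (en R n) by apply: ct.1; exact: en_itv.
have rho0 n : 0 < rs E0 E1 p0 p1 alpha beta n by exact: rs_gt0.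
have ht n := h6 _ _ (en_block R n).
have ft0 := @fine_tailseq_gt0 R E1 beta hbeta hE1.
exists D, rr; split.
- exact: s0.
- exact: om0.
- exact: dd0.
- exact: tau0.
- exact: rho0.
- exact: d0.
- by rewrite /rr lt_max r0/= gt_max r1 q1.
- by move=> n; apply: le_mul_trans d2 (h1 n); exact: ltW (s0 _).
- by move=> n; apply: le_mul_trans d3 (h2 n); exact: ltW (om0 _).
- by move=> n; apply: le_mul_trans d4 (h3 n); exact: ltW (dd0 _).
- by move=> n; apply: le_mul_trans d5 (h4 n); exact: ltW (tau0 _).
- by move=> n; apply: le_mul_trans d6 (h5 n); exact: ltW (rho0 _).
- by move=> n; exact: fundamental_ell_en.
- by move=> n m; exact: fundamental_ell_nd.
- move=> n; rewrite -[nseq _ _]/(tailseq E1 beta n) -(fineK (tf n)) -EFinM lee_fin.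
  exact: le_mul_trans (ltW (ft0 n)) d7 (ht n).1.
- move=> n; rewrite -[nseq _ _]/(tailseq E1 beta n) -(fineK (tf n)) -EFinM lee_fin.
  exact: le_mul_trans (ltW (tau0 n)) d7 (ht n).2.
- move=> n; apply: (le_mul_trans (ltW (tau0 n)) d10).
  have := dseq_le_tailseq E1 beta n; rewrite w1E -(fineK (tf n)) -EFinM lee_fin => hd.
  exact: le_divl w0 (le_trans hd (ht n).2).
- move=> n m nm; apply: (le_mul_trans (ltW (tau0 n)) d9).
  apply: (le_trans (ht m).1); rewrite -mulrA ler_pM2l//; apply: le_trans (ht n).2.
  exact: fine_tailseq_le.
- move=> n i; have -> : (weight p1 (fun=> 1) \o en R) (n + i)%N =
      q ^+ i * (weight p1 (fun=> 1) \o en R) n.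
    exact: weight_decay.
  apply: ler_wpM2r; first exact: ltW (om0 _).
  apply: (@le_trans _ _ (1 * rr ^+ i)); last by rewrite ler_wpM2r// exprn_ge0// le_max (ltW r0).
  by rewrite mul1r lerXn2r ?nnegrE ?le_max ?(ltW q0) ?(ltW r0) ?lexx ?orbT.
- move=> n i; apply: le_trans (h7 n i) _; apply: ler_wpM2r; first exact: ltW.
  apply: ler_pM; [exact: ltW|by apply: exprn_ge0; exact: ltW|exact: d8|].
  by rewrite lerXn2r ?nnegrE ?le_max ?(ltW q0) ?(ltW r0) ?lexx ?orbT.
- by move=> n; exact: rsE.
Qed.

End Instance.

Section KFunctional.
Variable R : realType.

Lemma lee_mul_ereal_inf (C : R) x (A : set (\bar R)) : 0 < C ->
  (forall z, A z -> (x <= C%:E * z)%E) -> (x <= C%:E * ereal_inf A)%E.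
Proof.
move=> C0 h; rewrite -lee_pdivrMl//; apply: le_ereal_inf_tmp => z Az.
by rewrite lee_pdivrMl//; exact: h.
Qed.

(** e^-(k+1) >= 2 e^-(k+2) because e >= 2, so the subadditivity of f^* applies with both arguments
    equal to e^-(k+2). *)
Lemma fseq_split (f f0 f1 : R -> R) k : measurable_fun (`]0, 1[ : set R) f ->
  measurable_fun (`]0, 1[ : set R) f0 -> measurable_fun (`]0, 1[ : set R) f1 ->
  {ae lebesgue_measure, forall s : R, 0 < s < 1 -> f s = f0 s + f1 s} ->
  (fseq f k <= fseq f0 k.+1 + fseq f1 k.+1)%E.
Proof.
move=> mf mf0 mf1 e; apply: le_trans (fstarD _ _ mf mf0 mf1 e); apply: fstar_antitone.
have -> : en R k.+1 = expR 1 * en R k.+2.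
  by rewrite -expRD -[k.+2]addn1 natrD opprD addrCA addrN addr0.
rewrite -mulr2n -mulr_natl ler_wpM2r ?(ltW (en_gt0 _ _))//.
by have := @expR_ge1Dx R 1; rewrite -natr1 => ->.
Qed.

Lemma lee_sum_bound (A B D r : R) (x x' y y' : \bar R) : 0 <= r -> 0 <= A -> 0 <= B -> 0 <= D ->
  (0 <= x' -> 0 <= y' -> x <= A%:E * x' -> y <= B%:E * y' ->
   D%:E * (x + r%:E * y) <= (D * (A + B))%:E * (x' + r%:E * y'))%E.
Proof.
move=> r0 A0 B0 D0 x0 y0 hx hy; rewrite EFinM -muleA; apply: lee_wpmul2l; first by rewrite lee_fin.
rewrite ge0_muleDr ?mule_ge0 ?lee_fin//; apply: leeD.
  apply: le_trans hx _; apply: lee_wpmul2r => //.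
  by rewrite lee_fin lerDl.
rewrite muleCA; apply: lee_wpmul2l; first by rewrite lee_fin.
apply: le_trans hy _; apply: lee_wpmul2r => //.
by rewrite lee_fin lerDr.
Qed.

Lemma P0_ge0 (E0 E1 : ri_space R) (s om d phi tau rho : nat -> R) (D r : R) a n :
  admissible E0 E1 s om d phi tau rho D r -> (forall k, 0 <= a k)%E -> (0 <= P0 E0 s phi a n)%E.
Proof.
move=> adm a0; rewrite adde_ge0//; first exact: P0a_ge0.
rewrite mule_ge0 ?lee_fin ?(ltW (phi_gt0 adm n))// Sseq_ge0// => k; exact/ltW/(adm_s0 adm).
Qed.

Lemma P1_ge0 (E0 E1 : ri_space R) (s om d phi tau rho : nat -> R) (D r : R) a n :
  admissible E0 E1 s om d phi tau rho D r -> (forall k, 0 <= a k)%E -> (0 <= P1 E1 om d tau a n)%E.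
Proof.
move=> adm a0; rewrite adde_ge0//; last exact: P1a_ge0.
rewrite mule_ge0 ?lee_fin ?(ltW (adm_tau0 adm n))// Tseq_ge0// => k; exact/ltW/(adm_om0 adm).
Qed.

Lemma gseq_le_P0 (E0 E1 : ri_space R) (s om d phi tau rho : nat -> R) (D r : R) a n :
  admissible E0 E1 s om d phi tau rho D r -> (forall k, 0 <= a k)%E ->
  (gseq s phi a n <= P0 E0 s phi a n)%E.
Proof.
move=> adm a0; rewrite /gseq EFinM -muleA.
apply: (@le_trans _ _ ((phi n)%:E * Sseq s a n)%E).
  by apply: lee_wpmul2l; [rewrite lee_fin (ltW (phi_gt0 adm n))|exact: Sseq_ge].
by rewrite leeDr//; exact: P0a_ge0.
Qed.

Lemma hseq_le_P1 (E0 E1 : ri_space R) (s om d phi tau rho : nat -> R) (D r : R) a n :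
  admissible E0 E1 s om d phi tau rho D r -> (forall k, 0 <= a k)%E ->
  (hseq om tau a n <= P1 E1 om d tau a n)%E.
Proof.
move=> adm a0; apply: le_trans (hseq_le_Tseq adm a0 n) _.
by rewrite leeDl//; exact: P1a_ge0.
Qed.

Variables (E0 E1 : ri_space R) (p0 p1 alpha beta : R).
Hypothesis hp0 : 1 < p0.
Hypothesis hp01 : p0 < p1.
Hypothesis halpha : alpha < 1.
Hypothesis hbeta : beta < 1.
Hypothesis hE1 : (E1 (fun u => ((1 + u) `^ (beta - 1))%:E) < +oo)%E.

Notation Y0 := (Bsp p0 alpha E0).
Notation Y1 := (Asp p1 beta E1).
Notation sv := (weight p0 (fun t => ell t `^ (alpha - 1)) \o en R).
Notation ov := (weight p1 (fun=> 1) \o en R).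
Notation phiv := (fundamental_ell E0 \o en R).
Notation tauv := (tail_norm beta E1 \o en R).
Notation rv := (rs E0 E1 p0 p1 alpha beta).
Notation NB f := (normB E0 sv (fseq f)).
Notation NA f := (normA E1 ov (dseq beta) (fseq f)).
Notation Q0 f n := (P0 E0 sv phiv (fseq f) n).
Notation Q1 f n := (P1 E1 ov (dseq beta) tauv (fseq f) n).

Lemma Bsp_normB : equivn (fnorm Y0) (fun f => NB f).
Proof. exact: Bsp_equiv. Qed.

Lemma Asp_normA : equivn (fnorm Y1) (fun f => NA f).
Proof. by apply: Asp_equiv => //; exact: lt_trans hp01. Qed.

Lemma fnorm_Bsp_ge0 f : (0 <= fnorm Y0 f)%E. Proof. exact: tilde_ge0. Qed.
Lemma fnorm_Asp_ge0 f : (0 <= fnorm Y1 f)%E. Proof. exact: tilde_ge0. Qed.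

Lemma Kfunctional_ge : exists2 C : R, 0 < C & forall f n, measurable_fun (`]0, 1[ : set R) f ->
  (Q0 f n + (rv n)%:E * Q1 f n <= C%:E * Kfunctional Y0 Y1 (rv n) f)%E.
Proof.
have [D [r adm]] := admissible_rs E0 hp0 hp01 halpha hbeta hE1.
have [C C0 hC] := holmstedt_lower adm.
have [B B0 hB] := Bsp_normB; have [A A0 hA] := Asp_normA.
exists (C * (B + A)) => [|f n mf]; first by rewrite mulr_gt0 ?addr_gt0.
apply: lee_mul_ereal_inf => [|_ [f0 [f1 [[mf0 _] [mf1 _] e ->]]]].
  by rewrite mulr_gt0 ?addr_gt0.
have h := hC (fseq f) (fseq f0) (fseq f1) n (fseq_ge0 f) (fseq_ge0 f0) (fseq_ge0 f1)
  (fun k => fseq_split k mf mf0 mf1 e).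
apply: (le_trans h); apply: lee_sum_bound.
- exact/ltW/(adm_rho0 adm).
- exact: ltW.
- exact: ltW.
- exact: ltW.
- exact: fnorm_Bsp_ge0.
- exact: fnorm_Asp_ge0.
- exact: (hB f0).2.
- exact: (hA f1).2.
Qed.

Lemma Kfunctional_le : exists2 C : R, 0 < C & forall f n, measurable_fun (`]0, 1[ : set R) f ->
  (Kfunctional Y0 Y1 (rv n) f <= C%:E * (Q0 f n + (rv n)%:E * Q1 f n))%E.
Proof.
have [D [r adm]] := admissible_rs E0 hp0 hp01 halpha hbeta hE1.
have [C C0 hC] := holmstedt_upperA adm.
have [B B0 hB] := Bsp_normB; have [A A0 hA] := Asp_normA.
exists (B + A * C) => [|f n mf]; first by rewrite addr_gt0 ?mulr_gt0.
have a0 := fseq_ge0 f; have rn0 := adm_rho0 adm n.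
have q0 := P0_ge0 n adm a0; have q1 := P1_ge0 n adm a0.
(* If either part is infinite, so is the right-hand side. Otherwise a finite P0 makes a_n finite,
   since phi_n s_n > 0, and a_n can serve as a real truncation height. *)
have [->|/eqP q0f] := pselect (Q0 f n = +oo%E).
  by rewrite addye ?gt0_muley ?leey ?lte_fin ?addr_gt0 ?mulr_gt0// gt_eqF// (lt_le_trans _ (mule_ge0 _ q1)) ?lee_fin ?ltW// ltNyr.
have [->|/eqP q1f] := pselect (Q1 f n = +oo%E).
  rewrite gt0_muley ?lte_fin// addey ?gt0_muley ?leey ?lte_fin ?addr_gt0 ?mulr_gt0//.
  by rewrite gt_eqF// (lt_le_trans _ q0)// ltNyr.
have psn : 0 < phiv n * sv n by rewrite mulr_gt0 ?(phi_gt0 adm n) ?(adm_s0 adm n).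
have gle := gseq_le_P0 n adm a0.
have fn : fseq f n \is a fin_num.
  rewrite ge0_fin_numE// ltey; apply: contra q0f => /eqP e.
  by rewrite -leye_eq; apply: le_trans gle; rewrite /gseq e gt0_muley ?lte_fin.
pose y := fine (fseq f n); have ye : fseq f n = y%:E by rewrite fineK.
have y0 : 0 <= y by rewrite -lee_fin -ye.
pose f1 := cut f y; pose f0 s := f s - cut f y s.
have mf1 : measurable_fun (`]0, 1[ : set R) f1 by exact: measurable_cut.
have mf0 : measurable_fun (`]0, 1[ : set R) f0 by exact: measurable_funB.
have k0 k : (fseq f0 k <= fseq f k)%E.
  by apply: fstar_mono => // s _; exact: (norm_sub_cut f s y0).1.
have k1 k : (fseq f1 k <= fseq f k)%E.
  by apply: fstar_mono => // s _; exact: (norm_cut f s y0).2.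
have k1n k : (fseq f1 k <= fseq f n)%E.
  rewrite ye; apply: fstar_bounded => //; first exact: ltW (en_gt0 _ _).
  by move=> s _; exact: (norm_cut f s y0).1.
have k0n k : (k <= n)%N -> fseq f0 k = 0%E.
  by move=> kn; apply: fstar_sub_cut mf ye _; exact: le_en.
have nb := holmstedt_upperB adm a0 (fseq_ge0 f0) k0 k0n.
have na := hC _ _ n a0 (fseq_ge0 f1) k1 k1n.
have b0 : (fnorm Y0 f0 <= B%:E * Q0 f n)%E.
  apply: le_trans (hB f0).1 _; apply: lee_wpmul2l => //; rewrite lee_fin; exact: ltW.
have b1 : (fnorm Y1 f1 <= (A * C)%:E * Q1 f n)%E.
  apply: le_trans (hA f1).1 _; rewrite EFinM -muleA.
  by apply: lee_wpmul2l => //; rewrite lee_fin; exact: ltW.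
apply: (@le_trans _ _ (1%:E * (fnorm Y0 f0 + (rv n)%:E * fnorm Y1 f1))%E).
  rewrite mul1e; apply: ereal_inf_lbound; exists f0, f1; split => //.
  - by split => //; apply: (le_lt_trans b0); rewrite lte_mul_pinfty ?lee_fin ?(ltW B0)// ltey.
  - split => //; apply: (le_lt_trans b1); rewrite lte_mul_pinfty ?lee_fin ?ltey//.
    by rewrite ltW// mulr_gt0.
  - by apply: aeW => s _; rewrite subrK.
rewrite -[X in (X%:E * (Q0 _ _ + _))%E]mul1r; apply: lee_sum_bound => //; try exact: ltW.
by rewrite ltW// mulr_gt0.
Qed.

End KFunctional.

(** * Sampling the interpolation norm *)

Section Reindexing.
Variable R : realType.
Implicit Types (x y : nat -> R) (s t : R) (n m i : nat) (E : ri_space R) (g : R -> \bar R).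

Definition decaying x := exists C q : R,
  [/\ 0 < C, 0 < q < 1 & forall n i, x (n + i)%N <= C * q ^+ i * x n].

Lemma geometric_lt (C q e : R) : 0 < C -> 0 < q < 1 -> 0 < e -> exists M : nat, C * q ^+ M < e.
Proof.
move=> C0 /andP[q0 q1] e0; have hq : `|q| < 1 by rewrite gtr0_norm.
have [M _ /(_ M (leqnn M))] := cvgr0_norm_lt _ (cvg_geometric C hq) _ e0.
by rewrite /= gtr0_norm ?mulr_gt0 ?exprn_gt0// => h; exists M.
Qed.

(** [tau n] is the first index at which y has dropped to x n. Minimality and the step bound of y
    make y at [tau n] comparable to x n; the decay of x bounds the length of the fibres of [tau], so
    [nseq_quasi] applies. *)
Lemma seq_reindex x y (S : R) : (forall n, 0 < x n) -> (forall n, 0 < y n) -> decaying x -> decaying y ->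
  0 < S -> (forall n, y n <= S * y n.+1) ->
  exists2 K : R, 0 < K & exists M : nat, forall E g (L : R), 0 < L ->
    (forall t, 0 < t -> (0 <= g t)%E) ->
    (forall s t, 0 < s -> 0 < t -> s <= K * t -> t <= K * s -> (g s <= L%:E * g t)%E) ->
    (nseq E (g \o x) <= (M.+1%:R * L)%:E * nseq E (g \o y))%E.
Proof.
move=> x0 y0 [C [q [C0 q01 hx]]] [C' [q' [C'0 q'01 hy]]] S0 hS.
have [q0 q1] : 0 <= q /\ q < 1 by case/andP: q01 => /ltW.
have ex n : exists m, y m <= x n.
  have [M hM] := geometric_lt C'0 q'01 (divr_gt0 (x0 n) (y0 0%N)).
  exists M; have := hy 0%N M; rewrite add0n => /le_trans; apply.
  by rewrite -ler_pdivlMr// ltW.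
pose tau n := ex_minn (ex n).
pose K := 1 + S + C * x 0%N / y 0%N.
have c0 : 0 < C * x 0%N / y 0%N by rewrite divr_gt0 ?mulr_gt0.
have K1 : 1 <= K by rewrite /K -addrA lerDl addr_ge0// ltW.
have K0 : 0 < K by exact: lt_le_trans K1.
have t1 n : y (tau n) <= x n by rewrite /tau; case: ex_minnP.
have t1' n : y (tau n) <= K * x n by apply: le_trans (t1 n) _; rewrite ler_peMl// ltW.
have t2 n : x n <= K * y (tau n).
  (* If [tau n] is 0 there is no previous index; then x n <= C x 0 is a multiple of y 0, which
     explains the last summand of K. *)
  rewrite /tau; case: ex_minnP => -[_ _|m _ hm].
    apply: (@le_trans _ _ (C * x 0%N)).
      have := hx 0%N n; rewrite add0n => /le_trans; apply; rewrite ler_wpM2r ?(ltW (x0 _))//.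
      by rewrite -[leRHS]mulr1 ler_pM2l// exprn_ile1// ltW.
    by rewrite -ler_pdivrMr//; rewrite /K lerDr addr_ge0// ltW.
  have lt : x n < y m by rewrite ltNge; apply/negP => /hm; rewrite ltnn.
  apply: le_trans (ltW lt) _; apply: le_trans (hS m) _.
  by rewrite ler_wpM2r ?(ltW (y0 _))// /K addrAC lerDr addr_ge0// ltW.
(* Equal images of n <= m give x n <= K K x m, which the decay of x excludes once K K C q^(m-n) <
   1. *)
have [M hM] := geometric_lt (mulr_gt0 (mulr_gt0 K0 K0) C0) q01 (@ltr01 R).
exists K => //; exists M => E g L L0 g0 hg.
have gx n : (0 <= (g \o x) n)%E by exact: g0.
have gy n : (0 <= (g \o y) n)%E by exact: g0.
rewrite EFinM -muleA -(nseqZ E (ltW L0) gy).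
apply: (@nseq_quasi _ _ _ _ tau M) => // [n|n|n m nm e].
- by rewrite mule_ge0 ?lee_fin// ltW.
- exact: hg.
rewrite leqNgt; apply/negP => Mi.
have : x n <= K * K * C * q ^+ (m - n) * x n.
  apply: (le_trans (t2 n)); rewrite e -!mulrA ler_pM2l//.
  apply: (le_trans (t1' m)); rewrite ler_pM2l// -{1}(subnKC nm) mulrA.
  exact: hx.
rewrite -[leLHS]mul1r ler_pM2r// leNgt => /negP; apply.
apply: le_lt_trans hM; rewrite ler_pM2l ?mulr_gt0//.
by apply: ler_wiXn2l; [exact: q0|exact: ltW|exact: ltnW].
Qed.

Lemma decaying_en : decaying (en R).
Proof.
exists 1, (expR (- 1)); split => //.
  by rewrite expR_gt0/= -[ltRHS]expR0 ltr_expR oppr_lt0.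
by move=> n i; rewrite /en mul1r -expRM_natr -expRD natrD mulN1r opprD addrC.
Qed.

Lemma en_step n : en R n <= expR 1 * en R n.+1.
Proof. by rewrite /en -expRD -natr1 opprD addrCA addrN addr0. Qed.

Lemma tilde_blocks E (L : R) : 0 < L -> exists2 C : R, 0 < C & forall g,
  (forall t, 0 < t -> (0 <= g t)%E) ->
  (forall s t, 0 < s -> 0 < t -> s <= expR 2%:R * t -> t <= expR 2%:R * s -> (g s <= L%:E * g t)%E) ->
  (tilde E `]0%R, 1%R[ g <= C%:E * nseq E (g \o en R))%E /\
  (nseq E (g \o en R) <= C%:E * tilde E `]0%R, 1%R[ g)%E.
Proof.
move=> L0; have e1 : 1 <= expR (2%:R : R) by rewrite -[leLHS]expR0 ler_expR.
have cmp n m t : (n <= m)%N -> (m <= n.+1)%N -> block m t ->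
    t <= expR 2%:R * en R n /\ en R n <= expR 2%:R * t.
  move=> nm mn bt; have t0 := block_gt0 bt; split.
    apply: le_trans (block_le bt) _; apply: le_trans (le_en R nm) _.
    by rewrite ler_peMl// ltW// en_gt0.
  have -> : en R n = expR 2%:R * en R n.+2.
    by rewrite /en -expRD -[n.+2]addn2 natrD opprD addrCA addrN addr0.
  rewrite ler_pM2l ?expR_gt0//; apply: ltW; apply: le_lt_trans (block_lt bt).
  exact: le_en.
have [C C0 h] := tilde_equiv E 0 (coarse_cst (@ltr01 R)) L0.
exists C => // g g0 hg; have := h g (g \o en R); rewrite nseq_mul1 tilde_mul1; apply.
- by move=> n; apply: g0; exact: en_gt0.
- move=> n t bt; have [h1 h2] := cmp n n t (leqnn n) (leqnSn n) bt.
  by rewrite g0 ?(block_gt0 bt)//= hg ?en_gt0 ?(block_gt0 bt).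
- move=> n t; rewrite addn1 => bt; have [h1 h2] := cmp n n.+1 t (leqnSn n) (leqnn _) bt.
  by rewrite /= hg ?en_gt0 ?(block_gt0 bt).
Qed.

(** [K'] depends on the sample points only and is fixed before [L], because the constant L of a
    weight can be named only once the range of dilations is known. *)
Lemma tilde_sequence E x (K : R) : (forall n, 0 < x n) -> decaying x ->
  0 < K -> (forall n, x n <= K * x n.+1) ->
  exists2 K' : R, 0 < K' & forall L : R, 0 < L -> exists2 C : R, 0 < C & forall g,
  (forall t, 0 < t -> (0 <= g t)%E) ->
  (forall s t, 0 < s -> 0 < t -> s <= K' * t -> t <= K' * s -> (g s <= L%:E * g t)%E) ->
  (tilde E `]0%R, 1%R[ g <= C%:E * nseq E (g \o x))%E /\
  (nseq E (g \o x) <= C%:E * tilde E `]0%R, 1%R[ g)%E.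
Proof.
move=> x0 dx K0 xK.
have [K1 K10 [M1 h1]] := seq_reindex (@en_gt0 R) x0 decaying_en dx K0 xK.
have [K2 K20 [M2 h2]] := seq_reindex x0 (@en_gt0 R) dx decaying_en (expR_gt0 1) en_step.
exists (K1 + K2 + expR 2%:R) => [|L L0]; first by rewrite !addr_gt0 ?expR_gt0.
have [C C0 hC] := tilde_blocks E L0.
exists (C * (M1.+1%:R * L) + M2.+1%:R * L * C) => [|g g0 hg].
  by rewrite addr_gt0 ?mulr_gt0 ?ltr0n.
have e0 := expR_gt0 (2%:R : R).
have mono (k : R) : k <= K1 + K2 + expR 2%:R -> forall s t : R, 0 < s -> 0 < t -> s <= k * t ->
    t <= k * s -> (g s <= L%:E * g t)%E.
  move=> kk s t s0 t0 st ts; apply: hg => //; [apply: le_trans st _|apply: le_trans ts _];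
    by rewrite ler_wpM2r// ltW.
have l1 : K1 <= K1 + K2 + expR 2%:R by rewrite -addrA lerDl addr_ge0// ltW.
have l2 : K2 <= K1 + K2 + expR 2%:R by rewrite addrAC lerDr addr_ge0// ltW.
have l3 : expR 2%:R <= K1 + K2 + expR 2%:R by rewrite lerDr addr_ge0// ltW.
have [c1 c2] := hC g g0 (mono _ l3).
have c3 := h1 E g L L0 g0 (mono _ l1); have c4 := h2 E g L L0 g0 (mono _ l2).
have ML k : 0 <= k.+1%:R * L :> R by rewrite mulr_ge0 ?ler0n// ltW.
split.
  apply: le_trans (lee_const_trans (ltW C0) c1 c3) _; apply: lee_wpmul2r.
    by apply: nseq_ge0 => n; exact: g0.
  by rewrite lee_fin lerDl mulr_ge0// ltW.
apply: le_trans (lee_const_trans (ML M2) c4 c2) _; apply: lee_wpmul2r; first exact: tilde_ge0.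
by rewrite lee_fin lerDr mulr_ge0// ltW.
Qed.

End Reindexing.

Section Interpolation.
Variable R : realType.
Variables (Y0 Y1 : fspace R).
Hypothesis Y0_ge0 : forall f, (0 <= fnorm Y0 f)%E.
Hypothesis Y1_ge0 : forall f, (0 <= fnorm Y1 f)%E.

Lemma Kfunctional_ge0 (t : R) f : 0 <= t -> (0 <= Kfunctional Y0 Y1 t f)%E.
Proof.
move=> t0; apply: le_ereal_inf_tmp => _ [f0 [f1 [_ _ _ ->]]].
by rewrite adde_ge0// mule_ge0 ?lee_fin.
Qed.

Lemma Kfunctional_dilate (K s t : R) f : 0 < K -> 0 < s -> 0 < t -> s <= K * t ->
  (Kfunctional Y0 Y1 s f <= (1 + K)%:E * Kfunctional Y0 Y1 t f)%E.
Proof.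
move=> K0 s0 t0 st; apply: lee_mul_ereal_inf => [|_ [f0 [f1 [h0 h1 e ->]]]].
  exact: addr_gt0.
apply: (@le_trans _ _ (fnorm Y0 f0 + s%:E * fnorm Y1 f1)%E).
  by apply: ereal_inf_lbound; exists f0, f1; split.
rewrite ge0_muleDr ?mule_ge0 ?lee_fin ?(ltW t0)//; apply: leeD.
  by rewrite -[leLHS]mul1e; apply: lee_wpmul2r; rewrite ?lee_fin// lerDl ltW.
rewrite muleA -EFinM; apply: lee_wpmul2r => //; rewrite lee_fin; apply: le_trans st _.
by rewrite ler_wpM2r ?(ltW t0)// lerDr.
Qed.

Lemma powRN_dilate (theta K s t : R) : 0 <= theta -> 0 < K -> 0 < s -> 0 < t -> t <= K * s ->
  s `^ (- theta) <= K `^ theta * t `^ (- theta).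
Proof.
move=> th0 K0 s0 t0 ts; rewrite !powRN.
rewrite ler_pdivlMr ?powR_gt0// mulrC ler_pdivrMr ?powR_gt0//.
rewrite -powRM ?(ltW K0) ?(ltW s0)//.
by apply: ge0_ler_powR; rewrite ?nnegrE ?mulr_ge0// ltW.
Qed.

(** Sample points may exceed 1, where b has no prescribed value; [extend1 b] continues it there and
    agrees with b on (0, 1), so the norm itself is unchanged. *)
Lemma interp_norm_equiv (E : ri_space R) (b : R -> R) (theta : R) x (K : R) :
  slowly_varying b -> 0 <= theta -> (forall n, 0 < x n) -> decaying x ->
  0 < K -> (forall n, x n <= K * x n.+1) ->
  equivn (interp_norm Y0 Y1 theta b E) (fun f =>
    nseq E (fun n => (x n `^ (- theta) * extend1 b (x n))%:E * Kfunctional Y0 Y1 (x n) f))%E.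
Proof.
move=> hb th0 x0 dx K0 xK.
have [K' K'0 h] := tilde_sequence E x0 dx K0 xK.
have [C C0 hC] := extend1_ratio hb K'0.
have L0 : 0 < K' `^ theta * C * (1 + K') by rewrite !mulr_gt0 ?powR_gt0 ?addr_gt0.
have [D D0 hD] := h _ L0; exists D => // f.
pose g t := ((t `^ (- theta) * extend1 b t)%:E * Kfunctional Y0 Y1 t f)%E.
have w0 t : 0 < t -> 0 <= t `^ (- theta) * extend1 b t.
  by move=> t0; rewrite mulr_ge0 ?powR_ge0// ltW// extend1_gt0.
have g0 t : 0 < t -> (0 <= g t)%E.
  by move=> t0; rewrite mule_ge0 ?lee_fin ?w0// Kfunctional_ge0// ltW.
have -> : interp_norm Y0 Y1 theta b E f = tilde E `]0%R, 1%R[ g.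
  rewrite /interp_norm /tilde; congr (E (rearrangement _ _)); apply/funext => t.
  rewrite /patch; case: ifPn => //; rewrite inE/= in_itv/= => /andP[t0 t1].
  by rewrite /g /extend1 t1.
apply: (hD g) => // s t s0 t0 st ts.
rewrite /g.
have k0 : (0 <= Kfunctional Y0 Y1 t f)%E by rewrite Kfunctional_ge0// ltW.
have k1 : 0 <= 1 + K' by rewrite addr_ge0// ltW.
apply: (@le_trans _ _ ((s `^ (- theta) * extend1 b s)%:E * ((1 + K')%:E * Kfunctional Y0 Y1 t f))%E).
  by apply: lee_wpmul2l; [rewrite lee_fin w0|exact: Kfunctional_dilate].
rewrite muleA -EFinM [leRHS]muleA -EFinM; apply: lee_wpmul2r => //; rewrite lee_fin.
have -> : K' `^ theta * C * (1 + K') * (t `^ (- theta) * extend1 b t) =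
  (K' `^ theta * t `^ (- theta)) * (C * extend1 b t) * (1 + K') by ring.
rewrite ler_wpM2r//; apply: ler_pM.
- exact: powR_ge0.
- by rewrite ltW// extend1_gt0.
- exact: powRN_dilate.
- exact: hC.
Qed.

End Interpolation.

(** * Identification of the interpolation spaces *)

Section WeightedFunctionals.
Variable R : realType.
Variables (E0 E1 : ri_space R) (s om d phi tau rho : nat -> R) (D r : R).
Hypothesis adm : admissible E0 E1 s om d phi tau rho D r.
Implicit Types (a : nat -> \bar R) (w : nat -> R) (E : ri_space R).

Notation P0 := (P0 E0 s phi).
Notation P1 := (P1 E1 om d tau).
Notation gseq := (gseq s phi).

Definition seq_equiv (N M : (nat -> \bar R) -> \bar R) := exists2 C : R, 0 < C &
  forall a, (forall k, 0 <= a k)%E -> (N a <= C%:E * M a)%E /\ (M a <= C%:E * N a)%E.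

Lemma seq_equiv_le (N M : (nat -> \bar R) -> \bar R) (C : R) : 0 < C ->
  (forall a, (forall k, 0 <= a k)%E -> (0 <= M a)%E) ->
  (forall a, (forall k, 0 <= a k)%E -> (N a <= C%:E * M a)%E) ->
  (forall a, (forall k, 0 <= a k)%E -> (M a <= N a)%E) -> seq_equiv N M.
Proof.
move=> C0 M0 NM MN; exists (C + 1) => [|a a0]; first exact: addr_gt0.
have m0 := M0 a a0; have n0 := le_trans m0 (MN a a0); split.
  by apply: le_trans (NM a a0) _; apply: lee_wpmul2r => //; rewrite lee_fin lerDl.
apply: le_trans (MN a a0) _; rewrite -[leLHS]mul1e; apply: lee_wpmul2r => //.
by rewrite lee_fin lerDr ltW.
Qed.

Definition Knorm E w a := nseq E (fun n => (w n)%:E * (P0 a n + (rho n)%:E * P1 a n))%E.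

Lemma Knorm_split E w a : (forall n, 0 < w n) -> (forall k, 0 <= a k)%E ->
  (Knorm E w a <= nseq E (fun n => (w n)%:E * P0 a n) +
                  nseq E (fun n => (w n * rho n)%:E * P1 a n))%E.
Proof.
move=> w0 a0; have p0 n := P0_ge0 n adm a0; have p1 n := P1_ge0 n adm a0.
have w0' n := ltW (w0 n); have r0 n := ltW (adm_rho0 adm n).
have x0 n : (0 <= (w n)%:E * P0 a n)%E by rewrite mule_ge0 ?lee_fin.
have y0 n : (0 <= (w n * rho n)%:E * P1 a n)%E by rewrite mule_ge0 ?lee_fin ?mulr_ge0.
apply: le_trans (nseqD E x0 y0); apply: nseq_le; first exact: ri_monotone.
  by move=> n; rewrite mule_ge0 ?lee_fin// adde_ge0// mule_ge0 ?lee_fin.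
move=> n; rewrite ge0_muleDr ?mule_ge0 ?lee_fin//.
by rewrite muleA -EFinM.
Qed.

Lemma Knorm_ge0 E w a n : (forall n, 0 < w n) -> (forall k, 0 <= a k)%E ->
  (0 <= (w n)%:E * P0 a n /\ (w n)%:E * P0 a n <= (w n)%:E * (P0 a n + (rho n)%:E * P1 a n))%E.
Proof.
move=> w0 a0; have p0 := P0_ge0 n adm a0; have p1 := P1_ge0 n adm a0.
have wn : (0 <= (w n)%:E)%E by rewrite lee_fin ltW.
split; first exact: mule_ge0.
apply: lee_wpmul2l => //; rewrite leeDl// mule_ge0// lee_fin; exact/ltW/(adm_rho0 adm).
Qed.

Lemma Knorm_P0_le E w a : (forall n, 0 < w n) -> (forall k, 0 <= a k)%E ->
  (nseq E (fun n => (w n)%:E * P0 a n) <= Knorm E w a)%E.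
Proof.
move=> w0 a0; apply: nseq_le; first exact: ri_monotone.
  by move=> n; exact: (Knorm_ge0 E n w0 a0).1.
by move=> n; exact: (Knorm_ge0 E n w0 a0).2.
Qed.

Lemma Knorm_P1_le E w a : (forall n, 0 < w n) -> (forall k, 0 <= a k)%E ->
  (nseq E (fun n => (w n * rho n)%:E * P1 a n) <= Knorm E w a)%E.
Proof.
move=> w0 a0; have p0 n := P0_ge0 n adm a0; have p1 n := P1_ge0 n adm a0.
have w0' n := ltW (w0 n); have r0 n := ltW (adm_rho0 adm n).
apply: nseq_le; first exact: ri_monotone.
  by move=> n; rewrite mule_ge0 ?lee_fin ?mulr_ge0.
move=> n; rewrite EFinM -muleA; apply: lee_wpmul2l; first by rewrite lee_fin.
by rewrite leeDr.
Qed.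

Lemma nseq_gseq_le E w a : (forall n, 0 < w n) -> (forall k, 0 <= a k)%E ->
  (nseq E (fun n => (w n)%:E * gseq a n) <= nseq E (fun n => (w n)%:E * P0 a n))%E.
Proof.
move=> w0 a0; apply: nseq_le; first exact: ri_monotone.
  by move=> n; apply: mule_ge0; [rewrite lee_fin ltW|exact: (gseq_ge0 adm a0 n)].
move=> n; apply: lee_wpmul2l; first by rewrite lee_fin ltW.
exact: gseq_le_P0 adm a0.
Qed.

Lemma nseq_gseq_le_P1 E w a : (forall n, 0 < w n) -> (forall k, 0 <= a k)%E ->
  (nseq E (fun n => (w n)%:E * gseq a n) <= nseq E (fun n => (w n * rho n)%:E * P1 a n))%E.
Proof.
move=> w0 a0; have w0' n := ltW (w0 n); have r0 n := ltW (adm_rho0 adm n); apply: nseq_le; first exact: ri_monotone.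
  by move=> n; apply: mule_ge0; [rewrite lee_fin ltW|exact: (gseq_ge0 adm a0 n)].
move=> n; rewrite (gseqE adm) [leLHS]muleA -EFinM; apply: lee_wpmul2l.
  by rewrite lee_fin mulr_ge0.
exact: hseq_le_P1 adm a0.
Qed.

Lemma weight_gseq E w a : nseq E (fun n => (w n * rho n)%:E * hseq om tau a n)%E =
  nseq E (fun n => (w n)%:E * gseq a n)%E.
Proof.
by congr nseq; apply/funext => n; rewrite (gseqE adm) [RHS]muleA -EFinM.
Qed.

(** Decay of w rho bounds the P1 part by the norm of w rho h = w g, and g_n <= P0_n. *)
Lemma Knorm_P0 E w (C q : R) : (forall n, 0 < w n) -> 0 < C -> 0 < q < 1 ->
  (forall n i, w (n + i)%N * rho (n + i)%N <= C * (q ^+ i * (w n * rho n))) ->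
  seq_equiv (Knorm E w) (fun a => nseq E (fun n => (w n)%:E * P0 a n)%E).
Proof.
move=> w0 C0 q01 wd; have wr0 n : 0 < w n * rho n by rewrite mulr_gt0 ?(adm_rho0 adm).
have [C' C'0 h] := hardy_right adm wr0 C0 q01 wd.
apply: (@seq_equiv_le _ _ (1 + C')) => [|a a0|a a0|a a0]; first by rewrite addr_gt0.
- by apply: nseq_ge0 => n; exact: (Knorm_ge0 E n w0 a0).1.
- apply: le_trans (Knorm_split E w0 a0) _.
  rewrite EFinD ge0_muleDl ?lee_fin ?(ltW C'0)// mul1e; apply: leeD => //.
  apply: le_trans (h E a a0) _; apply: lee_wpmul2l; first by rewrite lee_fin ltW.
  by rewrite weight_gseq; exact: nseq_gseq_le.
- exact: Knorm_P0_le.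
Qed.

(** Growth of w bounds the P0 part by the norm of w g = w rho h, and h_n <= P1_n. *)
Lemma Knorm_P1 E w (C q : R) : (forall n, 0 < w n) -> 0 < C -> 0 < q < 1 ->
  (forall n i, w n <= C * (q ^+ i * w (n + i)%N)) ->
  seq_equiv (Knorm E w) (fun a => nseq E (fun n => (w n * rho n)%:E * P1 a n)%E).
Proof.
move=> w0 C0 q01 wd; have wr0 n : 0 < w n * rho n by rewrite mulr_gt0 ?(adm_rho0 adm).
have [C' C'0 h] := hardy_left adm w0 C0 q01 wd.
apply: (@seq_equiv_le _ _ (C' + 1)) => [|a a0|a a0|a a0]; first by rewrite addr_gt0.
- by apply: nseq_ge0 => n; rewrite mule_ge0 ?(P1_ge0 n adm a0)// lee_fin ltW.
- apply: le_trans (Knorm_split E w0 a0) _.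
  rewrite EFinD ge0_muleDl ?lee_fin ?(ltW C'0)// mul1e; apply: leeD => //.
  apply: le_trans (h E a a0) _; apply: lee_wpmul2l; first by rewrite lee_fin ltW.
  exact: nseq_gseq_le_P1.
- exact: Knorm_P1_le.
Qed.

Lemma Knorm_gseq E w (C q C1 q1 : R) : (forall n, 0 < w n) -> 0 < C -> 0 < q < 1 ->
  0 < C1 -> 0 < q1 < 1 ->
  (forall n i, w n <= C * (q ^+ i * w (n + i)%N)) ->
  (forall n i, w (n + i)%N * rho (n + i)%N <= C1 * (q1 ^+ i * (w n * rho n))) ->
  seq_equiv (Knorm E w) (fun a => nseq E (fun n => (w n)%:E * gseq a n)%E).
Proof.
move=> w0 C0 q01 C10 q101 wd wd1.
have wr0 n : 0 < w n * rho n by rewrite mulr_gt0 ?(adm_rho0 adm).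
have [C' C'0 h] := hardy_left adm w0 C0 q01 wd.
have [C'1 C'10 h1] := hardy_right adm wr0 C10 q101 wd1.
apply: (@seq_equiv_le _ _ (C' + C'1)) => [|a a0|a a0|a a0]; first by rewrite addr_gt0.
- by apply: nseq_ge0 => n; rewrite mule_ge0 ?(gseq_ge0 adm a0)// lee_fin ltW.
- apply: le_trans (Knorm_split E w0 a0) _.
  rewrite EFinD ge0_muleDl ?lee_fin ?(ltW C'0) ?(ltW C'10)//; apply: leeD; first exact: h.
  by rewrite -(weight_gseq E w a); exact: h1.
- exact: le_trans (nseq_gseq_le E w0 a0) (Knorm_P0_le E w0 a0).
Qed.

(** P0 at index 0 contains the full B norm, the restriction k >= 0 being void, and the single entry
    n = 0 of the sequence already controls it. This puts f in the larger endpoint space, as the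
    interpolation space demands. *)
Lemma Knorm_normB_lty E w a : (forall n, 0 < w n) -> (forall k, 0 <= a k)%E ->
  (Knorm E w a < +oo)%E -> (normB E0 s a < +oo)%E.
Proof.
move=> w0 a0 fin.
have wP n := (Knorm_ge0 E n w0 a0).1.
pose c k : \bar R := (if (k < 1)%N then 1 else 0)%E.
have c0 k : (0 <= c k)%E by rewrite /c; case: ifP.
have h : (window E 1 * ((w 0%N)%:E * P0 a 0) <= Knorm E w a)%E.
  apply: le_trans (Knorm_P0_le E w0 a0); apply: (nseq_cst_le c0 (window_gt0 E 0)) => // k.
  by rewrite /c ltnS leqn0; case: eqP => [->|_]; rewrite ?mul1e ?mul0e.
have P0f : (P0 a 0 < +oo)%E.
  rewrite ltey; apply/eqP => e; move: h; rewrite e gt0_muley ?lte_fin// gt0_muley ?window_gt0//.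
  by rewrite leye_eq => /eqP e'; rewrite e' in fin.
apply: le_lt_trans P0f; rewrite /P0.
apply: (@le_trans _ _ (P0a E0 s a 0)); first by rewrite /P0a /normB; apply: nseq_le; [exact: ri_monotone|move=> k; rewrite Sseq_ge0// => j; exact/ltW/(adm_s0 adm)|].
rewrite leeDl// mule_ge0 ?lee_fin ?(ltW (phi_gt0 adm 0))// Sseq_ge0// => k; exact/ltW/(adm_s0 adm).
Qed.

End WeightedFunctionals.

Section Identification.
Variable R : realType.
Notation meas01 := (measurable_fun (`]0, 1[ : set R)).

(** Restricted to measurable f, because the estimates of the K-functional split and truncate
    measurable functions. *)
Definition equiv_on (N M : (R -> R) -> \bar R) := exists2 C : R, 0 < C &
  forall f, meas01 f -> (N f <= C%:E * M f)%E /\ (M f <= C%:E * N f)%E.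

Lemma equivn_on N M : equivn N M -> equiv_on N M.
Proof. by move=> [C C0 h]; exists C => // f _. Qed.

Lemma equiv_on_sym N M : equiv_on N M -> equiv_on M N.
Proof. by move=> [C C0 h]; exists C => // f /h[]. Qed.

Lemma equiv_on_trans N M P : equiv_on N M -> equiv_on M P -> equiv_on N P.
Proof.
move=> [C C0 h] [D D0 k]; exists (C * D) => [|f mf]; first exact: mulr_gt0.
have [h1 h2] := h f mf; have [k1 k2] := k f mf; split.
  exact: lee_const_trans (ltW C0) h1 k1.
by rewrite mulrC; exact: lee_const_trans (ltW D0) k2 h2.
Qed.

Lemma seq_equiv_on (N M : (nat -> \bar R) -> \bar R) :
  seq_equiv N M -> equiv_on (N \o @fseq R) (M \o @fseq R).
Proof. by move=> [C C0 h]; exists C => // f _; apply: h; exact: fseq_ge0. Qed.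

(** An intersection is normed by a maximum, whereas P0 and P1 are sums; monotonicity and the
    triangle inequality make the two comparable. *)
Lemma equivn_max_nseqD (E : ri_space R) (N N' : (R -> R) -> \bar R) (X Y : (R -> R) -> nat -> \bar R) :
  (forall f n, 0 <= X f n)%E -> (forall f n, 0 <= Y f n)%E ->
  (forall f, 0 <= N f)%E -> (forall f, 0 <= N' f)%E ->
  equivn N (fun f => nseq E (X f)) -> equivn N' (fun f => nseq E (Y f)) ->
  equivn (fun f => maxe (N f) (N' f)) (fun f => nseq E (fun n => X f n + Y f n))%E.
Proof.
move=> X0 Y0 N0 N'0 [C C0 h] [D D0 k]; exists (C + D) => [|f]; first exact: addr_gt0.
have [h1 h2] := h f; have [k1 k2] := k f.
have CD : C <= C + D /\ D <= C + D by rewrite lerDl lerDr !ltW.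
split; first rewrite ge_max; first (apply/andP; split).
- apply: le_trans h1 _; apply: lee_pmul; rewrite ?lee_fin ?(ltW C0) ?nseq_ge0 ?CD.1//.
  by apply: nseq_le; [exact: ri_monotone|exact: X0|move=> n; rewrite leeDl].
- apply: le_trans k1 _; apply: lee_pmul; rewrite ?lee_fin ?(ltW D0) ?nseq_ge0 ?CD.2//.
  by apply: nseq_le; [exact: ri_monotone|exact: Y0|move=> n; rewrite leeDr].
- apply: le_trans (nseqD E (X0 f) (Y0 f)) _.
  rewrite EFinD ge0_muleDl ?lee_fin ?(ltW C0) ?(ltW D0)//; apply: leeD.
    by apply: le_trans h2 _; apply: lee_wpmul2l; rewrite ?lee_fin ?(ltW C0)// le_max lexx.
  by apply: le_trans k2 _; apply: lee_wpmul2l; rewrite ?lee_fin ?(ltW D0)// le_max lexx orbT.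
Qed.

Lemma same_space_interp (Y0 Y1 X : fspace R) (theta : R) b E :
  (forall f, carrier X f <-> meas01 f /\ (fnorm X f < +oo)%E) ->
  (forall f, carrier Y0 f <-> meas01 f /\ (fnorm Y0 f < +oo)%E) ->
  equiv_on (interp_norm Y0 Y1 theta b E) (fnorm X) ->
  (forall f, meas01 f -> (interp_norm Y0 Y1 theta b E f < +oo)%E -> (fnorm Y0 f < +oo)%E) ->
  same_space (interp Y0 Y1 theta b E) X.
Proof.
move=> cX cY [C C0 h] fin; split; last by exists C => // f [/cY[mf _] _]; exact: h.
apply/seteqP; split=> f /=.
  move=> [/cY[mf _] nf]; apply/cX; split => //.
  by apply: le_lt_trans (h f mf).2 _; rewrite lte_mul_pinfty ?lee_fin ?(ltW C0).
move=> /cX[mf nf].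
have nf' : (interp_norm Y0 Y1 theta b E f < +oo)%E.
  by apply: le_lt_trans (h f mf).1 _; rewrite lte_mul_pinfty ?lee_fin ?(ltW C0).
by split => //; apply/cY; split => //; exact: fin.
Qed.

Lemma fspaceI_carrier (N M : (R -> R) -> \bar R) f :
  carrier (fspaceI (finite_norm_space N) (finite_norm_space M)) f <->
  meas01 f /\ (maxe (N f) (M f) < +oo)%E.
Proof.
rewrite gt_max; split => [[[mf nf] [_ nf']]|[mf /andP[nf nf']]]; first by rewrite nf nf'.
by split; split.
Qed.

Variables (E E0 E1 : ri_space R) (b : R -> R) (p0 p1 alpha beta : R).
Hypothesis hb : slowly_varying b.
Hypothesis hp0 : 1 < p0.
Hypothesis hp01 : p0 < p1.
Hypothesis halpha : alpha < 1.
Hypothesis hbeta : beta < 1.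
Hypothesis hE1 : (E1 (fun u => ((1 + u) `^ (beta - 1))%:E) < +oo)%E.

Notation Y0 := (Bsp p0 alpha E0).
Notation Y1 := (Asp p1 beta E1).
Notation sv := (weight p0 (fun t => ell t `^ (alpha - 1)) \o en R).
Notation ov := (weight p1 (fun=> 1) \o en R).
Notation phiv := (fundamental_ell E0 \o en R).
Notation tauv := (tail_norm beta E1 \o en R).
Notation rv := (rs E0 E1 p0 p1 alpha beta).
Notation b_rho := (extend1 b \o rho p0 p1 alpha beta E0 E1).

Definition interp_weight theta n : R := rv n `^ (- theta) * extend1 b (rv n).
Notation iw := interp_weight.
Notation KN theta := (Knorm E0 E1 sv ov (dseq beta) phiv tauv rv E (iw theta)).

Lemma rv_gt0 n : 0 < rv n. Proof. exact: rs_gt0. Qed.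

Lemma interp_weight_gt0 theta n : 0 < iw theta n.
Proof. by rewrite mulr_gt0 ?powR_gt0 ?extend1_gt0 ?rv_gt0. Qed.

Lemma interp_weight_rho theta n : iw theta n * rv n = rv n `^ (1 - theta) * extend1 b (rv n).
Proof.
rewrite /iw mulrAC; congr (_ * _); rewrite -{2}(powRr1 (ltW (rv_gt0 n))) -powRD ?(addrC (- theta))//.
by apply/implyP => _; rewrite gt_eqF// rv_gt0.
Qed.

Lemma interp_weight_rho_decay theta (C r : R) :
  (forall n i, rv (n + i)%N `^ (1 - theta) * extend1 b (rv (n + i)%N) <=
    C * (r ^+ i * (rv n `^ (1 - theta) * extend1 b (rv n)))) ->
  forall n i, iw theta (n + i)%N * rv (n + i)%N <= C * (r ^+ i * (iw theta n * rv n)).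
Proof.
have e (x x' y y' q : R) : x = x' -> y = y' -> x' <= C * (q * y') -> x <= C * (q * y).
  by move=> -> ->.
by move=> h n i; exact: e (interp_weight_rho theta (n + i)) (interp_weight_rho theta n) (h n i).
Qed.

Lemma interp_norm_Knorm (theta : R) : 0 <= theta ->
  equiv_on (interp_norm Y0 Y1 theta b E) (KN theta \o @fseq R).
Proof.
move=> th0; have [C [r [C0 r01 hr]]] := rs_decay E0 hp0 hp01 halpha hbeta hE1.
have [K K0 hK] := rs_step E0 p0 p1 alpha hbeta hE1.
have dx : decaying rv by exists C, r.
have e := interp_norm_equiv (@fnorm_Bsp_ge0 R E0 p0 alpha) (@fnorm_Asp_ge0 R E1 p1 beta)
  E hb th0 rv_gt0 dx K0 (fun n => (hK n).1).
apply: equiv_on_trans (equivn_on e) _.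
have [A A0 hA] := Kfunctional_le E0 hp0 hp01 halpha hbeta hE1.
have [B B0 hB] := Kfunctional_ge E0 hp0 hp01 halpha hbeta hE1.
have [D [q adm]] := admissible_rs E0 hp0 hp01 halpha hbeta hE1.
exists (A + B) => [|f mf]; first exact: addr_gt0.
have a0 := fseq_ge0 f.
have w0 n : (0 <= (iw theta n)%:E)%E by rewrite lee_fin ltW ?interp_weight_gt0.
have x0 n : (0 <= (iw theta n)%:E * Kfunctional Y0 Y1 (rv n) f)%E.
  apply: mule_ge0 => //; apply: Kfunctional_ge0; last exact: ltW (rv_gt0 n).
    exact: fnorm_Bsp_ge0.
  exact: fnorm_Asp_ge0.
have y0 n : (0 <= (iw theta n)%:E * (P0 E0 sv phiv (fseq f) n +
    (rv n)%:E * P1 E1 ov (dseq beta) tauv (fseq f) n))%E.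
  apply: mule_ge0 => //; apply: adde_ge0; first exact: P0_ge0 adm a0.
  by apply: mule_ge0; [rewrite lee_fin ltW ?rv_gt0|exact: P1_ge0 adm a0].
have AB : A <= A + B by rewrite lerDl ltW.
have BA : B <= A + B by rewrite lerDr ltW.
rewrite /= /Knorm; split.
  apply: (@le_trans _ _ (A%:E * nseq E (fun n => (iw theta n)%:E * (P0 E0 sv phiv (fseq f) n +
    (rv n)%:E * P1 E1 ov (dseq beta) tauv (fseq f) n)))%E).
    rewrite -(nseqZ E (ltW A0) y0); apply: nseq_le => //; first exact: ri_monotone.
    by move=> n; rewrite [leRHS]muleCA; apply: lee_wpmul2l; [exact: w0|exact: (hA f n mf)].
  by apply: lee_wpmul2r; [exact: nseq_ge0|rewrite lee_fin].
apply: (@le_trans _ _ (B%:E * nseq E (fun n => (iw theta n)%:E * Kfunctional Y0 Y1 (rv n) f))%E).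
  rewrite -(nseqZ E (ltW B0) x0); apply: nseq_le => //; first exact: ri_monotone.
  by move=> n; rewrite [leRHS]muleCA; apply: lee_wpmul2l; [exact: w0|exact: (hB f n mf)].
by apply: lee_wpmul2r; [exact: nseq_ge0|rewrite lee_fin].
Qed.

Lemma interp_norm_lty (theta : R) f : 0 <= theta -> meas01 f ->
  (interp_norm Y0 Y1 theta b E f < +oo)%E -> (fnorm Y0 f < +oo)%E.
Proof.
move=> th0 mf nf; have [D [q adm]] := admissible_rs E0 hp0 hp01 halpha hbeta hE1.
have [C C0 h] := interp_norm_Knorm th0; have [B B0 hB] := Bsp_normB E0 hp0 halpha.
have kf : (KN theta (fseq f) < +oo)%E.
  by apply: le_lt_trans (h f mf).2 _; rewrite lte_mul_pinfty ?lee_fin ?(ltW C0).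
apply: le_lt_trans (hB f).1 _; rewrite lte_mul_pinfty ?lee_fin ?(ltW B0)//.
exact: (Knorm_normB_lty adm (interp_weight_gt0 theta) (fseq_ge0 f) kf).
Qed.

Lemma coarse_pow_ell : coarse (fun t : R => ell t `^ (alpha - 1)). Proof. exact: coarse_ell_powR. Qed.

(** As 1/p = 1/p0 - theta (1/p0 - 1/p1), inserting rho into rho^-theta phi s collects the powers of
    u into u^(1/p), leaves ell^(alpha-1) phi with exponent 1 - theta and returns the tail norm with
    exponent theta. *)
Lemma interp_weight_gseq theta p n : p^-1 = (1 - theta) / p0 + theta / p1 ->
  iw theta n * (phiv n * sv n) = en R n `^ p^-1 *
    ((ell (en R n) `^ (alpha - 1) * phiv n) `^ (1 - theta) * tauv n `^ theta * b_rho (en R n)).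
Proof.
move=> hp; have t0 := tail_norm_en_gt0 hbeta hE1 n; have x0 := en_gt0 R n.
have f0 := fundamental_ell_gt0 E0 (en R n); have l0 : 0 < ell (en R n) `^ (alpha - 1).
  by apply: coarse_pow_ell.1; exact: en_itv.
have e : p^-1 = p0^-1 + (p0^-1 - p1^-1) * - theta by rewrite hp; ring.
rewrite /iw /rs /rho /weight /= e.
move: (extend1 b _) l0 f0 t0 => w; move: (ell _ `^ _) (fundamental_ell _ _) (tail_norm _ _ _).
move=> l f t l0 f0 t0.
rewrite [in RHS]powRD; last by apply/implyP => _; rewrite gt_eqF.
rewrite (powRrM (en R n)) [in LHS]powRM ?powR_ge0//; last by rewrite divr_ge0 ?mulr_ge0 ?ltW.
rewrite [in LHS](@powRM _ (l * f)) ?mulr_ge0 ?invr_ge0 ?(ltW l0) ?(ltW f0) ?(ltW t0)//.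
have -> : t^-1 `^ (- theta) = t `^ theta 
  by rewrite -(powR_inv1 (ltW t0)) -powRrM mulN1r opprK.
have -> : (l * f) `^ (1 - theta) = (l * f) * (l * f) `^ (- theta).
  by rewrite powRD ?powRr1 ?mulr_ge0 ?(ltW l0) ?(ltW f0)//; apply/implyP => _; rewrite gt_eqF ?mulr_gt0.
ring.
Qed.

Lemma interp_inner (theta p : R) : 0 < theta < 1 -> p^-1 = (1 - theta) / p0 + theta / p1 ->
  equiv_on (interp_norm Y0 Y1 theta b E)
    (fnorm (Lsp p (fun u =>
             (ell u `^ (alpha - 1) * fundamental_ell E0 u) `^ (1 - theta) *
             tail_norm beta E1 u `^ theta * b_rho u) E)).
Proof.
move=> /andP[th0 th1] hp; apply: equiv_on_trans (interp_norm_Knorm (ltW th0)) _.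
have th1' : 0 < 1 - theta by rewrite subr_gt0.
have [D [q adm]] := admissible_rs E0 hp0 hp01 halpha hbeta hE1.
have [C [r [C0 r01 wd]]] := rs_negative_decay E0 hb hp0 hp01 halpha hbeta hE1 th0.
have [C1 [r1 [C10 r101 wd1]]] := rs_positive_decay E0 hb hp0 hp01 halpha hbeta hE1 th1'.
have wd1' := interp_weight_rho_decay wd1.
have k := Knorm_gseq adm E (interp_weight_gt0 theta) C0 r01 C10 r101 wd wd1'.
apply: equiv_on_trans (seq_equiv_on k) _; apply: equiv_on_sym; apply: equivn_on.
have cB : coarse (fun u => (ell u `^ (alpha - 1) * fundamental_ell E0 u) `^ (1 - theta) *
             tail_norm beta E1 u `^ theta * b_rho u).
  apply: coarseM; last exact: coarse_b_rho.
  apply: coarseM; last by apply: coarse_powR; exact: coarse_tail_norm.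
  by apply: coarse_powR; apply: coarseM; [exact: coarse_ell_powR|exact: coarse_fundamental_ell].
have [B B0 h] := Lsp_equiv p E cB; exists B; first exact: B0.
move=> f.
suff -> : ((fun a => nseq E (fun n => (iw theta n)%:E * gseq sv phiv a n)) \o @fseq R)%E f =
  nseq E (fun n => (en R n `^ p^-1 * ((ell (en R n) `^ (alpha - 1) * phiv n) `^ (1 - theta) *
      tauv n `^ theta * b_rho (en R n)))%:E * fseq f n)%E by exact: h.
rewrite /=; congr nseq; apply/funext => n.
by rewrite /gseq muleA -EFinM (interp_weight_gseq n hp).
Qed.

(** At theta = 0 the product w rho = rho b(rho) still decays geometrically, so P0 remains. Its
    summand phi S is the [LL] norm, and the E0 norm of the tail of S is the [LLL] norm. *)
Lemma interp_zero : equiv_on (interp_norm Y0 Y1 0 b E)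
  (fnorm (fspaceI
          (LL p0 (fun u => fundamental_ell E0 u * b_rho u) E
              (fun u => ell u `^ (alpha - 1)) (Lq +oo%E))
          (LLL p0 b_rho E (fun=> 1) E0
               (fun u => ell u `^ (alpha - 1)) (Lq +oo%E)))).
Proof.
apply: equiv_on_trans (interp_norm_Knorm (lexx 0)) _.
have [D [q adm]] := admissible_rs E0 hp0 hp01 halpha hbeta hE1.
have [C1 [r1 [C10 r101 wd1]]] := rs_positive_decay E0 hb hp0 hp01 halpha hbeta hE1 (@ltr01 R).
rewrite -{1 2}(subr0 1) in wd1; have wd1' := interp_weight_rho_decay wd1.
have k := Knorm_P0 adm E (interp_weight_gt0 0) C10 r101 wd1'.
apply: equiv_on_trans (seq_equiv_on k) _; apply: equiv_on_sym; apply: equivn_on.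
have cb : coarse b_rho by exact: coarse_b_rho.
have c1 : coarse (fun u => fundamental_ell E0 u * b_rho u).
  by apply: coarseM => //; exact: coarse_fundamental_ell.
have h1 := LL_equiv p0 E c1 coarse_pow_ell.
have h2 := LLL_equiv p0 E E0 cb (coarse_cst (@ltr01 R)) coarse_pow_ell.
have i0 n : iw 0 n = b_rho (en R n) by rewrite /iw oppr0 powRr0 mul1r.
have S0 f n : (0 <= Sseq sv (fseq f) n)%E.
  by apply: Sseq_ge0 => j; [exact/ltW/(adm_s0 adm)|exact: fseq_ge0].
have ph0 n : 0 <= phiv n := ltW (phi_gt0 adm n).
have -> : (fun a => nseq E (fun n => (iw 0 n)%:E * P0 E0 sv phiv a n)%E) \o @fseq R =
  (fun f => nseq E (fun n =>
    ((phiv n * b_rho (en R n))%:E * Sseq sv (fseq f) n) + (b_rho (en R n))%:E *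
    nseq E0 (fun k => 1%:E * (if (n <= k)%N then Sseq sv (fseq f) k else 0))))%E.
  apply/funext => f; congr nseq; apply/funext => n; rewrite /P0 i0 nseq_mul1 addeC ge0_muleDr.
  - congr (_ + _)%E; rewrite [LHS]muleA -EFinM; congr (_%:E * _)%E; exact: mulrC.
  - by apply: mule_ge0; [rewrite lee_fin ph0|exact: S0].
  - exact: nseq_ge0.
have b0 n : 0 <= b_rho (en R n) by rewrite ltW// cb.1// en_itv.
apply: equivn_max_nseqD h1 h2 => [f n|f n|f|f]; [| |exact: tilde_ge0|exact: tilde_ge0].
  by apply: mule_ge0; [rewrite lee_fin mulr_ge0 ?ph0 ?b0|exact: S0].
by apply: mule_ge0; [rewrite lee_fin b0|exact: nseq_ge0].
Qed.

(** At theta = 1 the weight w = b(rho)/rho still grows geometrically, so P1 remains with weight w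
    rho = b(rho). Its summand tau T is the [LR] norm, and the E1 norm of the head of d T is the
    [LRR] norm. *)
Lemma interp_one : equiv_on (interp_norm Y0 Y1 1 b E)
  (fnorm (fspaceI
          (LR p1 (fun u => tail_norm beta E1 u * b_rho u) E
              (fun=> 1) (Lq 1%E))
          (LRR p1 b_rho E (fun u => ell u `^ (beta - 1)) E1
               (fun=> 1) (Lq 1%E)))).
Proof.
apply: equiv_on_trans (interp_norm_Knorm ler01) _.
have [D [q adm]] := admissible_rs E0 hp0 hp01 halpha hbeta hE1.
have [C [r [C0 r01 wd]]] := rs_negative_decay E0 hb hp0 hp01 halpha hbeta hE1 (@ltr01 R).
have k := Knorm_P1 adm E (interp_weight_gt0 1) C0 r01 wd.
apply: equiv_on_trans (seq_equiv_on k) _; apply: equiv_on_sym; apply: equivn_on.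
have cb : coarse b_rho by exact: coarse_b_rho.
have cc := coarse_cst (@ltr01 R).
have c1 : coarse (fun u => tail_norm beta E1 u * b_rho u).
  by apply: coarseM => //; exact: coarse_tail_norm.
have h1 := LR_equiv p1 E c1 cc.
have h2 := LRR_equiv p1 E E1 cb (coarse_ell_powR (beta - 1)) cc.
have i0 n : iw 1 n * rv n = b_rho (en R n) by rewrite (interp_weight_rho 1 n) subrr powRr0 mul1r.
have T0 f n : (0 <= Tseq ov (fseq f) n)%E.
  by apply: Tseq_ge0 => j; [exact/ltW/(adm_om0 adm)|exact: fseq_ge0].
have t0 n : 0 <= tauv n := ltW (adm_tau0 adm n).
have -> : (fun a => nseq E (fun n => (iw 1 n * rv n)%:E * P1 E1 ov (dseq beta) tauv a n)%E) \o @fseq R =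
  (fun f => nseq E (fun n =>
    ((tauv n * b_rho (en R n))%:E * Tseq ov (fseq f) n) + (b_rho (en R n))%:E *
    nseq E1 (fun k => (dseq beta k)%:E * (if (k <= n)%N then Tseq ov (fseq f) k else 0))))%E.
  apply/funext => f; congr nseq; apply/funext => n; rewrite /P1 i0 ge0_muleDr.
  - congr (_ + _)%E; rewrite [LHS]muleA -EFinM; congr (_%:E * _)%E; exact: mulrC.
  - by apply: mule_ge0; [rewrite lee_fin t0|exact: T0].
  - exact: nseq_ge0.
have b0 n : 0 <= b_rho (en R n) by rewrite ltW// cb.1// en_itv.
apply: equivn_max_nseqD h1 h2 => [f n|f n|f|f]; [| |exact: tilde_ge0|exact: tilde_ge0].
  by apply: mule_ge0; [rewrite lee_fin mulr_ge0 ?t0 ?b0|exact: T0].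
by apply: mule_ge0; [rewrite lee_fin b0|exact: nseq_ge0].
Qed.

End Identification.

Theorem corollary5p18 (R : realType) (E E0 E1 : ri_space R) (b : R -> R)
    (p0 p1 alpha beta : R)
    (hb : slowly_varying b)
    (hp0 : 1 < p0) (hp01 : p0 < p1)
    (halpha : alpha < 1) (hbeta : beta < 1)
    (hE1 : (E1 (fun u => ((1 + u) `^ (beta - 1))%:E) < +oo)%E) :
  let Y0 := Bsp p0 alpha E0 in
  let Y1 := Asp p1 beta E1 in
  let b_rho := extend1 b \o rho p0 p1 alpha beta E0 E1 in
  [/\ forall theta p : R, 0 < theta < 1 ->
        p^-1 = (1 - theta) / p0 + theta / p1 ->
        same_space (interp Y0 Y1 theta b E)
          (Lsp p (fun u =>
             (ell u `^ (alpha - 1) * fundamental_ell E0 u) `^ (1 - theta) *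
             tail_norm beta E1 u `^ theta * b_rho u) E),
      same_space (interp Y0 Y1 0 b E)
        (fspaceI
          (LL p0 (fun u => fundamental_ell E0 u * b_rho u) E
              (fun u => ell u `^ (alpha - 1)) (Lq +oo%E))
          (LLL p0 b_rho E (fun=> 1) E0
               (fun u => ell u `^ (alpha - 1)) (Lq +oo%E))) &
      (tilde E `]0%R, 1%R[ (EFin \o b) < +oo)%E ->
      same_space (interp Y0 Y1 1 b E)
        (fspaceI
          (LR p1 (fun u => tail_norm beta E1 u * b_rho u) E
              (fun=> 1) (Lq 1%E))
          (LRR p1 b_rho E (fun u => ell u `^ (beta - 1)) E1
               (fun=> 1) (Lq 1%E)))].
Proof.
move=> Y0 Y1 b_rho.
have lty theta f := @interp_norm_lty R E E0 E1 b p0 p1 alpha beta hb hp0 hp01 halpha hbeta hE1 theta f.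
split.
- move=> theta p th01 hp; apply: same_space_interp => // [|f].
    exact: interp_inner.
  by apply: lty; case/andP: th01 => /ltW.
- apply: same_space_interp => // [f||f]; first exact: fspaceI_carrier.
    exact: interp_zero.
  exact: lty.
- move=> _; apply: same_space_interp => // [f||f]; first exact: fspaceI_carrier.
    exact: interp_one.
  exact: lty.
Qed.
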